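(* Let $1<p<\infty$, let $(\lambda_n)_{n\geq 1}$ be a sequence in the open unit disk $\mathbb{D}$, and let $B_0=1$ and $B_n(z)=\prod_{k=1}^n \frac{\lambda_k-z}{1-\overline{\lambda}_k z}$ for $n\ge 1$. Then $(B_n)_{n\geq 0}$ is a Schauder basis for the Hardy space $H^p$ if and only if $\sup_{n\geq 1}|\lambda_n|<1$.
   Context: $H^p$ is the Hardy space of analytic functions $f$ on $\mathbb{D}$ with $\|f\|_p=\sup_{0<r<1}\left(\frac{1}{2\pi}\int_0^{2\pi}|f(re^{it})|^p\,dt\right)^{1/p}<\infty$. A sequence $(x_n)_{n\ge 0}$ in a complex topological linear space $\mathcal{X}$ is a Schauder basis for $\mathcal{X}$ if for each $x\in\mathcal{X}$ there is a unique sequence $(a_n)_{n\ge 0}$ of complex numbers such that $x=\sum_{n=0}^\infty a_nx_n$, with convergence in the topology of $\mathcal{X}$. *)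

(* Defs.v *)
From HB Require Import structures.
From mathcomp Require Import all_boot all_order all_algebra.
From mathcomp Require Import all_classical all_reals all_analysis.
From mathcomp Require Import measurable_realfun.
From mathcomp Require Import complex ring lra.

Set Implicit Arguments.
Unset Strict Implicit.
Unset Printing Implicit Defensive.

Import Order.TTheory GRing.Theory Num.Theory.
Import numFieldNormedType.Exports.
Import ComplexField.Normc.

Local Open Scope classical_set_scope.
Local Open Scope ring_scope.
Local Open Scope complex_scope.

Definition schauder_basis (R : realType) (X : topologicalLmodType R[i])
    (x : nat -> X) : Prop :=
  forall y : X, exists! a : nat -> R[i],
    series (fun n => a n *: x n) @ \oo --> y.

Section hardy_def.
Context {R : realType}.
Implicit Types (p r t : R) (f : R[i]^o -> R[i]^o).

Definition circle r t : R[i] := (r * cos t) +i* (r * sin t).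

(* [normc] is the modulus with values in [R], whereas [`|z|] lives in [R[i]]. *)
Definition integral_mean p f r : \bar R :=
  (((2 * pi)^-1%:E * \int[lebesgue_measure]_(t in `[0%R, (2 * pi)%R])
      ((normc (f (circle r t))) `^ p)%:E) `^ p^-1)%E.

End hardy_def.

HB.lock Definition hardy_norm {R : realType} (p : R) (f : R[i]^o -> R[i]^o) :
    \bar R :=
  ereal_sup [set integral_mean p f r | r in `]0, 1[].
Canonical hardy_norm_unlock := Unlockable hardy_norm.unlock.

Section hardy_pred.
Context {R : realType}.
Implicit Types (p : R) (f : R[i]^o -> R[i]^o).

(* Complex differentiability: the scalars of the derivative are [R[i]]. *)
Definition analytic_on_disc f : Prop :=
  forall z : R[i], normc z < 1 -> derivable (f : R[i]^o -> R[i]^o) z 1.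

(* Functions on the open disc are represented by functions on the whole plane
   that vanish off the disc, so that equality is equality on the disc. *)
Definition hardy_pred p (p1 : 1 <= p) : {pred R[i]^o -> R[i]^o} :=
  mem [set f | [/\ analytic_on_disc f,
                   forall z, 1 <= normc z -> f z = 0
                 & (hardy_norm p f < +oo)%E]].

End hardy_pred.

Section modulus.
Context {R : realType}.
Implicit Types (z w : R[i]).

Lemma normCE z : `|z| = (normc z)%:C. Proof. by case: z. Qed.

Lemma ltr0c (x : R) : (0 < x%:C :> R[i]) = (0 < x).
Proof. exact: (ltcR 0 x). Qed.

Lemma normc_ge0 z : 0 <= normc z.
Proof. by case: z => a b; exact: sqrtr_ge0. Qed.

Lemma normcD z w : normc (z + w) <= normc z + normc w.
Proof. exact: le_normcD. Qed.

Lemma normc_dist z w : `|normc z - normc w| <= normc (z - w).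
Proof.
have h (u v : R[i]) : normc u - normc v <= normc (u - v).
  by have := normcD (u - v) v; rewrite subrK lerBlDr.
rewrite ler_norml h andbT lerNl opprB (le_trans (h _ _))//.
by rewrite -lecR -!normCE distrC.
Qed.

Lemma continuous_normc : continuous (@normc R : R[i]^o -> R).
Proof.
move=> z; apply/(@cvgrPdist_lt _ _ _ (nbhs (z : R[i]^o))) => e e0.
apply/nbhs_ballP; exists e%:C; first by rewrite /= ltr0c.
move=> w; rewrite /ball/= normCE ltcR => h.
exact: le_lt_trans (normc_dist _ _) h.
Qed.

Lemma continuous_real_complex : continuous (real_complex R : R -> R[i]^o).
Proof.
move=> x; apply/cvgrPdist_lt => e e0.
have [e' e'0 ->] : exists2 e' : R, 0 < e' & e = e'%:C.
  case: e e0 => a b; rewrite ltcE/= => /andP[/eqP b0 a0].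
  by exists a => //; rewrite b0.
near=> y; rewrite -rmorphB/= normCE ltcR /normc/= expr0n/= addr0 sqrtr_sqr.
by near: y; exact: (nbhsx_ballx x e' e'0).
Unshelve. all: by end_near. Qed.

Lemma continuous_circle (r : R) : continuous (circle r : R -> R[i]^o).
Proof.
have -> : circle r = fun t => (r * cos t)%:C + 'i * (r * sin t)%:C :> R[i]^o.
  apply/funext => t; rewrite /circle; apply/eqP; rewrite eq_complex/=.
  by apply/andP; split; apply/eqP; ring.
have h (g : R -> R) : continuous g ->
    continuous (fun t => (g t)%:C : R[i]^o).
  move=> gc t; apply: (@continuous_comp R R R[i]^o g (real_complex R)).
    exact: gc.
  exact: continuous_real_complex.
have hc : continuous (fun t => r * cos t : R).
  by move=> t; apply: cvgM; [exact: cvg_cst|exact: continuous_cos].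
have hs : continuous (fun t => r * sin t : R).
  by move=> t; apply: cvgM; [exact: cvg_cst|exact: continuous_sin].
move=> t; apply: (@cvgD R[i] R[i]^o _ _ _ _ _ _ _ (h _ hc t)).
by apply: (@cvgM R[i] _ _ _ _ _ _ _ _ (h _ hs t)); exact: cvg_cst.
Qed.

Lemma normc_circle (r t : R) : 0 <= r -> normc (circle r t) = r.
Proof.
by move=> r0; rewrite /circle/= !exprMn -mulrDr cos2Dsin2 mulr1 sqrtr_sqr ger0_norm.
Qed.

Lemma circle_surj z : exists2 t, t \in `[0, 2 * pi] & z = circle (normc z) t.
Proof.
have [->|z0] := eqVneq z 0.
  exists 0; first by rewrite in_itv/= lexx mulr_ge0// pi_ge0.
  by rewrite /circle normc0 !mul0r.
have r0 : 0 < normc z.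
  by rewrite lt_def normc_ge0 andbT; apply: contra z0 => /eqP/eq0_normc ->.
move: r0 z0; case: z => x y; set r := normc _ => r0 _.
have r2 : r ^+ 2 = x ^+ 2 + y ^+ 2.
  by rewrite /r/= sqr_sqrtr// addr_ge0// sqr_ge0.
have xr : -1 <= x / r <= 1.
  rewrite -ler_norml -(@expr_le1 _ 2)// real_normK ?num_real//.
  by rewrite expr_div_n ler_pdivrMr ?exprn_gt0// mul1r r2 lerDl sqr_ge0.
have [/andP[c0 cpi] cc] := acos_def xr.
have sc : r * sin (acos (x / r)) = `|y|.
  rewrite sin_acos// -[X in X * _](@gtr0_norm _ r)// -sqrtr_sqr -sqrtrM ?sqr_ge0//.
  rewrite mulrBr mulr1 -exprMn mulrCA divff ?gt_eqF// mulr1 r2.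
  by rewrite addrAC subrr add0r sqrtr_sqr.
have [y0|y0] := leP 0 y.
- exists (acos (x / r)).
    by rewrite in_itv/= c0/= (le_trans cpi)// ler_peMl ?pi_ge0// ler1n.
  by rewrite /circle sc cc mulrCA divff ?gt_eqF// mulr1 ger0_norm.
- exists (pi *+ 2 - acos (x / r)).
    rewrite in_itv/= subr_ge0 (le_trans cpi)/=; last first.
      by rewrite mulr2n lerDl pi_ge0.
    by rewrite mulr_natl gerBl.
  rewrite /circle addrC cosD2pi sinD2pi cosN sinN mulrN sc cc.
  by rewrite mulrCA divff ?gt_eqF// mulr1 ltr0_norm// opprK.
Qed.

End modulus.

Section hardy_norm_theory.
Context {R : realType}.
Implicit Types (p r t : R) (f g : R[i]^o -> R[i]^o).
Local Notation mu := lebesgue_measure.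

Lemma continuous_on_circle f r : analytic_on_disc f -> 0 < r < 1 ->
  continuous (fun t => normc (f (circle r t))).
Proof.
move=> fa /andP[r0 r1] t.
apply: (@continuous_comp _ R[i]^o _ (fun t => f (circle r t)) (@normc R)); last first.
  exact: continuous_normc.
apply: (@continuous_comp _ R[i]^o _ (circle r) f); first exact: continuous_circle.
apply/differentiable_continuous/derivable1_diffP/fa.
by rewrite normc_circle// ltW.
Qed.

Lemma measurable_on_circle f r : analytic_on_disc f -> 0 < r < 1 ->
  measurable_fun [set: R] (fun t => normc (f (circle r t))).
Proof.
move=> fa r01; apply: continuous_measurable_fun.
exact: continuous_on_circle.
Qed.

Lemma measurable_mean p f r : analytic_on_disc f -> 0 < r < 1 ->
  measurable_fun [set: R] (fun t => (normc (f (circle r t)) `^ p)%:E).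
Proof.
move=> fa r01; apply/measurable_EFinP.
exact: (measurableT_comp (measurable_powR p) (measurable_on_circle fa r01)).
Qed.

Lemma twopi_gt0 : 0 < 2 * pi :> R.
Proof. by rewrite mulr_gt0// pi_gt0. Qed.

Lemma integral_mean_ge0 p f r : (0 <= integral_mean p f r)%E.
Proof. exact: poweR_ge0. Qed.

Lemma hardy_norm_ge0 p f : (0 <= hardy_norm p f)%E.
Proof.
rewrite unlock; apply: (le_trans (integral_mean_ge0 p f 2^-1)); apply: ereal_sup_ubound.
by exists 2^-1 => //=; rewrite in_itv/=; lra.
Qed.

Lemma integral_mean_Lnorm p f r : 0 < p ->
  integral_mean p f r =
  (((2 * pi)^-1 `^ p^-1)%:E *
   'N[mu]_p%:E[EFin \o ((fun t => normc (f (circle r t))) \_ `[0%R, (2 * pi)%R])])%E.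
Proof.
move=> p0; rewrite /integral_mean poweRM; last 2 first.
- by rewrite lee_fin invr_ge0 ltW// twopi_gt0.
- by apply: integral_ge0 => t _; rewrite lee_fin powR_ge0.
rewrite poweR_EFin unlock; cbv beta iota; set J := integral _ _ _; set K := integral _ _ _.
suff -> : J = K by [].
rewrite /J /K [LHS]integral_mkcond. apply: eq_integral => t _.
rewrite /= /patch; case: ifPn => _ /=.
  by rewrite ger0_norm// normc_ge0.
by rewrite normr0 powR0// gt_eqF.
Qed.

Lemma le_integral_mean p f (h : R -> R) r : 0 < p ->
  measurable_fun setT h -> analytic_on_disc f -> 0 < r < 1 ->
  (forall t, normc (f (circle r t)) <= h t) ->
  ('N[mu]_p%:E[EFin \o ((fun t => normc (f (circle r t))) \_ `[0%R, (2 * pi)%R])]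
   <= 'N[mu]_p%:E[EFin \o (h \_ `[0%R, (2 * pi)%R])])%E.
Proof.
move=> p0 mh fa r01 fh; rewrite unlock/=.
have m (k : R -> R) : measurable_fun setT k ->
    measurable_fun setT (fun x => (`|(EFin \o (k \_ `[0%R, (2 * pi)%R])) x| `^ p)%E).
  move=> mk; apply: (measurableT_comp (measurable_poweR _)).
  apply: measurableT_comp => //; apply/measurable_EFinP.
  by apply/(measurable_restrictT _ _).1 => //; exact: measurable_funTS.
apply: gt0_ler_poweR.
- by rewrite invr_ge0 ltW.
- by rewrite in_itv/= leey andbT integral_ge0// => t _; exact: poweR_ge0.
- by rewrite in_itv/= leey andbT integral_ge0// => t _; exact: poweR_ge0.
apply: ge0_le_integral => //.
- exact: m _ (measurable_on_circle fa r01).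
- exact: m.
- move=> t _; rewrite /= lee_fin; apply: ge0_ler_powR; rewrite ?nnegrE//.
    exact: ltW.
  rewrite /patch; case: ifPn => // _.
  rewrite (ger0_norm (normc_ge0 _)) ger0_norm//.
  exact: le_trans (normc_ge0 _) (fh t).
Qed.

Lemma integral_meanD p f g r : 1 <= p ->
  analytic_on_disc f -> analytic_on_disc g -> 0 < r < 1 ->
  analytic_on_disc (f + g) ->
  (integral_mean p (f + g)%R r <= integral_mean p f r + integral_mean p g r)%E.
Proof.
move=> p1 fa ga r01 fga.
have p0 : 0 < p by rewrite (lt_le_trans _ p1).
rewrite !integral_mean_Lnorm// -ge0_muleDr ?Lnorm_ge0//.
apply: lee_wpmul2l; first by rewrite lee_fin powR_ge0.
pose F (k : R[i]^o -> R[i]^o) t := normc (k (circle r t)).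
have mF k : analytic_on_disc k -> measurable_fun setT (F k).
  by move=> ka; exact: measurable_on_circle.
have mr (k : R -> R) : measurable_fun setT k ->
    measurable_fun setT (k \_ `[0, (2 * pi)]).
  move=> mk.
  by apply/(measurable_restrictT _ _).1 => //; exact: measurable_funTS.
apply: (le_trans (@le_integral_mean p (f + g) (F f \+ F g) r p0 _ fga r01 _)).
- by apply: measurable_funD; exact: mF.
- by move=> t; exact: normcD.
rewrite (_ : (F f \+ F g) \_ _ =
   (F f \_ `[0, (2 * pi)] \+ F g \_ `[0, (2 * pi)])).
  by apply: minkowski_EFin => //; apply: mr; exact: mF.
by apply/funext => t /=; rewrite /patch; case: ifPn => //; rewrite addr0.
Qed.

Lemma analytic_on_discD f g :
  analytic_on_disc f -> analytic_on_disc g -> analytic_on_disc (f + g).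
Proof. by move=> fa ga z z1; apply: derivableD; [exact: fa|exact: ga]. Qed.

Lemma analytic_on_discZ (a : R[i]) f :
  analytic_on_disc f -> analytic_on_disc (a *: f).
Proof. by move=> fa z z1; apply: derivableZ; exact: fa. Qed.

Lemma hardy_normD p f g : 1 <= p ->
  analytic_on_disc f -> analytic_on_disc g ->
  (hardy_norm p (f + g)%R <= hardy_norm p f + hardy_norm p g)%E.
Proof.
move=> p1 fa ga; rewrite unlock; apply: ge_ereal_sup => _ [r r01 <-].
have r01' : 0 < r < 1 by move: r01; rewrite /= in_itv.
apply: (le_trans (integral_meanD p1 fa ga r01' (analytic_on_discD fa ga))).
by apply: leeD; apply: ereal_sup_ubound; exists r.
Qed.

Lemma hardy_normZ p f (a : R[i]) : 1 <= p -> analytic_on_disc f ->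
  hardy_norm p (a *: f) = ((normc a)%:E * hardy_norm p f)%E.
Proof.
move=> p1 fa; have p0 : 0 < p by rewrite (lt_le_trans _ p1).
rewrite unlock -ereal_supZl ?normc_ge0//; last first.
  apply/set0P; exists (integral_mean p f 2^-1); exists 2^-1 => //=.
  by rewrite in_itv/=; lra.
rewrite image_comp; congr ereal_sup.
apply: eq_imagel => r /=; rewrite in_itv/= => r01.
rewrite /integral_mean.
under eq_integral do rewrite /= normcM powRM ?normc_ge0// EFinM.
rewrite ge0_integralZl_EFin ?powR_ge0//; last 2 first.
- by move=> t _; rewrite lee_fin powR_ge0.
- by apply: measurable_funTS; exact: measurable_mean.
have I0 : (0 <= ((2 * pi)^-1)%:E *
    \int[mu]_(t in `[0%R, (2 * pi)%R]) (normc (f (circle r t)) `^ p)%:E)%E.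
  apply: mule_ge0; first by rewrite lee_fin invr_ge0 ltW// twopi_gt0.
  by apply: integral_ge0 => t _; rewrite lee_fin powR_ge0.
rewrite muleCA (poweRM _ _ I0) ?lee_fin ?powR_ge0//.
by rewrite [X in (X * _)%E = _]poweR_EFin -powRrM divff ?gt_eqF// powRr1 ?normc_ge0.
Qed.

Lemma hardy_norm0 p : 1 <= p -> hardy_norm p 0 = 0%E.
Proof.
move=> p1; have a0 : @analytic_on_disc R 0 by move=> z _; exact: derivable_cst.
by rewrite -(scale0r (0 : R[i]^o -> R[i]^o)) hardy_normZ// normc0 mul0e.
Qed.

Lemma hardy_norm_eq0 p f : 1 <= p -> analytic_on_disc f ->
  hardy_norm p f = 0%E -> forall z, normc z < 1 -> f z = 0.
Proof.
move=> p1 fa f0; have p0 : 0 < p by rewrite (lt_le_trans _ p1).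
have circ r t : 0 < r < 1 -> t \in `[0, 2 * pi] -> f (circle r t) = 0.
  move=> r01 t02; apply: eq0_normc; apply/eqP; apply/negPn/negP => ft.
  pose g s := normc (f (circle r s)).
  have gt0 : 0 < g t by rewrite lt_def ft normc_ge0.
  have : (integral_mean p f r <= 0)%E.
    by rewrite -f0 unlock; apply: ereal_sup_ubound; exists r.
  rewrite leNgt => /negP; apply.
  rewrite poweR_gt0// mule_gt0// ?lte_fin ?invr_gt0 ?twopi_gt0//.
  have := @continuous_on_circle f r fa r01 t.
  move=> /cvgrPdist_lt/(_ (g t / 2)) /=; rewrite divr_gt0// => /(_ isT).
  move=> /nbhs_ballP[d /= d0 db].
  pose a := Num.max 0 (t - d / 2); pose b := Num.min (2 * pi) (t + d / 2).
  move: t02; rewrite in_itv/= => /andP[t0 t2].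
  have ab : a < b.
    by rewrite /a /b gt_max !lt_min twopi_gt0/=; apply/and3P; split; lra.
  have sub : `[a, b] `<=` `[0, (2 * pi)].
    move=> s /=; rewrite !in_itv/= /a /b ge_max le_min.
    by move=> /andP[/andP[-> _] /andP[-> _]].
  have gs s : s \in `[a, b] -> g t / 2 <= g s.
    rewrite in_itv/= /a /b ge_max le_min => /andP[/andP[_ sa] /andP[_ sb]].
    have /db/= : ball t d s by rewrite /ball/= ltr_distlC; apply/andP; split; lra.
    rewrite -/(g t) -/(g s) ltr_distlC => /andP[h _]; lra.
  have mg : measurable_fun `[a, b] (fun s => (g s `^ p)%:E).
    by apply: measurable_funTS; exact: measurable_mean.
  have mg' : measurable_fun `[0, 2 * pi] (fun s => (g s `^ p)%:E).
    by apply: measurable_funTS; exact: measurable_mean.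
  apply: (@lt_le_trans _ _ (\int[mu]_(s in `[a, b]) (g s `^ p)%:E)%E); last first.
    by apply: ge0_subset_integral => // s _; rewrite lee_fin powR_ge0.
  apply: (@lt_le_trans _ _ (\int[mu]_(s in `[a, b]) (cst ((g t / 2) `^ p)%:E s))%E).
    rewrite integral_cst//= lebesgue_measure_itv/= lte_fin ab.
    by rewrite -EFinB -EFinM lte_fin mulr_gt0 ?powR_gt0 ?divr_gt0// subr_gt0.
  apply: ge0_le_integral => //.
  - by move=> s _; rewrite lee_fin powR_ge0.
  - move=> s sab; rewrite lee_fin; apply: ge0_ler_powR.
    + exact: ltW.
    + by rewrite nnegrE divr_ge0// ltW.
    + by rewrite nnegrE normc_ge0.
    + exact: gs.
have nz z : 0 < normc z -> normc z < 1 -> f z = 0.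
  move=> z0 z1; have [t t02 zt] := circle_surj z.
  by rewrite zt circ// z0.
move=> z z1.
have [z0|z0] := eqVneq z 0; last first.
  by apply: nz => //; rewrite lt_def normc_ge0 andbT; apply: contra z0 => /eqP/eq0_normc ->.
have cf : {for (0 : R[i]^o), continuous f}.
  by apply/differentiable_continuous/derivable1_diffP/fa; rewrite normc0.
rewrite z0; apply/eqP; apply/negPn/negP => fn0.
move/cvgrPdist_lt : cf => /(_ `|f 0|); rewrite normr_gt0 => /(_ fn0).
move=> /nbhs_ballP[d /= d0 db].
have d0' : 0 < normc d by move: d0; rewrite -ltr0c -normCE => d0; rewrite gtr0_norm.
pose e := Num.min (normc d / 2) 2^-1.
have e0 : 0 < e by rewrite lt_min divr_gt0//= invr_gt0.
have ed : e < normc d by rewrite gt_min; apply/orP; left; lra.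
have e1 : e < 1 by rewrite gt_min; apply/orP; right; lra.
have ne : normc e%:C = e by rewrite /normc/= expr0n/= addr0 sqrtr_sqr gtr0_norm.
have /db/= : ball (0 : R[i]^o) d (e%:C).
  by rewrite /ball/= sub0r normrN normCE ne -(gtr0_norm d0) normCE ltcR.
by rewrite (nz e%:C) ?ne// subr0 ltxx.
Qed.

End hardy_norm_theory.

Section hardy_space.
Context {R : realType} (p : R) (p1 : 1 <= p).
Implicit Types (f g : R[i]^o -> R[i]^o).

Lemma hardy_submod_closed : submod_closed (hardy_pred p1).
Proof.
split.
  rewrite inE; split; [by move=> z _; exact: derivable_cst|by []|].
  by rewrite hardy_norm0.
move=> a f g /set_mem[fa fz fn] /set_mem[ga gz gn]; apply/mem_set; split.
- exact: (analytic_on_discD (analytic_on_discZ fa) ga).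
- move=> z z1; transitivity (a * f z + g z); first exact: erefl.
  by rewrite (fz z z1) (gz z z1) mulr0 addr0.
- apply: (le_lt_trans (hardy_normD p1 (analytic_on_discZ fa) ga)).
  apply: lte_add_pinfty; last exact: gn.
  rewrite (hardy_normZ _ p1 fa); apply: lte_mul_pinfty; last exact: fn.
    by rewrite lee_fin normc_ge0.
  by [].
Qed.

HB.instance Definition _ := GRing.isSubmodClosed.Build _ _ (hardy_pred p1)
  hardy_submod_closed.

Record hardy : Type := Hardy {
  hardy_fun : R[i]^o -> R[i]^o ;
  hardy_funP : hardy_fun \in hardy_pred p1 }.

HB.instance Definition _ := [isSub for hardy_fun].
HB.instance Definition _ := [Choice of hardy by <:].
HB.instance Definition _ := [SubChoice_isSubLmodule of hardy by <:].

Definition hardy_normC (f : hardy) : R[i] := (fine (hardy_norm p (val f)))%:C.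

Lemma hardyP (f : hardy) : [/\ analytic_on_disc (val f),
  forall z, 1 <= normc z -> val f z = 0
  & (hardy_norm p (val f)) \is a fin_num].
Proof.
have := hardy_funP f; rewrite inE => -[fa fz fn]; split => //.
by rewrite ge0_fin_numE// hardy_norm_ge0.
Qed.

Lemma hardy_normCD (f g : hardy) :
  hardy_normC (f + g) <= hardy_normC f + hardy_normC g.
Proof.
have [fa _ ff] := hardyP f; have [ga _ gf] := hardyP g.
have [_ _ fgf] := hardyP (f + g).
rewrite /hardy_normC -(rmorphD (real_complex R)) lecR -(fineD ff gf).
apply: fine_le; first exact: fgf.
  by rewrite fin_numD ff gf.
exact: (hardy_normD p1 fa ga).
Qed.

Lemma hardy_normCZ (a : R[i]) (f : hardy) :
  hardy_normC (a *: f) = `|a| * hardy_normC f.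
Proof.
have [fa _ ff] := hardyP f.
rewrite /hardy_normC (hardy_normZ a p1 fa : hardy_norm p (val (a *: f)) = _) normCE.
by rewrite (fineM _ ff) ?rmorphM.
Qed.

Lemma hardy_normC_eq0 (f : hardy) : hardy_normC f = 0 -> f = 0.
Proof.
have [fa fz ff] := hardyP f => /complexI f0.
apply: val_inj; apply/funext => z; transitivity (0 : R[i]); last exact: erefl.
have [z1|/fz//] := ltP (normc z) 1.
apply: (hardy_norm_eq0 p1 fa); last exact: z1.
by rewrite -(fineK ff) f0.
Qed.

HB.instance Definition _ := Lmodule_isNormed.Build R[i] hardy
  hardy_normCD hardy_normCZ hardy_normC_eq0.

End hardy_space.

Section blaschke.
Context {R : realType}.
Implicit Types (lam : nat -> R[i]) (z w : R[i]).

Definition blaschke_factor w z : R[i] := (w - z) / (1 - w^* * z).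

Definition blaschke lam (n : nat) : R[i]^o -> R[i]^o := fun z =>
  if normc z < 1 then \prod_(1 <= k < n.+1) blaschke_factor (lam k) z else 0.

Lemma normcJ z : normc z^* = normc z.
Proof. by case: z => a b; rewrite /= sqrrN. Qed.

Lemma blaschke_denom_neq0 w z : normc w < 1 -> normc z < 1 ->
  1 - w^* * z != 0.
Proof.
move=> w1 z1; apply/negP; rewrite subr_eq0 => /eqP/(congr1 (@normc R)).
rewrite normc1 normcM normcJ => /esym/eqP; rewrite lt_eqF//.
by rewrite mulr_ilt1// normc_ge0.
Qed.

Lemma blaschke_factor_le1 w z : normc w < 1 -> normc z < 1 ->
  normc (blaschke_factor w z) <= 1.
Proof.
move=> w1 z1; rewrite /blaschke_factor normcM normcV.
have d0 : 0 < normc (1 - w^* * z).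
  rewrite lt_def normc_ge0 andbT; apply: contra (blaschke_denom_neq0 w1 z1).
  by move=> /eqP/eq0_normc ->.
rewrite ler_pdivrMr// mul1r.
have sq (u : R[i]) : normc u ^+ 2 = complex.Re u ^+ 2 + complex.Im u ^+ 2.
  by case: u => a b /=; rewrite sqr_sqrtr// addr_ge0// sqr_ge0.
rewrite -(@ler_pXn2r _ 2) ?nnegrE ?normc_ge0// !sq.
have w2 : normc w ^+ 2 <= 1 by rewrite expr_le1 ?normc_ge0// ltW.
have z2 : normc z ^+ 2 <= 1 by rewrite expr_le1 ?normc_ge0// ltW.
move: w2 z2; rewrite !sq; case: w z {w1 z1 d0} => [a b] [c d] /=.
by move=> ? ?; nra.
Qed.

Lemma blaschke_hardy_subproof (p : R) (p1 : 1 <= p) lam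
    (lam1 : forall k, (1 <= k)%N -> normc (lam k) < 1) (n : nat) :
  blaschke lam n \in hardy_pred p1.
Proof.
have p0 : 0 < p by rewrite (lt_le_trans _ p1).
have an : analytic_on_disc (blaschke lam n).
  move=> z z1.
  pose P m : R[i]^o -> R[i]^o :=
    fun w => \prod_(1 <= k < m.+1) blaschke_factor (lam k) w.
  have zP : {near (z : R[i]^o), P n =1 blaschke lam n}.
    have : \forall w \near (z : R[i]^o), normc w < 1.
      apply/nbhs_ballP; exists (1 - normc z)%:C; first by rewrite /= ltr0c subr_gt0.
      move=> w; rewrite /ball/= normCE ltcR => zw.
      have := normc_dist z w; rewrite ler_norml => /andP[h _].
      by move: h zw; lra.
    by apply: filterS => w w1; rewrite /blaschke w1.
  apply: (near_eq_derivable zP) => {zP}.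
  elim: n => [|n IHn].
    have -> : P 0%N = cst 1 by apply/funext => w; rewrite /P big_nil.
    exact: derivable_cst.
  have -> : P n.+1 = P n * ((fun w => lam n.+1 - w) *
      (fun w => (1 - (lam n.+1)^* * w)^-1)).
    by apply/funext => w; rewrite /P big_nat_recr.
  apply: (derivableM IHn); apply: derivableM.
    by apply: derivableB; [exact: derivable_cst|exact: derivable_id].
  apply: derivableV; first by apply: blaschke_denom_neq0 => //; exact: lam1.
  apply: derivableB; first exact: derivable_cst.
  by apply: derivableM; [exact: derivable_cst|exact: derivable_id].
rewrite inE; split => //.
  by move=> z z1; rewrite /blaschke ltNge z1.
apply: (@le_lt_trans _ _ 1%E); last by rewrite ltry.
rewrite unlock; apply: ge_ereal_sup => _ [r /= r01 <-].
have {}r01 : 0 < r < 1 by move: r01; rewrite in_itv.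
have <- : (1 `^ p^-1 = 1 :> \bar R)%E by rewrite poweR_EFin powR1.
apply: gt0_ler_poweR.
- by rewrite invr_ge0 ltW.
- rewrite in_itv/= leey andbT; apply: mule_ge0.
    by rewrite lee_fin invr_ge0 ltW// twopi_gt0.
  by apply: integral_ge0 => t _; rewrite lee_fin powR_ge0.
- by rewrite in_itv/= leey andbT.
rewrite lee_pdivrMl ?twopi_gt0// mule1.
apply: (@le_trans _ _
  (\int[lebesgue_measure]_(t in `[0%R, (2 * pi)%R]) cst 1%E t)%E); last first.
  rewrite integral_cst//= lebesgue_measure_itv/= lte_fin twopi_gt0.
  by rewrite -EFinB subr0 mul1e.
apply: ge0_le_integral => //.
- by move=> t _; rewrite lee_fin powR_ge0.
- by apply: measurable_funTS; exact: measurable_mean.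
- move=> t _; rewrite lee_fin; apply: (@le_trans _ _ (1 `^ p)); last by rewrite powR1.
  apply: ge0_ler_powR; rewrite ?nnegrE ?normc_ge0//; first exact: ltW.
  rewrite /blaschke; case: ifPn => [c1|_]; last by rewrite normc0.
  rewrite big_nat_cond; apply: (big_ind (fun z => normc z <= 1)).
  + by rewrite normc1.
  + by move=> z w z1 w1; rewrite normcM mulr_ile1// normc_ge0.
  + move=> k /andP[/andP[k1 _] _]; apply: blaschke_factor_le1 => //.
    exact: lam1.
Qed.

Definition blaschke_hardy (p : R) (p1 : 1 <= p) lam
    (lam1 : forall k, (1 <= k)%N -> normc (lam k) < 1) (n : nat) : hardy p1 :=
  Hardy (blaschke_hardy_subproof p1 lam1 n).

End blaschke.

(* Main.v *)
(** Let [S_n T] be the [n]-th partial sum of a finite sum [T = sum a_k B_k]. On the circle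
    [T conj(B_n) = g + conj(Z)] with [g] and [Z] analytic, [|Z| = |S_n T|] and
    [Z (lambda_n) = 0], so that the M. Riesz inequality together with the evaluation at
    [lambda_n] bounds the norm of [S_n T] by that of [T], with a constant depending only on
    [p] and [|lambda_n|]. If [sup |lambda_n| < 1] these bounds are uniform, and the [B_n] span
    a dense subspace: subtracting [n] terms from [1 / (1 - u z)] leaves [B_n / (1 - u z)] times
    a product of [n] Blaschke factors at [u]. If [|lambda_n|] comes arbitrarily close to 1, the
    blocks [B_n - conj(lambda_(n+1)) B_(n+1)] along a sparse sequence of indices have summable
    norms; their sum is in [H^p], but its coefficients would have to be 1 infinitely often,
    although the terms of a convergent series tend to 0.

    The Riesz inequality for [1 < p <= 2] results from the submean property of
    [C (|w + conj z|^2 + 2 e)^(p/2) - (|w|^2 + |z|^2 + e)^(p/2)], and larger [p] are reached by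
    doubling. Submean properties are derived from lower bounds on sums over four points, two
    dilations and two rotations of the argument, which replace the Laplacian. Monotonicity of
    the means and uniform convexity make the dilations [f (rho z)] converge to [f] in [H^p];
    Cauchy's formula, by Goursat's bisection in polar coordinates, makes them uniform limits
    of polynomials. *)

Require Import Defs.
From HB Require Import structures.
From mathcomp Require Import all_boot all_order all_algebra.
From mathcomp Require Import all_classical all_reals all_analysis.
From mathcomp Require Import complex ring lra.

Set Implicit Arguments.
Unset Strict Implicit.
Unset Printing Implicit Defensive.

Import Order.TTheory GRing.Theory Num.Theory.
Import numFieldNormedType.Exports.
Import ComplexField.Normc.
Local Open Scope classical_set_scope.
Local Open Scope ring_scope.
Local Open Scope complex_scope.

(* In [ring_scope], [z^*] would otherwise denote [Num.conj]. *)
Local Notation "z ^*" := (conjc z) : ring_scope.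

(** * Means of continuous functions over the circle *)

Section mean.
Context {R : realType}.
Implicit Types (u v : R -> R) (t : R).
Local Notation mu := (@lebesgue_measure R).

(** No boundary values of [H^p] functions are used: a function enters only through its means over
    circles. Inequalities are proved for polynomials, pass to uniform limits of polynomials on the
    closed disc, and reach [H^p] through dilations. Blaschke products lie in the middle class, so
    that the norm of a finite Blaschke sum is a mean over the unit circle itself.

    The four-point method tolerates an error of third order in the step [h]. Along a geometric
    sequence of radii with ratio [(1-h)/(1+h)], errors accumulate twice, once in the differences of
    the means and once in their sum; each time a factor of order [1/h] is lost, and [h^3 / h^2]
    still tends to [0].

    The range [p <= 2] is the one where [x^(p/2)] is concave, so that the subtracted power lies
    below its tangent; the first power gains convexity only because its argument is a squared
    modulus. The parameter [e] keeps both powers away from their singularity at [0] and is removed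
    at the end. *)

Definition mean u : R := (2 * pi)^-1 * (\int[mu]_(t in `[0%R, (2 * pi)%R]) u t).

Lemma continuous_integrable u (a b : R) : continuous u ->
  mu.-integrable `[a, b] (EFin \o u).
Proof.
move=> cu; apply: continuous_compact_integrable; first exact: segment_compact.
exact: continuous_subspaceT.
Qed.

Lemma primitive_exists u (A : R) : continuous u ->
  exists U : R -> R, forall x, - A < x < A -> is_derive x 1 U (u x).
Proof.
move=> cu; exists (fun x => \int[mu]_(t in `[- A, x]) u t) => x /andP[Ax xA].
have [dU <-] := @continuous_FTC1_closed _ u (- A) x A xA
  (continuous_integrable _ _ cu) Ax (cu x).
by rewrite derive1E; exact/derivableP.
Qed.

Lemma Rintegral_primitive u U (a b : R) : a < b -> continuous u ->
  (forall x, a <= x <= b -> is_derive x 1 U (u x)) ->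
  (\int[mu]_(t in `[a, b]) u t) = U b - U a.
Proof.
move=> ab cu dU; rewrite /Rintegral (@continuous_FTC2 _ u U a b) => //.
- exact: continuous_subspaceT.
- have cU x : a <= x <= b -> {for x, continuous U}.
    move=> /dU[dx _]; exact/differentiable_continuous/derivable1_diffP.
  split.
  + by move=> x; rewrite in_itv/= => /andP[ax xb]; have [] := dU x; rewrite ?ltW.
  + by apply: cvg_at_right_filter; apply: cU; rewrite lexx ltW.
  + by apply: cvg_at_left_filter; apply: cU; rewrite lexx ltW.
- move=> x; rewrite in_itv/= => /andP[ax xb].
  by rewrite derive1E; have [|_ ->] := dU x; rewrite ?ltW.
Qed.

Let pi2 := @twopi_gt0 R.
Lemma meanD u v : continuous u -> continuous v ->
  mean (fun t => u t + v t) = mean u + mean v.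
Proof.
by move=> cu cv; rewrite /mean RintegralD// ?mulrDr//; exact: continuous_integrable.
Qed.

Lemma meanB u v : continuous u -> continuous v ->
  mean (fun t => u t - v t) = mean u - mean v.
Proof.
by move=> cu cv; rewrite /mean RintegralB// ?mulrBr//; exact: continuous_integrable.
Qed.

Lemma meanZ (c : R) u : continuous u -> mean (fun t => c * u t) = c * mean u.
Proof.
move=> cu; rewrite /mean RintegralZl//; last exact: continuous_integrable.
by rewrite mulrCA.
Qed.

Lemma mean_cst (c : R) : mean (fun=> c) = c.
Proof.
rewrite /mean Rintegral_cst//= lebesgue_measure_itv/= lte_fin pi2/= subr0.
by rewrite mulrCA mulVf ?mulr1// gt_eqF.
Qed.

Lemma le_mean u v : continuous u -> continuous v -> (forall t, u t <= v t) ->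
  mean u <= mean v.
Proof.
move=> cu cv uv; rewrite /mean ler_wpM2l//; first by rewrite invr_ge0 ltW.
by apply: le_Rintegral => //; exact: continuous_integrable.
Qed.

Lemma eq_mean u v : u =1 v -> mean u = mean v.
Proof. by move=> /funext ->. Qed.

Lemma mean_ge0 u : (forall t, 0 <= u t) -> 0 <= mean u.
Proof.
move=> u0; rewrite /mean mulr_ge0//; first by rewrite invr_ge0 ltW.
by apply: Rintegral_ge0 => t _; exact: u0.
Qed.

Lemma dist_mean u v (e : R) : continuous u -> continuous v ->
  (forall t, `|u t - v t| <= e) -> `|mean u - mean v| <= e.
Proof.
move=> cu cv uv; have ce : continuous (fun _ : R => e) by move=> t; exact: cvg_cst.
have cB : continuous (fun t => u t - v t).
  by move=> t; apply: cvgB; [exact: cu|exact: cv].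
have cN : continuous (fun _ : R => - e) by move=> t; exact: cvg_cst.
rewrite -meanB// ler_norml -{1}(mean_cst (- e)) -{2}(mean_cst e).
by apply/andP; split; apply: le_mean => // t; have := uv t; rewrite ler_norml => /andP[].
Qed.

Lemma mean_shift u (s : R) : continuous u -> (forall t, u (t + 2 * pi) = u t) ->
  mean (fun t => u (t + s)) = mean u.
Proof.
move=> cu per.
(* The open interval []-A, A[] must contain [[0, 2 pi]] together with its translate by [s], whatever
   the sign of [s]. *)
pose A := `|s| + 2 * pi + 1.
have [U dU] := @primitive_exists u A cu.
have bnd t : - `|s| <= t <= `|s| + 2 * pi -> is_derive t 1 U (u t).
  move=> /andP[h1 h2]; apply: dU; rewrite /A; have := pi2.
  by move=> h; apply/andP; split; lra.
have s0 : - `|s| <= s <= `|s| by rewrite -ler_norml.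
have cus : continuous (fun t => u (t + s)).
  move=> t; apply: (@continuous_comp _ _ _ (fun t => t + s) u); last exact: cu.
  by apply: cvgD; [exact: cvg_id|exact: cvg_cst].
have E1 : \int[mu]_(t in `[0%R, (2 * pi)%R]) u (t + s) = U (2 * pi + s) - U (0 + s).
  apply: (@Rintegral_primitive (fun t => u (t + s)) (fun t => U (t + s))) => //.
  move=> t /andP[t0 t2].
  have h : is_derive (t + s) 1 U (u (t + s)) by apply: bnd; lra.
  have h' : is_derive t 1 (fun t => t + s) 1.
    by rewrite -[X in is_derive _ _ _ X]addr0; apply: is_deriveD.
  by have := @is_derive1_comp _ U (fun t => t + s) t _ _ h h'; rewrite mulr1.
have E2 : \int[mu]_(t in `[0%R, (2 * pi)%R]) u t = U (2 * pi) - U 0.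
  apply: Rintegral_primitive => //.
  by move=> t /andP[t0 t2]; apply: bnd; lra.
rewrite /mean; congr (_ * _); rewrite E1 E2.
rewrite add0r; apply/eqP; rewrite subr_eq addrAC -subr_eq; apply/eqP.
(* The increment of the primitive over a period is constant. *)
pose D t := U (2 * pi + t) - U t.
suff : D s = D 0 by rewrite /D addr0; move=> h; lra.
have dD t : - `|s| <= t <= `|s| -> is_derive t 1 D 0.
  move=> /andP[h1 h2]; have h0 := pi2.
  have k1 : is_derive t 1 U (u t) by apply: bnd; lra.
  have k2 : is_derive (2 * pi + t) 1 U (u (2 * pi + t)) by apply: bnd; lra.
  have h' : is_derive t 1 (fun t => 2 * pi + t) 1.
    by rewrite -[X in is_derive _ _ _ X]add0r; apply: is_deriveD.
  have k3 := @is_derive1_comp _ U (fun t => 2 * pi + t) t _ _ k2 h'.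
  have := @is_deriveB _ _ _ _ _ t 1 _ _ k3 k1.
  by rewrite mulr1 (addrC _ t) per subrr.
have cD (a b : R) : - `|s| <= a -> b <= `|s| -> {within `[a, b], continuous D}.
  move=> ha hb; apply: derivable_within_continuous => x; rewrite in_itv/= => /andP[xa xb].
  by have [] := dD x _ => //; lra.
have [h|h] := leP 0 s.
- have c0 : {within `[0, s], continuous D} by apply: cD; lra.
  have [|c _] := @MVT_segment _ D (fun=> 0) 0 s h _ c0.
    by move=> x; rewrite in_itv/= => /andP[xa xb]; apply: dD; lra.
  by rewrite mul0r => /eqP; rewrite subr_eq0 => /eqP.
- have c0 : {within `[s, 0], continuous D} by apply: cD; lra.
  have [|c _] := @MVT_segment _ D (fun=> 0) s 0 (ltW h) _ c0.
    by move=> x; rewrite in_itv/= => /andP[xa xb]; apply: dD; lra.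
  by rewrite mul0r => /eqP; rewrite subr_eq0 => /eqP.
Qed.

End mean.

(** * Inequalities for real powers *)

Section powR_inequalities.
Context {R : realType}.
Implicit Types (a p x y : R).

(** Young's inequality for [y] and [x^(p-1)] with the conjugate exponents [p] and [p/(p-1)];
    differentiability at [0] is not involved. *)
Lemma powR_tangent p x y : 1 <= p -> 0 <= x -> 0 <= y ->
  x `^ p + p * x `^ (p - 1) * (y - x) <= y `^ p.
Proof.
move=> p1 x0 y0.
have [->|pn1] := eqVneq p 1.
  by rewrite subrr !powRr1// powRr0; lra.
have {}p1 : 1 < p by rewrite lt_neqAle eq_sym pn1.
have p0 : 0 < p by lra.
pose q := p / (p - 1).
have q0 : 0 < q by rewrite divr_gt0// subr_gt0.
have pq : p^-1 + q^-1 = 1 by rewrite /q; field; lra.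
have := conjugate_powR y0 (powR_ge0 x (p - 1)) p0 q0 pq.
rewrite -powRrM (_ : (p - 1) * q = p); last by rewrite /q; field; lra.
have xp : x * x `^ (p - 1) = x `^ p by rewrite mulr_powRB1// ltW.
have qE : q^-1 = (p - 1) / p by rewrite /q invf_div.
move/(ler_wpM2l (ltW p0)); rewrite qE mulrDr.
rewrite (_ : p * (y `^ p / p) = y `^ p); last by field; lra.
rewrite (_ : p * (x `^ p * ((p - 1) / p)) = x `^ p * (p - 1)); last by field; lra.
rewrite -xp; set Z := x `^ (p - 1); set Y := y `^ p => h.
nra.
Qed.

(** This is [powR_tangent] for the convex inverse power [a^-1] at the points [x^a] and [y^a], solved
    for [y^a]. *)
Lemma powR_concave a x y : 0 < a <= 1 -> 0 < x -> 0 <= y ->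
  y `^ a <= x `^ a + a * x `^ (a - 1) * (y - x).
Proof.
move=> /andP[a0 a1] x0 y0.
have p1 : 1 <= a^-1 by rewrite invf_ge1.
have := powR_tangent p1 (powR_ge0 x a) (powR_ge0 y a).
rewrite -!powRrM mulfV ?gt_eqF// !powRr1//; last exact: ltW.
have -> : a * (a^-1 - 1) = - (a - 1) by field; lra.
set X := x `^ a; set Y := y `^ a; rewrite powRN.
have Z0 : 0 < x `^ (a - 1) by rewrite powR_gt0.
set Z := x `^ (a - 1) in Z0 * => h.
have : a * Z * (x + a^-1 / Z * (Y - X)) <= a * Z * y.
  by rewrite ler_pM2l ?mulr_gt0.
rewrite mulrDr (_ : a * Z * (a^-1 / Z * (Y - X)) = Y - X); last first.
  by field; rewrite !gt_eqF.
nra.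
Qed.

Lemma powR_lipschitz p (M : R) x y : 1 <= p -> 0 <= x <= M -> 0 <= y <= M ->
  `|x `^ p - y `^ p| <= p * M `^ (p - 1) * `|x - y|.
Proof.
move=> p1; wlog yx : x y / y <= x.
  move=> h hx hy; have [/h|/ltW/h] := leP y x; first by apply.
  by rewrite distrC (distrC x); apply.
move=> /andP[x0 xM] /andP[y0 yM].
have m : y `^ p <= x `^ p by apply: ge0_ler_powR; rewrite ?nnegrE; lra.
rewrite !ger0_norm ?subr_ge0//.
have := powR_tangent p1 x0 y0.
have h : x `^ (p - 1) <= M `^ (p - 1) by apply: ge0_ler_powR; rewrite ?nnegrE; lra.
have : p * x `^ (p - 1) * (x - y) <= p * M `^ (p - 1) * (x - y).
  by rewrite ler_wpM2r ?subr_ge0// ler_wpM2l//; lra.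
nra.
Qed.

Lemma powRD_le p x y : 0 <= p -> 0 <= x -> 0 <= y ->
  (x + y) `^ p <= 2 `^ p * (x `^ p + y `^ p).
Proof.
move=> p0 x0 y0; wlog yx : x y x0 y0 / y <= x.
  move=> h; have [/h|/ltW/h] := leP y x; first by apply.
  by rewrite addrC (addrC (x `^ p)); apply.
apply: (@le_trans _ _ ((2 * x) `^ p)).
  by apply: ge0_ler_powR; rewrite ?nnegrE; lra.
by rewrite powRM// ler_wpM2l ?powR_ge0// lerDl powR_ge0.
Qed.

Lemma powR_double p x : 0 <= x -> x `^ (2 * p) = x `^ p * x `^ p.
Proof. by move=> x0; rewrite mulrC powRrM -[in RHS]expr2 powR_mulrn ?powR_ge0. Qed.

Lemma ler_powRB1 a (e v : R) : a <= 1 -> 0 < e -> e <= v ->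
  v `^ (a - 1) <= e `^ (a - 1).
Proof.
move=> a1 e0 ev; have -> : a - 1 = - (1 - a) by ring.
rewrite !powRN lef_pV2 ?posrE ?powR_gt0//; last exact: lt_le_trans ev.
by apply: ge0_ler_powR; rewrite ?nnegrE; lra.
Qed.

Lemma is_derive_le (f df : R -> R) (a b : R) : a <= b ->
  (forall x, a <= x <= b -> is_derive x 1 f (df x)) ->
  (forall x, a <= x <= b -> 0 <= df x) -> f a <= f b.
Proof.
move=> ab d d0; apply: (@ger0_derive1_ndecr _ f a b) => //.
- by move=> x; rewrite in_itv/= => /andP[xa xb]; have [] := d x => //; lra.
- move=> x; rewrite in_itv/= => /andP[xa xb]; rewrite derive1E.
  by have [|_ ->] := d x; [lra|apply: d0; lra].
- apply: derivable_within_continuous => x; rewrite in_itv/= => /andP[xa xb].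
  by have [] := d x => //; lra.
Qed.

(* The second derivative of [q^a] is [a q^(a-2) ((a-1) q'^2 + q q'')], and
   [B^2 <= A C] says that [q'^2 <= 2 q q'']. *)
Lemma powR_quadratic (a A B C E : R) : 1 / 2 < a <= 1 -> 0 <= C ->
  B ^+ 2 <= A * C ->
  (forall t : R, 0 <= t <= 1 -> 0 < A + 2 * B * t + C * t ^+ 2 <= E) ->
  A `^ a + 2 * a * A `^ (a - 1) * B + a * (2 * a - 1) * E `^ (a - 1) * C <=
  (A + 2 * B + C) `^ a.
Proof.
move=> /andP[a2 a1] C0 BAC qE.
pose q t := A + 2 * B * t + C * t ^+ 2.
pose kap := a * (2 * a - 1) * E `^ (a - 1) * C.
(* The claim is [k 0 <= k 1], where [k] is [q^a] minus its linear part and minus [kap t^2]. Since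
   [k1 0 = 0], it suffices that the second derivative [k2] is nonnegative. *)
pose k t := q t `^ a - 2 * a * A `^ (a - 1) * B * t - kap * t ^+ 2.
pose k1 t := a * q t `^ (a - 1) * (2 * B + 2 * C * t)
  - 2 * a * A `^ (a - 1) * B - 2 * kap * t.
pose k2 t := a * ((a - 1) * q t `^ (a - 1 - 1) * (2 * B + 2 * C * t) ^+ 2
  + q t `^ (a - 1) * (2 * C)) - 2 * kap.
have q0 : q 0 = A by rewrite /q !mulr0 expr0n/= mulr0 !addr0.
have dq (t : R) : is_derive t 1 q (2 * B + 2 * C * t).
  rewrite /q; apply: is_derive_eq.
  by rewrite /GRing.scale/= ?scaler0 ?mulr0 ?addr0 ?add0r; ring.
have dqp b (t : R) : 0 <= t <= 1 ->
    is_derive t 1 (fun t => q t `^ b) (b * q t `^ (b - 1) * (2 * B + 2 * C * t)).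
  move=> /qE /andP[qt _].
  have h := is_derive1_powR b qt; have h' := dq t.
  exact: (@is_derive1_comp _ (fun x => x `^ b) q t _ _ h h').
have dk (t : R) : 0 <= t <= 1 -> is_derive t 1 k (k1 t).
  move=> t01; have := dqp a t t01; rewrite /k /k1 => d.
  apply: is_derive_eq; rewrite /GRing.scale/= ?scaler0 ?mulr0 ?addr0 ?add0r.
  by ring.
have dk1 (t : R) : 0 <= t <= 1 -> is_derive t 1 k1 (k2 t).
  move=> t01; have := dqp (a - 1) t t01; rewrite /k1 /k2 => d.
  apply: is_derive_eq; rewrite /GRing.scale/= ?scaler0 ?mulr0 ?addr0 ?add0r.
  by ring.
have k20 (t : R) : 0 <= t <= 1 -> 0 <= k2 t.
  move=> t01; have /andP[qt qtE] := qE _ t01; rewrite -/(q t) in qt qtE.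
  have qa : q t `^ (a - 1) = q t * q t `^ (a - 1 - 1).
    rewrite -[X in X * _](powRr1 (ltW qt)) -powRD ?(gt_eqF qt) ?implybT//.
    by congr (_ `^ _); ring.
  have sq : (2 * B + 2 * C * t) ^+ 2 <= 4 * C * q t by rewrite /q; nra.
  have Ea : E `^ (a - 1) <= q t `^ (a - 1) by exact: ler_powRB1.
  rewrite /k2 /kap.
  have P0 := powR_ge0 (q t) (a - 1 - 1).
  set P := q t `^ (a - 1 - 1) in qa P0 *; set F := E `^ (a - 1) in Ea *.
  set S := (2 * B + 2 * C * t) ^+ 2 in sq *.
  have h1 : (1 - a) * P * S <= (1 - a) * P * (4 * C * q t).
    by rewrite ler_wpM2l// mulr_ge0//; lra.
  have h2 : (2 * a - 1) * C * F <= (2 * a - 1) * C * (q t * P).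
    by rewrite -qa ler_wpM2l// mulr_ge0//; lra.
  rewrite qa.
  have -> : a * ((a - 1) * P * S + q t * P * (2 * C)) -
     2 * (a * (2 * a - 1) * F * C) =
     a * (((1 - a) * P * (4 * C * q t) - (1 - a) * P * S) +
     2 * ((2 * a - 1) * C * (q t * P) - (2 * a - 1) * C * F)) by ring.
  by apply: mulr_ge0; lra.
have k10 (t : R) : 0 <= t <= 1 -> 0 <= k1 t.
  move=> /andP[t0 t1]; have : k1 0 <= k1 t.
    apply: (is_derive_le t0 (df := k2)) => x xt; [apply: dk1|apply: k20]; lra.
  by apply: le_trans; rewrite /k1 q0; nra.
have : k 0 <= k 1.
  exact: (is_derive_le ler01 dk k10).
rewrite /k q0 /q /kap !mulr0 expr0n/= expr1n !mulr1 mulr0 !subr0.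
lra.
Qed.

End powR_inequalities.

(** * Moduli, conjugation and points on circles *)

Section modulus_extra.
Context {R : realType}.
Implicit Types (z w : R[i]) (x : R).

Lemma normcX z n : normc (z ^+ n) = normc z ^+ n.
Proof. by elim: n => [|n IH]; rewrite ?expr0 ?normc1// !exprS normcM IH. Qed.

Lemma normc_real x : normc x%:C = `|x|.
Proof. by rewrite /normc/= expr0n/= addr0 sqrtr_sqr. Qed.

Lemma normc_nat n : normc (n%:R : R[i]) = n%:R.
Proof. by rewrite -(rmorph_nat (real_complex R)) normc_real ger0_norm. Qed.

Lemma normcB z w : normc (z - w) <= normc z + normc w.
Proof. by rewrite -(normcN w) normcD. Qed.

Lemma normc_i : normc ('i : R[i]) = 1.
Proof. by rewrite /normc/= expr0n/= add0r expr1n sqrtr1. Qed.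

Lemma sqr_normcE z : normc z ^+ 2 = complex.Re z ^+ 2 + complex.Im z ^+ 2.
Proof. by case: z => a b /=; rewrite sqr_sqrtr// addr_ge0// sqr_ge0. Qed.

Lemma sqr_normcJ z : (normc z ^+ 2)%:C = z * z^*.
Proof.
rewrite sqr_normcE; case: z => a b; apply/eqP; rewrite eq_complex/=.
by apply/andP; split; apply/eqP; ring.
Qed.

Lemma normc_Re z : `|complex.Re z| <= normc z.
Proof.
rewrite -(@ler_pXn2r _ 2)// ?nnegrE ?normc_ge0// real_normK ?num_real//.
by rewrite sqr_normcE lerDl sqr_ge0.
Qed.

Lemma normc_Im z : `|complex.Im z| <= normc z.
Proof.
rewrite -(@ler_pXn2r _ 2)// ?nnegrE ?normc_ge0// real_normK ?num_real//.
by rewrite sqr_normcE lerDr sqr_ge0.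
Qed.

Lemma normc_gt0 z : (0 < normc z) = (z != 0).
Proof.
rewrite lt_def normc_ge0 andbT; congr (~~ _); apply/eqP/eqP => [|->].
  exact: eq0_normc.
by rewrite normc0.
Qed.

Lemma normc_exp_le z n : normc z <= 1 -> (0 < n)%N -> normc (z ^+ n) <= normc z.
Proof.
move=> z1; case: n => // n _; rewrite normcX exprS ler_piMr ?normc_ge0//.
by rewrite exprn_ile1// normc_ge0.
Qed.

Lemma conjcD z w : (z + w)^* = z^* + w^*. Proof. exact: rmorphD. Qed.

Lemma conjcB z w : (z - w)^* = z^* - w^*. Proof. exact: rmorphB. Qed.

Lemma conjcM z w : (z * w)^* = z^* * w^*. Proof. exact: rmorphM. Qed.

Lemma conjc_quad (a b c d z : R[i]) :
  (a + b + (c + d) - 4 * z)^* = a^* + b^* + (c^* + d^*) - 4 * z^*.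
Proof.
case: a => ? ?; case: b => ? ?; case: c => ? ?; case: d => ? ?; case: z => ? ?.
by apply/eqP; rewrite eq_complex/=; apply/andP; split; apply/eqP; ring.
Qed.

Lemma circleE (r t : R) : circle r t = r%:C * circle 1 t.
Proof. by apply/eqP; rewrite eq_complex/=; apply/andP; split; apply/eqP; ring. Qed.

Lemma circleD (r s t : R) : circle r (t + s) = circle r t * circle 1 s.
Proof.
rewrite /circle cosD sinD; apply/eqP; rewrite eq_complex/=.
by apply/andP; split; apply/eqP; ring.
Qed.

Lemma circle_periodic (r t : R) : circle r (t + 2 * pi) = circle r t.
Proof. by rewrite /circle mulr_natl cosD2pi sinD2pi. Qed.

End modulus_extra.

(** * Four-point sums and submean functions *)

Section four_points.
Context {R : realType}.
Implicit Types (z w e : R[i]) (h : R).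

(* The Cayley transform maps reals to dilations and imaginary numbers to
   rotations, without logarithms. *)
Definition cayley e : R[i] := (1 + e) / (1 - e).

Lemma cayley_denom e : normc e <= 1 / 2 -> 1 / 2 <= normc (1 - e).
Proof.
move=> e2; have := normcD (1 - e) e; rewrite subrK normc1; lra.
Qed.

Lemma cayley_denom_neq0 e : normc e <= 1 / 2 -> 1 - e != 0.
Proof. by move=> /cayley_denom h; rewrite -normc_gt0; lra. Qed.

Lemma normc_cayley e : normc e <= 1 / 2 -> normc (cayley e) <= 3.
Proof.
move=> e2; have d := cayley_denom e2.
rewrite /cayley normcM normcV ler_pdivrMr; last by lra.
have := normcD 1 e; rewrite normc1; lra.
Qed.

(** The second-order Taylor polynomial of [cayley e ^+ n] at [0], as [cayley e] is the exponential
    of [2 artanh e]. *)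
Let jet n e : R[i] := 1 + 2 * n%:R * e + 2 * n%:R ^+ 2 * e ^+ 2.

Lemma cayley_jet n : exists2 K : R, 0 <= K & forall e, normc e <= 1 / 2 ->
  normc (cayley e ^+ n - (1 + 2 * n%:R * e + 2 * n%:R ^+ 2 * e ^+ 2)) <=
  K * normc e ^+ 3.
Proof.
elim: n => [|n [K K0 IH]].
  by exists 0 => // e _; rewrite mul0r (_ : _ - _ = 0) ?normc0//; ring.
pose m : R := n%:R.
exists (3 * K + 4 * (1 + m + m ^+ 2) + (4 * m + 6 * m ^+ 2)).
  have m0 : 0 <= m := ler0n _ _.
  by nra.
move=> e e2; have e0 := normc_ge0 e; have m0 : 0 <= m := ler0n _ _.
have d0 := cayley_denom_neq0 e2; have d := cayley_denom e2.
rewrite -/(jet n.+1 e).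
(* The identity behind this split is [cayley e = jet 1 e + 2 e^3 / (1 - e)]; the last summand is
   [jet n e * jet 1 e - jet n.+1 e], whose terms up to order two cancel. *)
have -> : cayley e ^+ n.+1 - jet n.+1 e =
   (cayley e ^+ n - jet n e) * cayley e + jet n e * (2 * e ^+ 3 / (1 - e)) +
   e ^+ 3 * (4 * n%:R + 4 * n%:R ^+ 2 + 4 * n%:R ^+ 2 * e).
  rewrite exprSr; set P := cayley e ^+ n; rewrite /jet /cayley -natr1.
  by field.
have h1 : normc ((cayley e ^+ n - jet n e) * cayley e) <= 3 * K * normc e ^+ 3.
  rewrite normcM; apply: le_trans (ler_pM (normc_ge0 _) (normc_ge0 _) (IH e e2)
    (normc_cayley e2)) _; lra.
have h2 : normc (jet n e * (2 * e ^+ 3 / (1 - e))) <=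
    4 * (1 + m + m ^+ 2) * normc e ^+ 3.
  have a : normc (jet n e) <= 1 + m + m ^+ 2.
    apply: le_trans (normcD _ _) _; apply: lerD.
      apply: le_trans (normcD _ _) _; rewrite normc1 lerD2l !normcM !normc_nat.
      by rewrite -/m; nra.
    rewrite !(normcX, normcM, normc_nat) -/m.
    have : normc e ^+ 2 <= 1 / 2 by nra.
    have : 0 <= m ^+ 2 by nra.
    by nra.
  have b : normc (2 * e ^+ 3 / (1 - e)) <= 4 * normc e ^+ 3.
    rewrite !(normcX, normcV, normcM, normc_nat) ler_pdivrMr; last by lra.
    have : 0 <= normc e ^+ 3 by rewrite exprn_ge0.
    by nra.
  rewrite normcM; apply: le_trans (ler_pM (normc_ge0 _) (normc_ge0 _) a b) _; lra.
have h3 : normc (e ^+ 3 * (4 * n%:R + 4 * n%:R ^+ 2 + 4 * n%:R ^+ 2 * e)) <=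
    (4 * m + 6 * m ^+ 2) * normc e ^+ 3.
  rewrite normcM normcX mulrC ler_wpM2r ?exprn_ge0//.
  apply: le_trans (normcD _ _) _; apply: (@le_trans _ _ ((4 * m + 4 * m ^+ 2) + 2 * m ^+ 2)); last by lra.
  apply: lerD; last by rewrite !(normcX, normcM, normc_nat) -/m; nra.
  by apply: le_trans (normcD _ _) _; rewrite !(normcX, normcM, normc_nat) -/m.
apply: le_trans (normcD _ _) _; apply: (@le_trans _ _
  ((3 * K * normc e ^+ 3 + 4 * (1 + m + m ^+ 2) * normc e ^+ 3) +
   (4 * m + 6 * m ^+ 2) * normc e ^+ 3)); last by lra.
by apply: lerD => //; apply: le_trans (normcD _ _) _; exact: lerD.
Qed.

(** In the coordinate [log z] the four points are shifts by [2 artanh h] and [2 i arctan h] with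
    both signs, so [quad F z h - 4 F z] is a discrete Laplacian. The codomain is general because
    both complex polynomials and real functions of them are inserted. *)
Definition quad (V : zmodType) (F : R[i] -> V) z h : V :=
  F (z * cayley h%:C) + F (z * cayley (- h%:C)) +
  (F (z * cayley (h%:C * 'i)) + F (z * cayley (- (h%:C * 'i)))).

Lemma quad_steps h : 0 <= h <= 1 / 2 ->
  [/\ normc (h%:C : R[i]) = h, normc (- h%:C : R[i]) = h,
      normc (h%:C * 'i : R[i]) = h & normc (- (h%:C * 'i) : R[i]) = h].
Proof.
by move=> /andP[h0 _]; rewrite !normcN !normcM normc_i normc_real ger0_norm// mulr1.
Qed.

(** The steps [h], [-h], [ih], [-ih] have sum zero and so have their squares, so that only the
    remainders of [cayley_jet] survive: [z^n] is harmonic up to third order. *)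
Lemma cayley_quad n : exists2 K : R, 0 <= K & forall h, 0 <= h <= 1 / 2 ->
  normc (cayley h%:C ^+ n + cayley (- h%:C) ^+ n +
    (cayley (h%:C * 'i) ^+ n + cayley (- (h%:C * 'i)) ^+ n) - 4) <= K * h ^+ 3.
Proof.
have [K K0 HK] := cayley_jet n; exists (4 * K); first by lra.
move=> h h2; have [e1 e2 e3 e4] := quad_steps h2.
have {h2} /andP[h0 h2] := h2.
set a := h%:C in e1 e2 e3 e4 *.
have -> : cayley a ^+ n + cayley (- a) ^+ n +
    (cayley (a * 'i) ^+ n + cayley (- (a * 'i)) ^+ n) - 4 =
  (cayley a ^+ n - jet n a) + (cayley (- a) ^+ n - jet n (- a)) +
  ((cayley (a * 'i) ^+ n - jet n (a * 'i)) +
   (cayley (- (a * 'i)) ^+ n - jet n (- (a * 'i)))).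
  rewrite /jet !sqrrN (_ : (a * 'i) ^+ 2 = - a ^+ 2); last by rewrite exprMn sqr_i mulrN1.
  by ring.
have := HK _ (eq_ind_r (fun x => x <= 1 / 2) h2 e1).
have := HK _ (eq_ind_r (fun x => x <= 1 / 2) h2 e2).
have := HK _ (eq_ind_r (fun x => x <= 1 / 2) h2 e3).
have := HK _ (eq_ind_r (fun x => x <= 1 / 2) h2 e4).
rewrite e1 e2 e3 e4 -/(jet n a) -/(jet n (- a)) -/(jet n (a * 'i)) -/(jet n (- (a * 'i))).
move=> h4 h3 h2' h1.
apply: le_trans (normcD _ _) _; apply: le_trans (lerD (normcD _ _) (normcD _ _)) _.
lra.
Qed.

Lemma cayley_exp_sub1 n : exists2 K : R, 0 <= K & forall e, normc e <= 1 / 2 ->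
  normc (cayley e ^+ n - 1) <= K * normc e.
Proof.
have [K K0 HK] := cayley_jet n; pose m : R := n%:R.
have m0 : 0 <= m := ler0n _ _.
exists (K + 2 * m + 2 * m ^+ 2); first by nra.
move=> e e2; have e0 := normc_ge0 e.
have -> : cayley e ^+ n - 1 = (cayley e ^+ n - jet n e) + (jet n e - 1) by ring.
apply: le_trans (normcD _ _) _.
apply: (@le_trans _ _ (K * normc e + (2 * m + 2 * m ^+ 2) * normc e)); last by lra.
apply: lerD.
  apply: le_trans (HK e e2) _; rewrite ler_wpM2l// exprS ler_piMr//.
  by nra.
have -> : jet n e - 1 = e * (2 * n%:R + 2 * n%:R ^+ 2 * e) by rewrite /jet; ring.
rewrite normcM mulrC ler_wpM2r//; apply: le_trans (normcD _ _) _.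
rewrite !(normcX, normcM, normc_nat) -/m lerD2l.
by have := sqr_ge0 m; nra.
Qed.

(** The factor [normc z] is gained because the constant term cancels in both differences. It makes
    the errors summable along a geometric sequence of radii. *)
Lemma poly_four_points (P : {poly R[i]}) : exists2 K : R, 0 <= K &
  forall z h, normc z <= 1 -> 0 <= h <= 1 / 2 ->
  normc (quad (horner P) z h - 4 * P.[z]) <= K * normc z * h ^+ 3 /\
  forall e, normc e <= 1 / 2 ->
    normc (P.[z * cayley e] - P.[z]) <= K * normc z * normc e.
Proof.
pose F n z : R[i] := \sum_(i < n) P`_i * z ^+ i.
suff [K K0 HK] : exists2 K : R, 0 <= K &
  forall z h, normc z <= 1 -> 0 <= h <= 1 / 2 ->
  normc (quad (F (size P)) z h - 4 * F (size P) z) <= K * normc z * h ^+ 3 /\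
  forall e, normc e <= 1 / 2 ->
    normc (F (size P) (z * cayley e) - F (size P) z) <= K * normc z * normc e.
  have -> : horner P = F (size P) by apply/funext => z; rewrite horner_coef.
  by exists K.
elim: (size P) => [|n [K K0 IH]].
  exists 0 => // z h z1 h2; rewrite /quad /F !big_ord0 !addr0 mulr0 subr0 normc0.
  split; first by rewrite !mul0r.
  by move=> e _; rewrite !big_ord0 subr0 normc0 !mul0r.
have [K1 K10 H1] := cayley_quad n; have [K2 K20 H2] := cayley_exp_sub1 n.
pose c := normc P`_n; have c0 : 0 <= c := normc_ge0 _.
exists (K + c * K1 + c * K2); first by nra.
(* A factor [normc z] can be extracted from [z ^+ n] only for [n > 0]; for [n = 0] the other factor
   [B] vanishes. *)
have zn z (A B : R) : normc z <= 1 -> 0 <= A -> (n = 0%N -> B = 0) -> B <= A ->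
    normc (P`_n * z ^+ n) * B <= c * normc z * A.
  move=> z1 A0; case: (posnP n) => [->|n0] => [/(_ erefl) -> _|_ BA].
    by rewrite mulr0 !mulr_ge0// normc_ge0.
  rewrite normcM -!mulrA ler_wpM2l//; apply: (@le_trans _ _ (normc (z ^+ n) * A)).
    by rewrite ler_wpM2l// normc_ge0.
  by rewrite ler_wpM2r// normc_exp_le.
move=> z h z1 h2; have z0 := normc_ge0 z.
have /andP[h0 _] := h2; have h30 : 0 <= h ^+ 3 by rewrite exprn_ge0.
have [Ha Hb] := IH z h z1 h2; split.
  have -> : quad (F n.+1) z h - 4 * F n.+1 z = (quad (F n) z h - 4 * F n z) +
     P`_n * z ^+ n * (cayley h%:C ^+ n + cayley (- h%:C) ^+ n +
    (cayley (h%:C * 'i) ^+ n + cayley (- (h%:C * 'i)) ^+ n) - 4).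
    by rewrite /quad /F !big_ord_recr/= !exprMn; ring.
  apply: le_trans (normcD _ _) _; rewrite normcM.
  have := @zn z (K1 * h ^+ 3) _ z1 (mulr_ge0 K10 h30) _ (H1 h h2).
  move=> /(_ _)/wrap[n0|h1].
    by rewrite n0 !expr0 (_ : 1 + 1 + (1 + 1) - 4 = 0) ?normc0//; ring.
  have := mulr_ge0 (mulr_ge0 (mulr_ge0 c0 K20) z0) h30; lra.
move=> e e2; have -> : F n.+1 (z * cayley e) - F n.+1 z =
   (F n (z * cayley e) - F n z) + P`_n * z ^+ n * (cayley e ^+ n - 1).
  by rewrite /F !big_ord_recr/= !exprMn; ring.
apply: le_trans (normcD _ _) _; rewrite normcM.
have e0 := normc_ge0 e.
have := @zn z (K2 * normc e) _ z1 (mulr_ge0 K20 e0) _ (H2 e e2).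
move=> /(_ _)/wrap[n0|h1].
  by rewrite n0 !expr0 subrr normc0.
have := Hb e e2.
have := mulr_ge0 (mulr_ge0 (mulr_ge0 c0 K10) z0) e0; lra.
Qed.

End four_points.

(** * Means of submean functions over concentric circles *)

Section submean.
Context {R : realType}.
Implicit Types (z w : R[i]) (r t h : R).

Lemma cayley_real h : cayley (h%:C) = ((1 + h) / (1 - h))%:C.
Proof. by rewrite /cayley rmorphM fmorphV rmorphD rmorphB rmorph1. Qed.

Lemma cayleyN (e : R[i]) : cayley (- e) = (cayley e)^-1.
Proof. by rewrite /cayley opprK invf_div. Qed.

Lemma cayley_rotation h : 0 <= h <= 1 / 2 -> exists s : R,
  cayley (h%:C * 'i) = circle 1 s /\ cayley (- (h%:C * 'i)) = circle 1 (- s).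
Proof.
move=> h2; have [_ _ e3 e4] := @quad_steps R h h2; have {h2} /andP[h0 h2] := h2.
have n1 : normc (cayley (h%:C * 'i)) = 1.
  rewrite /cayley normcM normcV.
  have -> : 1 - h%:C * 'i = (1 + h%:C * 'i)^* :> R[i].
    by apply/eqP; rewrite eq_complex/=; apply/andP; split; apply/eqP; ring.
  rewrite Defs.normcJ mulfV// gt_eqF// normc_gt0.
  by have := @cayley_denom_neq0 R (- (h%:C * 'i)); rewrite opprK; apply; rewrite e4.
have [s _ hs] := circle_surj (cayley (h%:C * 'i)).
rewrite n1 in hs; exists s; split => //.
rewrite cayleyN hs.
have h1 : circle 1 s * circle 1 (- s) = 1 :> R[i].
  rewrite -circleD subrr /circle cos0 sin0 mulr1 mulr0.
  by apply/eqP; rewrite eq_complex/= !eqxx.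
have s0 : circle 1 s != 0 :> R[i] by rewrite -normc_gt0 normc_circle.
by apply: (mulfI s0); rewrite h1 mulfV.
Qed.

Variables (G : R[i] -> R) (K h0 : R).
Hypothesis cG : forall r, continuous (fun t => G (circle r t)).
Hypothesis h00 : 0 < h0 <= 1 / 2.
Hypothesis K0 : 0 <= K.
Hypothesis G4 : forall z h, normc z <= 1 -> 0 <= h <= h0 ->
  - (K * normc z * h ^+ 3) <= quad G z h - 4 * G z.
Hypothesis GL : forall z, normc z <= 1 -> `|G z - G 0| <= K * normc z.

Let A r := mean (fun t => G (circle r t)).

(** Averaging [G4] over the circle turns each rotated term into [A r] by [mean_shift]. What remains
    is a second difference of [A] on a geometric progression of radii: convexity in [log r] up to a
    third-order error. *)
Let A_step r h : 0 <= r <= 1 -> 0 <= h <= h0 ->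
  - (K * r * h ^+ 3) <= A (r * ((1 + h) / (1 - h))) +
     A (r * ((1 - h) / (1 + h))) - 2 * A r.
Proof.
move=> /andP[r0 r1] hh0; have h0b := h00; have h2 : 0 <= h <= 1 / 2 by lra.
have [s [s1 s2]] := cayley_rotation h2.
pose k := (1 + h) / (1 - h).
have qE t : quad G (circle r t) h = G (circle (r * k) t) +
    G (circle (r * ((1 - h) / (1 + h))) t) +
    (G (circle r (t + s)) + G (circle r (t - s))).
  rewrite /quad s1 s2 -!circleD -(rmorphN (real_complex R)) !cayley_real opprK.
  rewrite (circleE (r * k)) (circleE (r * _)) (circleE r t) !rmorphM.
  by rewrite !(mulrAC _ (circle 1 t)).
have per u t : G (circle u (t + 2 * pi)) = G (circle u t) by rewrite circle_periodic.
have cS a : continuous (fun t => G (circle r (t + a))).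
  move=> t; apply: (@continuous_comp _ _ _ (fun t => t + a) (fun t => G (circle r t))).
    by apply: cvgD; [exact: cvg_id|exact: cvg_cst].
  exact: cG.
have -> : 2 * A r = mean (fun t => G (circle r (t + s))) +
    mean (fun t => G (circle r (t - s))).
  rewrite (@mean_shift _ (fun t => G (circle r t)) s)//.
  by rewrite (@mean_shift _ (fun t => G (circle r t)) (- s))// mulr2n mulrDl mul1r.
rewrite -(mean_cst (- (K * r * h ^+ 3))).
have c1 : continuous (fun t => G (circle (r * k) t) +
    G (circle (r * ((1 - h) / (1 + h))) t)).
  by move=> t; apply: cvgD; exact: cG.
have c2 : continuous (fun t => G (circle r (t + s)) + G (circle r (t - s))).
  by move=> t; apply: cvgD; exact: cS.
have c3 : continuous (fun t => 4 * G (circle r t)).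
  by move=> t; apply: cvgM; [exact: cvg_cst|exact: cG].
have c4 : continuous (fun t => quad G (circle r t) h).
  by rewrite (funext qE) => t; apply: cvgD; [exact: c1|exact: c2].
have c5 : continuous (fun t => quad G (circle r t) h - 4 * G (circle r t)).
  by move=> t; apply: cvgB; [exact: c4|exact: c3].
apply: (@le_trans _ _ (mean (fun t => quad G (circle r t) h - 4 * G (circle r t)))).
  apply: le_mean => //; first by move=> t; exact: cvg_cst.
  move=> t; have := @G4 (circle r t) h; rewrite normc_circle//; apply => //.
rewrite meanB// (eq_mean qE) meanD// meanD; [|exact: cG|exact: cG].
rewrite meanZ; last exact: cG.
rewrite meanD//.
rewrite (@mean_shift _ (fun t => G (circle r t)) s)//.
rewrite (@mean_shift _ (fun t => G (circle r t)) (- s))//.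
rewrite -/(A r) -/(A (r * k)) -/(A (r * _)); lra.
Qed.

Let A_lip r : 0 <= r <= 1 -> `|A r - G 0| <= K * r.
Proof.
move=> /andP[r0 r1]; rewrite -(mean_cst (G 0)); apply: dist_mean => //.
  by move=> t; exact: cvg_cst.
by move=> t; have := @GL (circle r t); rewrite normc_circle//; apply.
Qed.

Lemma expr_lt_eps (x e : R) : 0 <= x < 1 -> 0 < e -> exists j, x ^+ j < e.
Proof.
move=> /andP[x0 x1] e0.
have /cvgrPdist_lt/(_ e e0) : x ^+ n @[n --> \oo] --> 0.
  by apply: cvg_expr; rewrite ger0_norm.
by case=> j _ /(_ j (leqnn _)); rewrite sub0r normrN ger0_norm ?exprn_ge0//; exists j.
Qed.

(** Along the radii [x^n] the decrements [d n], corrected by [c x^n], are nonincreasing in [n], and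
    they tend to [0] because [A] is continuous at radius [0]. They are therefore nonnegative, and
    summing them compares [A (x^j)] with [A 1]. *)
Let A_geom h j : 0 < h <= h0 -> A (((1 - h) / (1 + h)) ^+ j) <= A 1 + K * h.
Proof.
move=> hh; have h0b := h00; have Kb := K0; have hpos : 0 < h by lra.
pose x := (1 - h) / (1 + h).
have x01 : 0 < x < 1 by rewrite /x divr_gt0 ?ltr_pdivrMr; lra.
have x0 : 0 < x by lra.
have xle n : 0 <= x ^+ n <= 1.
  by rewrite exprn_ge0 ?exprn_ile1//; lra.
have xV : (1 + h) / (1 - h) = x^-1 by rewrite /x invf_div.
have x1h : 1 - x = 2 * h / (1 + h) by rewrite /x; field; lra.
(* With this [c] the drop from [c x^n] to [c x^(n+1)] equals the error [K x^(n+1) h^3] of [A_step]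
   at radius [x^(n+1)]. *)
pose c := K * h ^+ 3 * x / (1 - x).
pose d n := A (x ^+ n) - A (x ^+ n.+1).
have dstep n : d n.+1 + c * x ^+ n.+1 <= d n + c * x ^+ n.
  have := @A_step (x ^+ n.+1) h (xle _); rewrite xV exprSr mulfK ?gt_eqF//.
  rewrite -exprSr -exprSr => /(_ _)/= s.
  have {s} : - (K * x ^+ n.+1 * h ^+ 3) <=
    A (x ^+ n) + A (x ^+ n.+2) - 2 * A (x ^+ n.+1) by apply: s; lra.
  rewrite /d.
  have : c * x ^+ n - c * x ^+ n.+1 = K * x ^+ n.+1 * h ^+ 3.
    by rewrite /c (exprSr x); field; lra.
  lra.
have dmono m n : d (m + n)%N + c * x ^+ (m + n) <= d m + c * x ^+ m.
  elim: n => [|n IH]; first by rewrite addn0.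
  by rewrite addnS; exact: le_trans (dstep _) IH.
have c0 : 0 <= c.
  apply: divr_ge0; last by lra.
  by apply: mulr_ge0; [apply: mulr_ge0 => //; apply: exprn_ge0; lra|lra].
(* A negative value at [m] would persist at all later indices by [dmono], whereas [A_lip] bounds
   [d (m + n)] below by [- 2 K x^n], which tends to [0]. *)
have dge m : 0 <= d m + c * x ^+ m.
  rewrite leNgt; apply/negP => neg.
  have [n xn] : exists n, x ^+ n < - (d m + c * x ^+ m) / (2 * K + 1).
    by apply: expr_lt_eps; [lra|rewrite divr_gt0//; lra].
  have := dmono m n.
  have xmn : x ^+ (m + n) <= x ^+ n.
    by rewrite exprD ler_piMl//; have := xle n; have := xle m; lra.
  have := A_lip (xle (m + n)%N); have := A_lip (xle (m + n).+1).
  rewrite !ler_norml => /andP[l1 l2] /andP[l3 l4].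
  have xs : x ^+ (m + n).+1 <= x ^+ (m + n).
    by rewrite exprS ler_piMl//; have := xle (m + n)%N; lra.
  have : - (2 * K * x ^+ n) <= d (m + n)%N.
    rewrite /d; have : K * x ^+ (m + n).+1 <= K * x ^+ n.
      by rewrite ler_wpM2l//; lra.
    have : K * x ^+ (m + n) <= K * x ^+ n by rewrite ler_wpM2l.
    lra.
  have : 0 <= c * x ^+ (m + n) by rewrite mulr_ge0//; have := xle (m + n)%N; lra.
  move: xn; rewrite ltr_pdivlMr; last by lra.
  have := xle n; lra.
(* Second summation: [c' x^n - c' x^(n+1) = c x^n]. As [1 - x = 2h / (1 + h)], the total error [c']
   is only of order [h]. *)
pose c' := c / (1 - x).
have Amono n : A (x ^+ n) + c' * x ^+ n <= A 1 + c'.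
  elim: n => [|n IH]; first by rewrite expr0 mulr1.
  apply: le_trans IH; have := dge n; rewrite /d.
  have : c' * x ^+ n - c' * x ^+ n.+1 = c * x ^+ n.
    by rewrite /c' (exprS x); field; lra.
  lra.
have := Amono j; rewrite -/x.
have : 0 <= c' * x ^+ j.
  have /andP[xj _] := xle j; apply: mulr_ge0 => //; apply: divr_ge0 => //; lra.
have : c' <= K * h.
  have y0 : 0 < 1 - x by lra.
  rewrite /c' /c ler_pdivrMr// ler_pdivrMr//.
  have -> : K * h ^+ 3 * x = K * h * (h ^+ 2 * x) by ring.
  rewrite -[leRHS]mulrA; apply: ler_wpM2l; first by apply: mulr_ge0 => //; lra.
  have -> : h ^+ 2 * x = h ^+ 2 * (1 - h ^+ 2) / (1 + h) ^+ 2.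
    by rewrite /x; field; lra.
  have -> : (1 - x) * (1 - x) = 4 * h ^+ 2 / (1 + h) ^+ 2.
    by rewrite x1h; field; lra.
  rewrite ler_wpM2r ?invr_ge0 ?sqr_ge0//.
  by have := sqr_ge0 h; nra.
lra.
Qed.

Lemma mean_circle_le r : 0 <= r <= 1 ->
  mean (fun t => G (circle r t)) <= mean (fun t => G (circle 1 t)).
Proof.
have h0b := h00; have Kb := K0.
(* Radius [0] lies on no geometric sequence of radii; it is reached as a limit of small [u] through
   [A_lip]. *)
suff pos u : 0 < u < 1 -> A u <= A 1.
  move=> /andP[]; rewrite le_eqVlt => /predU1P[<- _|r0].
    apply/ler_addgt0Pr => e e0; pose u := Num.min (1 / 2) (e / (2 * K + 1)).
    have u0 : 0 < u by rewrite lt_min; apply/andP; split; [lra|apply: divr_gt0; lra].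
    have u1 : u < 1 by rewrite /u gt_min; apply/orP; left; lra.
    have uK : 2 * K * u <= e.
      apply: (@le_trans _ _ ((2 * K + 1) * u)); first by lra.
      by rewrite mulrC -ler_pdivlMr; [rewrite /u ge_min lexx orbT|lra].
    have u01 : 0 <= u <= 1 by lra.
    have := A_lip u01; have := @A_lip 0; rewrite lexx ler01 => /(_ isT).
    rewrite mulr0 normr_le0 subr_eq0 => /eqP; rewrite -/(A 0) -/(A 1) => ->.
    rewrite ler_norml => /andP[h1 _]; have := @pos u; rewrite u0 u1 => /(_ isT).
    have : 0 <= K * u by rewrite mulr_ge0// ltW.
    by lra.
  by rewrite le_eqVlt => /predU1P[-> //|r1]; apply: pos; rewrite r0.
move=> /andP[u0 u1]; apply/ler_addgt0Pr => e e0.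
pose eta := Num.min h0 (e / (K + 1)).
have eta0 : 0 < eta.
  by rewrite lt_min; apply/andP; split; [lra|apply: divr_gt0; lra].
(* The radius [u] has to be hit exactly by some [x^(j+1)] with a small step. For the root [k] of
   order [j+1] of [u^-1], Bernoulli's inequality gives [(j+1) (k-1) <= u^-1], so this [j] makes
   [k - 1 <= eta]. *)
pose j := Num.truncn (u^-1 / eta).
pose k := u^-1 `^ (j.+1%:R^-1).
have uV : 1 < u^-1 by rewrite invf_gt1.
have kj : k ^+ j.+1 = u^-1.
  rewrite -powR_mulrn ?powR_ge0// -powRrM mulVf ?pnatr_eq0// powRr1//.
  by rewrite ltW// (lt_trans ltr01).
have k1 : 1 < k.
  rewrite ltNge; apply/negP => kle; have : k ^+ j.+1 <= 1.
    by rewrite exprn_ile1// powR_ge0.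
  by rewrite kj leNgt uV.
have bern : j.+1%:R * (k - 1) <= u^-1.
  rewrite -kj; elim: (j.+1) => [|n IH]; first by rewrite mul0r expr0.
  have : 1 <= k ^+ n by rewrite exprn_ege1// ltW.
  by rewrite -natr1 exprSr; nra.
(* The solution of [(1 + h) / (1 - h) = k]. *)
pose h := (k - 1) / (k + 1).
have h0' : 0 < h by rewrite divr_gt0//; lra.
have heta : h <= eta.
  apply: (@le_trans _ _ (k - 1)).
    by rewrite ler_pdivrMr; [nra|lra].
  have : u^-1 / eta < j.+1%:R.
    by have := @truncnS_gt R (u^-1 / eta).
  rewrite ltr_pdivrMr// => lt1.
  have : j.+1%:R * (k - 1) <= j.+1%:R * eta by lra.
  by rewrite ler_pM2l.
have hh : 0 < h <= h0.
  by rewrite h0'/= (le_trans heta)// /eta ge_min lexx.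
have := A_geom j.+1 hh.
have -> : ((1 - h) / (1 + h)) ^+ j.+1 = u.
  have -> : (1 - h) / (1 + h) = k^-1 by rewrite /h; field; lra.
  by rewrite exprVn kj invrK.
have : K * h <= e.
  apply: (@le_trans _ _ ((K + 1) * eta)).
    by nra.
  by rewrite mulrC -ler_pdivlMr; [rewrite /eta ge_min lexx orbT|lra].
by lra.
Qed.

End submean.

(** * Continuity of the integrands *)

Section continuity.
Context {R : realType}.
Implicit Types (f g : R -> R[i]) (p r t : R).

Lemma continuous_conjc f : continuous (f : R -> R[i]^o) ->
  continuous (fun t => (f t)^* : R[i]^o).
Proof.
move=> cf t; apply/cvgrPdist_lt => e e0.
have /cvgrPdist_lt/(_ e e0) := cf t; apply: filterS => s.
by rewrite -rmorphB /= !normCE Defs.normcJ.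
Qed.

Lemma continuous_poly_circle (P : {poly R[i]}) r :
  continuous (fun t => P.[circle r t] : R[i]^o).
Proof.
elim/poly_ind: P => [|P c IH] t.
  under eq_fun do rewrite horner0; exact: cvg_cst.
under eq_fun do rewrite hornerMXaddC.
apply: (@cvgD R[i] R[i]^o); last exact: cvg_cst.
by apply: (@cvgM R[i]); [exact: IH|exact: continuous_circle].
Qed.

Lemma continuous_normc_comp f : continuous (f : R -> R[i]^o) ->
  continuous (fun t => normc (f t)).
Proof.
move=> cf t; apply: (@continuous_comp _ R[i]^o _ f (@normc R)).
  exact: cf.
exact: continuous_normc.
Qed.

Lemma continuous_norm_powR p f : 1 <= p -> continuous (f : R -> R[i]^o) ->
  continuous (fun t => normc (f t) `^ p).
Proof.
move=> p1 /continuous_normc_comp cf t; apply/cvgrPdist_lt => e e0.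
pose M := normc (f t) + 1; have f0 := normc_ge0 (f t).
pose L := p * M `^ (p - 1) + 1.
have L0 : 0 < L by rewrite ltr_wpDl// mulr_ge0 ?powR_ge0//; lra.
have d0 : 0 < Num.min 1 (e / L) by rewrite lt_min ltr01 divr_gt0.
have /cvgrPdist_lt/(_ _ d0) := cf t; apply: filterS => s.
rewrite lt_min => /andP[s1 s2].
have sM : normc (f s) <= M by move: s1; rewrite ltr_norml /M => /andP[]; lra.
apply: (@le_lt_trans _ _ (L * `|normc (f t) - normc (f s)|)); last first.
  by rewrite mulrC -ltr_pdivlMr.
apply: (le_trans (@powR_lipschitz _ p M _ _ p1 _ _)).
- by rewrite f0 /M; lra.
- by rewrite normc_ge0.
- by rewrite ler_wpM2r// /L lerDl.
Qed.

Lemma continuous_powR_pos (a : R) (u : R -> R) : continuous u ->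
  (forall t, 0 < u t) -> continuous (fun t => u t `^ a).
Proof.
move=> cu u0 t; apply: (@continuous_comp _ _ _ u (fun x => x `^ a)); first exact: cu.
apply/differentiable_continuous/derivable1_diffP.
by have [] := is_derive1_powR a (u0 t).
Qed.

Lemma continuous_sqr_normc f : continuous (f : R -> R[i]^o) ->
  continuous (fun t => normc (f t) ^+ 2).
Proof.
by move=> /continuous_normc_comp cf t; apply: cvgM; exact: cf.
Qed.

End continuity.

(** * Convex functions of harmonic polynomials *)

Section polynomials.
Context {R : realType}.
Implicit Types (P Q : {poly R[i]}) (z w : R[i]) (p r t : R).

Lemma poly_bound P : exists2 M : R, 0 <= M & forall z, normc z <= 1 ->
  normc P.[z] <= M /\ normc (P.[z] - P.[0]) <= M * normc z.
Proof.
elim/poly_ind: P => [|P c [M M0 IH]].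
  by exists 0 => // z z1; rewrite !horner0 subr0 normc0 mul0r.
exists (M + normc c); first by rewrite addr_ge0// normc_ge0.
move=> z z1; have [b _] := IH z z1; have z0 := normc_ge0 z.
have c0 := normc_ge0 c; have P0 := normc_ge0 P.[z].
rewrite !hornerMXaddC mulr0 add0r addrK normcM; split.
  by apply: (le_trans (normcD _ _)); rewrite normcM; nra.
by nra.
Qed.

Lemma powR_subgradient p z : 1 <= p -> exists2 l : R[i],
  normc l <= p * normc z `^ (p - 1) &
  forall w, normc z `^ p + complex.Re (l * (w - z)) <= normc w `^ p.
Proof.
(* At [z = 0] division by zero gives [u = 0], hence [l = 0], which is a subgradient there also for
   [p = 1]. *)
move=> p1; pose u := z^* / (normc z)%:C.
have zV : z^* * z = (normc z ^+ 2)%:C by rewrite mulrC sqr_normcJ.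
have uz : complex.Re (u * z) = normc z.
  rewrite /u mulrAC zV; have [->|z0] := eqVneq z 0.
    by rewrite -fmorphV -rmorphM normc0 invr0 mulr0.
  by rewrite -fmorphV -rmorphM/= expr2 mulfK// gt_eqF// normc_gt0.
have u1 : normc u <= 1.
  rewrite normcM normcV Defs.normcJ normc_real ger0_norm ?normc_ge0//.
  have [->|z0] := eqVneq (normc z) 0; first by rewrite mul0r.
  by rewrite mulfV.
pose k := p * normc z `^ (p - 1).
have k0 : 0 <= k by rewrite mulr_ge0 ?powR_ge0//; lra.
exists (k%:C * u).
  by rewrite normcM normc_real ger0_norm// ler_piMr.
move=> w; have := powR_tangent p1 (normc_ge0 z) (normc_ge0 w); apply: le_trans.
rewrite lerD2l -/k -mulrA mulrBr.
have -> : complex.Re (k%:C * (u * w - u * z)) = k * (complex.Re (u * w) - normc z).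
  by rewrite -uz; case: (u * w) => a b; case: (u * z) => c d /=; ring.
rewrite ler_wpM2l// lerD2r; apply: le_trans (ler_norm _) _.
apply: le_trans (normc_Re _) _; rewrite normcM.
by rewrite ler_piMl// normc_ge0.
Qed.

(** A convex function of the harmonic function [F] is submean: adding the four subgradient
    inequalities at [F z] leaves the real part of [l] times [quad F z h - 4 F z], and this
    difference is of third order by [poly_four_points]. *)
Lemma harmonic_mean_le p P Q r : 1 <= p -> 0 <= r <= 1 ->
  mean (fun t => normc (P.[circle r t] + (Q.[circle r t])^*) `^ p) <=
  mean (fun t => normc (P.[circle 1 t] + (Q.[circle 1 t])^*) `^ p).
Proof.
move=> p1 r01.
have [K1 K10 H1] := poly_four_points P; have [K2 K20 H2] := poly_four_points Q.
have [M1 M10 B1] := poly_bound P; have [M2 M20 B2] := poly_bound Q.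
pose F z := P.[z] + (Q.[z])^*; pose G z := normc (F z) `^ p.
pose M := M1 + M2; pose L := p * M `^ (p - 1).
have M0 : 0 <= M by exact: addr_ge0.
have L0 : 0 <= L by rewrite mulr_ge0 ?powR_ge0//; lra.
have FM z : normc z <= 1 -> normc (F z) <= M.
  move=> z1; apply: (le_trans (normcD _ _)); rewrite Defs.normcJ.
  by apply: lerD; [have [] := B1 z z1|have [] := B2 z z1].
have z01 : normc (0 : R[i]) <= 1 by rewrite normc0 ler01.
apply: (@mean_circle_le _ G (L * (K1 + K2) + L * M) (1 / 2)) => //.
- move=> s t; apply: continuous_norm_powR => // {}t.
  apply: (@cvgD R[i] R[i]^o); first exact: continuous_poly_circle.
  by apply: continuous_conjc; exact: continuous_poly_circle.
- by lra.
- by apply: addr_ge0; apply: mulr_ge0 => //; apply: addr_ge0.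
- move=> z h z1 h2; have [a1 _] := H1 z h z1 h2; have [a2 _] := H2 z h z1 h2.
  have [l lL lG] := powR_subgradient (F z) p1.
  have lL' : normc l <= L.
    apply: le_trans lL _; rewrite ler_wpM2l//; first by lra.
    apply: ge0_ler_powR; [lra|by rewrite nnegrE normc_ge0| |exact: FM].
    by rewrite nnegrE.
  have := lG (F (z * cayley h%:C)); have := lG (F (z * cayley (- h%:C))).
  have := lG (F (z * cayley (h%:C * 'i))); have := lG (F (z * cayley (- (h%:C * 'i)))).
  rewrite -!/(G _) /quad.
  have : normc (l * (quad F z h - 4 * F z)) <= L * ((K1 + K2) * normc z * h ^+ 3).
    rewrite normcM; apply: ler_pM => //; try exact: normc_ge0.
    have -> : quad F z h - 4 * F z =
       (quad (horner P) z h - 4 * P.[z]) + (quad (horner Q) z h - 4 * Q.[z])^*.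
      by rewrite /quad /F conjc_quad; ring.
    by apply: (le_trans (normcD _ _)); rewrite Defs.normcJ; lra.
  move=> /(le_trans (normc_Re _)); rewrite ler_norml => /andP[lo _].
  have /(congr1 (@complex.Re R)) : l * (quad F z h - 4 * F z) =
      (l * (F (z * cayley h%:C) - F z) + l * (F (z * cayley (- h%:C)) - F z)) +
      (l * (F (z * cayley (h%:C * 'i)) - F z) + l * (F (z * cayley (- (h%:C * 'i))) - F z)).
    by rewrite /quad; ring.
  have ReD (x y : R[i]) : complex.Re (x + y) = complex.Re x + complex.Re y.
    by case: x => ? ?; case: y.
  rewrite !ReD => eq h4 h3 h2' h1; rewrite eq in lo.
  have h0 : 0 <= L * M * normc z * h ^+ 3.
    apply: mulr_ge0; last by apply: exprn_ge0; lra.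
    by apply: mulr_ge0 (normc_ge0 _); exact: mulr_ge0.
  lra.
- move=> z z1; apply: (le_trans (@powR_lipschitz _ p M _ _ p1 _ _)).
  + by rewrite normc_ge0 FM.
  + by rewrite normc_ge0 FM.
  rewrite -/L mulrDl; apply: (@le_trans _ _ (L * M * normc z)); last first.
    by rewrite lerDr; apply: mulr_ge0 (normc_ge0 _); apply: mulr_ge0 => //; exact: addr_ge0.
  rewrite -mulrA ler_wpM2l//; apply: (le_trans (normc_dist _ _)).
  have -> : F z - F 0 = (P.[z] - P.[0]) + (Q.[z] - Q.[0])^*.
    by rewrite /F rmorphB/=; ring.
  apply: (le_trans (normcD _ _)); rewrite Defs.normcJ /M mulrDl.
  by apply: lerD; [have [] := B1 z z1|have [] := B2 z z1].
Qed.

End polynomials.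

(** * The Riesz inequality for polynomials *)

Section riesz.
Context {R : realType}.
Implicit Types (P Q : {poly R[i]}) (z w x d : R[i]) (p r t a e : R).

Lemma ReD x d : complex.Re (x + d) = complex.Re x + complex.Re d.
Proof. by case: x => ? ?; case: d. Qed.

Lemma sqr_normcD x d :
  normc (x + d) ^+ 2 = normc x ^+ 2 + 2 * complex.Re (x^* * d) + normc d ^+ 2.
Proof. by rewrite !sqr_normcE; case: x => ? ?; case: d => ? ? /=; ring. Qed.

Lemma sqr_normcD_le x d : normc (x + d) ^+ 2 <= 2 * normc x ^+ 2 + 2 * normc d ^+ 2.
Proof.
rewrite !sqr_normcE; case: x => a b; case: d => k l /=.
have := sqr_ge0 (a - k); have := sqr_ge0 (b - l); nra.
Qed.

(** [powR_quadratic] along the segment from [x] to [x + d]. Its discriminant condition is the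
    Cauchy-Schwarz inequality, and [e] keeps the quadratic positive. *)
Lemma sqr_norm_powR_convex a e (E : R) x d : 1 / 2 < a <= 1 -> 0 < e ->
  (forall t, 0 <= t <= 1 -> normc (x + t%:C * d) ^+ 2 + e <= E) ->
  (normc x ^+ 2 + e) `^ a
    + 2 * a * (normc x ^+ 2 + e) `^ (a - 1) * complex.Re (x^* * d)
    + a * (2 * a - 1) * E `^ (a - 1) * normc d ^+ 2 <=
  (normc (x + d) ^+ 2 + e) `^ a.
Proof.
move=> a12 e0 hE.
have -> : normc (x + d) ^+ 2 + e =
    (normc x ^+ 2 + e) + 2 * complex.Re (x^* * d) + normc d ^+ 2.
  by rewrite sqr_normcD; ring.
apply: powR_quadratic => //; first exact: sqr_ge0.
  rewrite mulrDl; apply: ler_wpDr; first by rewrite mulr_ge0 ?sqr_ge0// ltW.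
  rewrite !sqr_normcE; case: x {hE} => u v; case: d => k l /=.
  by have := sqr_ge0 (u * l - v * k); nra.
move=> t t01; have := hE t t01.
have -> : normc (x + t%:C * d) ^+ 2 + e =
    normc x ^+ 2 + e + 2 * complex.Re (x^* * d) * t + normc d ^+ 2 * t ^+ 2.
  rewrite sqr_normcD normcM normc_real exprMn real_normK ?num_real//.
  by case: x {hE} => u v; case: d => k l /=; ring.
move=> ->; rewrite andbT.
apply: (@lt_le_trans _ _ e) => //.
have : 0 <= normc (x + t%:C * d) ^+ 2 by exact: sqr_ge0.
rewrite sqr_normcD normcM normc_real exprMn real_normK ?num_real//.
have -> : complex.Re (x^* * (t%:C * d)) = complex.Re (x^* * d) * t.
  by case: x {hE} => u v; case: d => k l /=; ring.
lra.
Qed.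

(** Second-order form of [2 Re (w z) = |w + conj z|^2 - |w|^2 - |z|^2]. It trades the increment of
    [|w|^2 + |z|^2] for [|d|^2], with [d] the increment of [w + conj z], up to increments of [w],
    [z] and [w z]. On analytic functions the four-point sums of these three are negligible. *)
Lemma riesz_cross w z w1 z1 :
  complex.Re ((w1 * z1 - w * z) - (w + z^*) * (z1 - z) - (w + z^*)^* * (w1 - w)) =
  (normc ((w1 - w) + (z1 - z)^*) ^+ 2
   - (normc w1 ^+ 2 + normc z1 ^+ 2 - normc w ^+ 2 - normc z ^+ 2)) / 2.
Proof.
rewrite !sqr_normcE; case: w => ? ?; case: w1 => ? ?; case: z => ? ?.
by case: z1 => ? ? /=; field.
Qed.

(** The factor for which the second-order gain [a (2a-1) (4N)^(a-1) |d|^2] of the first power in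
    [riesz_fun] matches the loss [a N^(a-1) |d|^2] of the second one. It blows up as [a = p/2]
    approaches [1/2]. *)
Definition riesz_cst a : R := ((2 * a - 1) * 4 `^ (a - 1))^-1.

Definition riesz_fun a e w z : R :=
  riesz_cst a * (normc (w + z^*) ^+ 2 + 2 * e) `^ a
  - (normc w ^+ 2 + normc z ^+ 2 + e) `^ a.

Lemma riesz_cst_gt0 a : 1 / 2 < a -> 0 < riesz_cst a.
Proof. by move=> a2; rewrite invr_gt0 mulr_gt0 ?powR_gt0//; lra. Qed.

Lemma riesz_cst_ge1 a : 1 / 2 < a <= 1 -> 1 <= riesz_cst a.
Proof.
move=> a'; rewrite /riesz_cst invf_ge1; last by rewrite mulr_gt0 ?powR_gt0//; lra.
rewrite mulr_ile1 ?powR_ge0//; [lra|lra|].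
have h4 : 1 <= 4 :> R by lra.
have := ler_powR h4 (_ : a - 1 <= 0); rewrite powRr0; apply; lra.
Qed.

(** The first power is bounded below by [sqr_norm_powR_convex] and the second above by its tangent;
    with [riesz_cross] the terms in [|d|^2] cancel by the choice of [riesz_cst]. The left side is
    linear in the increments of [w], [z] and [w z], so that it can be summed over four points. *)
Lemma riesz_fun_gain a e w z w1 z1 (rho : R) : 1 / 2 < a <= 1 -> 0 < e ->
  normc (w1 - w) <= rho -> normc (z1 - z) <= rho -> 8 * rho ^+ 2 <= e ->
  2 * a * riesz_cst a * (normc (w + z^*) ^+ 2 + 2 * e) `^ (a - 1) *
    complex.Re ((w + z^*)^* * ((w1 - w) + (z1 - z)^*))
  + 2 * a * (normc w ^+ 2 + normc z ^+ 2 + e) `^ (a - 1) *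
    complex.Re ((w1 * z1 - w * z) - (w + z^*) * (z1 - z) - (w + z^*)^* * (w1 - w))
  <= riesz_fun a e w1 z1 - riesz_fun a e w z.
Proof.
move=> a' e01 wr zr re; set C := riesz_cst a.
have C0 : 0 < C by apply: riesz_cst_gt0; case/andP: a'.
set x := w + z^*; set d := (w1 - w) + (z1 - z)^*.
set N := normc w ^+ 2 + normc z ^+ 2 + e.
have N0 : 0 < N.
  by apply: ltr_wpDl => //; apply: addr_ge0; exact: sqr_ge0.
have rho0 : 0 <= rho := le_trans (normc_ge0 _) wr.
have dr : normc d ^+ 2 <= 4 * rho ^+ 2.
  have : normc d <= 2 * rho.
    by apply: (le_trans (normcD _ _)); rewrite Defs.normcJ mulr2n mulrDl mul1r lerD.
  by have := normc_ge0 d; nra.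
have xN : normc x ^+ 2 <= 2 * (normc w ^+ 2 + normc z ^+ 2).
  by have := sqr_normcD_le w z^*; rewrite Defs.normcJ -/x; lra.
have e20 : 0 < 2 * e by lra.
(* Two uses of [sqr_normcD_le] produce the factor [4] that appears in [riesz_cst]; the displacement
   costs at most [8 rho^2 <= e]. *)
have E4 t : 0 <= t <= 1 -> normc (x + t%:C * d) ^+ 2 + 2 * e <= 4 * N.
  move=> /andP[t0 t1]; have := sqr_normcD_le x (t%:C * d).
  rewrite normcM normc_real ger0_norm// exprMn.
  have : t ^+ 2 * normc d ^+ 2 <= normc d ^+ 2.
    by rewrite ler_piMl ?sqr_ge0// exprn_ile1.
  by rewrite /N; lra.
have c1 := sqr_norm_powR_convex a' e20 E4.
have xd : x + d = w1 + z1^* by rewrite /x /d rmorphB/=; ring.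
rewrite xd powRM in c1 => //; last exact: ltW.
have c2 : (normc w1 ^+ 2 + normc z1 ^+ 2 + e) `^ a <=
    N `^ a + a * N `^ (a - 1) * ((normc w1 ^+ 2 + normc z1 ^+ 2 + e) - N).
  apply: powR_concave => //; first by lra.
  by apply: addr_ge0 (ltW _) => //; apply: addr_ge0; exact: sqr_ge0.
rewrite /riesz_fun -/N -/x -/C.
have c3 := ler_wpM2l (ltW C0) c1.
have kE : C * (a * (2 * a - 1) * (4 `^ (a - 1) * N `^ (a - 1)) * normc d ^+ 2) =
    a * N `^ (a - 1) * normc d ^+ 2.
  have : 4 `^ (a - 1) != 0 :> R by rewrite gt_eqF// powR_gt0.
  by rewrite /C /riesz_cst => ?; field; apply/andP; split => //; lra.
rewrite riesz_cross -/d.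
move: c2 c3 kE; rewrite /N.
lra.
Qed.

(** Summed over the four points, the left sides of [riesz_fun_gain] depend only on the four-point
    sums [Sw], [Sz] and [Swz], all of modulus at most [del]. The weights are powers with exponent
    [a - 1 <= 0], hence at most [e^(a-1)]. *)
Lemma riesz_quad a e w z w1 w2 w3 w4 z1 z2 z3 z4 (M rho del : R) :
  1 / 2 < a <= 1 -> 0 < e -> normc w <= M -> normc z <= M -> 8 * rho ^+ 2 <= e ->
  [/\ normc (w1 - w) <= rho, normc (w2 - w) <= rho, normc (w3 - w) <= rho
    & normc (w4 - w) <= rho] ->
  [/\ normc (z1 - z) <= rho, normc (z2 - z) <= rho, normc (z3 - z) <= rho
    & normc (z4 - z) <= rho] ->
  normc (w1 + w2 + (w3 + w4) - 4 * w) <= del ->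
  normc (z1 + z2 + (z3 + z4) - 4 * z) <= del ->
  normc (w1 * z1 + w2 * z2 + (w3 * z3 + w4 * z4) - 4 * (w * z)) <= del ->
  - (e `^ (a - 1) * (8 * riesz_cst a * M + 2 * (1 + 4 * M)) * del) <=
  riesz_fun a e w1 z1 + riesz_fun a e w2 z2 +
  (riesz_fun a e w3 z3 + riesz_fun a e w4 z4) - 4 * riesz_fun a e w z.
Proof.
move=> a' e0 wM zM re [rw1 rw2 rw3 rw4] [rz1 rz2 rz3 rz4].
set Sw := _ - 4 * w; set Sz := _ - 4 * z; set Swz := _ - 4 * (w * z).
move=> hw hz hwz.
have g1 := riesz_fun_gain a' e0 rw1 rz1 re; have g2 := riesz_fun_gain a' e0 rw2 rz2 re.
have g3 := riesz_fun_gain a' e0 rw3 rz3 re; have g4 := riesz_fun_gain a' e0 rw4 rz4 re.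
have del0 : 0 <= del := le_trans (normc_ge0 _) hw.
have M0 : 0 <= M := le_trans (normc_ge0 _) wM.
set x := w + z^* in g1 g2 g3 g4.
have xM : normc x <= 2 * M.
  by apply: (le_trans (normcD _ _)); rewrite Defs.normcJ mulr2n mulrDl mul1r lerD.
set n := (_ + 2 * e) `^ (a - 1) in g1 g2 g3 g4.
set N := (_ + _ + e) `^ (a - 1) in g1 g2 g3 g4.
have decr (y : R) : 0 <= y -> (y + e) `^ (a - 1) <= e `^ (a - 1).
  by move=> y0; apply: ler_powRB1 => //; [case/andP: a'|rewrite lerDr].
have ne : n <= e `^ (a - 1).
  rewrite /n (_ : _ + 2 * e = (normc x ^+ 2 + e) + e); last by ring.
  by apply: decr; apply: addr_ge0 (ltW _) => //; exact: sqr_ge0.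
have Ne : N <= e `^ (a - 1) by apply: decr; apply: addr_ge0; exact: sqr_ge0.
have n0 : 0 <= n := powR_ge0 _ _; have N0 : 0 <= N := powR_ge0 _ _.
have r1 : - (4 * M * del) <= complex.Re (x^* * (Sw + Sz^*)).
  have : normc (x^* * (Sw + Sz^*)) <= 2 * M * (2 * del).
    rewrite normcM Defs.normcJ; apply: ler_pM; rewrite ?normc_ge0//.
    by apply: (le_trans (normcD _ _)); rewrite Defs.normcJ mulr2n mulrDl mul1r lerD.
  by move=> /(le_trans (normc_Re _)); rewrite ler_norml => /andP[+ _]; clear; lra.
have r2 : - ((1 + 4 * M) * del) <= complex.Re (Swz - x * Sz - x^* * Sw).
  have : normc (Swz - x * Sz - x^* * Sw) <= del + 2 * M * del + 2 * M * del.
    apply: (le_trans (normcB _ _)); apply: lerD.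
      apply: (le_trans (normcB _ _)); apply: lerD => //.
      by rewrite normcM; apply: ler_pM; rewrite ?normc_ge0.
    by rewrite normcM Defs.normcJ; apply: ler_pM; rewrite ?normc_ge0.
  by move=> /(le_trans (normc_Re _)); rewrite ler_norml => /andP[+ _]; clear; lra.
have E1 : complex.Re (x^* * (Sw + Sz^*)) =
  complex.Re (x^* * ((w1 - w) + (z1 - z)^*)) + complex.Re (x^* * ((w2 - w) + (z2 - z)^*))
  + (complex.Re (x^* * ((w3 - w) + (z3 - z)^*)) + complex.Re (x^* * ((w4 - w) + (z4 - z)^*))).
  rewrite -!ReD; congr complex.Re; rewrite /Sw /Sz.
  by rewrite conjc_quad !rmorphB/=; ring.
have E2 : complex.Re (Swz - x * Sz - x^* * Sw) =
  complex.Re ((w1 * z1 - w * z) - x * (z1 - z) - x^* * (w1 - w)) +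
  complex.Re ((w2 * z2 - w * z) - x * (z2 - z) - x^* * (w2 - w)) +
  (complex.Re ((w3 * z3 - w * z) - x * (z3 - z) - x^* * (w3 - w)) +
  complex.Re ((w4 * z4 - w * z) - x * (z4 - z) - x^* * (w4 - w))).
  by rewrite -!ReD; congr complex.Re; rewrite /Sw /Sz /Swz; ring.
set C := riesz_cst a; have C0 : 0 < C by apply: riesz_cst_gt0; case/andP: a'.
have low (m y B : R) : 0 <= m -> m <= e `^ (a - 1) -> 0 <= B -> - B <= y ->
    - (e `^ (a - 1) * B) <= m * y.
  move=> m0 me B0 By; apply: (@le_trans _ _ (m * - B)); last exact: ler_wpM2l.
  by rewrite mulrN lerN2; exact: ler_wpM2r.
have Md : 0 <= M * del by exact: mulr_ge0.
have k1 := low _ _ _ n0 ne _ r1.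
have k2 := low _ _ _ N0 Ne _ r2.
have {}k1 : - (e `^ (a - 1) * (4 * M * del)) <= n * complex.Re (x^* * (Sw + Sz^*)).
  by apply: k1; move: Md; clear; lra.
have {}k2 : - (e `^ (a - 1) * ((1 + 4 * M) * del)) <=
   N * complex.Re (Swz - x * Sz - x^* * Sw).
  by apply: k2; move: Md del0; clear; lra.
have a0 : 0 <= 2 * a by move: a'; clear; lra.
have a1 : a <= 1 by case/andP: a'.
have E0 : 0 <= e `^ (a - 1) := powR_ge0 _ _.
have kk (c X y : R) : 0 <= c -> 0 <= X -> - X <= y -> - (2 * c * X) <= 2 * a * c * y.
  move: a0 a1; clear => a0 a1 c0 X0 Xy.
  apply: (@le_trans _ _ (2 * a * c * - X)); last by rewrite ler_wpM2l// mulr_ge0.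
  have : 0 <= c * X by exact: mulr_ge0.
  by nra.
have h1 := kk C _ _ (ltW C0) (mulr_ge0 E0 (_ : 0 <= 4 * M * del)) k1.
have h2 := kk 1 _ _ ler01 (mulr_ge0 E0 (_ : 0 <= (1 + 4 * M) * del)) k2.
have {}h1 := h1 ltac:(by move: Md; clear; lra).
have {}h2 := h2 ltac:(by move: Md del0; clear; lra).
move: h1 h2 g1 g2 g3 g4; rewrite E1 E2 -/C; clear.
lra.
Qed.

(** The composite [g] of [riesz_fun] with [P] and [Q] is submean by [riesz_quad], so its mean over
    the unit circle is at least [g 0]. Since [Q] vanishes at [0] and [riesz_cst a >= 1], [g 0] is
    nonnegative. *)
Lemma riesz_reg a e P Q : 1 / 2 < a <= 1 -> 0 < e -> Q.[0] = 0 ->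
  mean (fun t => (normc P.[circle 1 t] ^+ 2 + normc Q.[circle 1 t] ^+ 2 + e) `^ a)
  <= riesz_cst a * mean (fun t =>
    (normc (P.[circle 1 t] + (Q.[circle 1 t])^*) ^+ 2 + 2 * e) `^ a).
Proof.
move=> a' e0 Q0; set C := riesz_cst a.
have C0 : 0 < C by apply: riesz_cst_gt0; case/andP: a'.
pose G := riesz_fun a e.
have [K1 K10 H1] := poly_four_points P; have [K2 K20 H2] := poly_four_points Q.
have [K3 K30 H3] := poly_four_points (P * Q).
have [M1 M10 B1] := poly_bound P; have [M2 M20 B2] := poly_bound Q.
pose g z := G P.[z] Q.[z].
pose K := K1 + K2 + K3; pose M := M1 + M2.
have M0 : 0 <= M by exact: addr_ge0.
have cP r := @continuous_poly_circle R P r; have cQ r := @continuous_poly_circle R Q r.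
have c1 r : continuous (fun t =>
    (normc (P.[circle r t] + (Q.[circle r t])^*) ^+ 2 + 2 * e) `^ a).
  apply: continuous_powR_pos => t; last first.
    by apply: ltr_wpDl; [exact: sqr_ge0|lra].
  apply: cvgD; last exact: cvg_cst.
  apply: continuous_sqr_normc => {}t; apply: (@cvgD R[i] R[i]^o); first exact: cP.
  by apply: continuous_conjc; exact: cQ.
have c2 r : continuous (fun t =>
    (normc P.[circle r t] ^+ 2 + normc Q.[circle r t] ^+ 2 + e) `^ a).
  apply: continuous_powR_pos => t; last first.
    by apply: ltr_wpDl => //; apply: addr_ge0; exact: sqr_ge0.
  apply: cvgD; last exact: cvg_cst.
  by apply: cvgD; apply: continuous_sqr_normc; [exact: cP|exact: cQ].
have cC r : continuous (fun t => C *
    (normc (P.[circle r t] + (Q.[circle r t])^*) ^+ 2 + 2 * e) `^ a).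
  by move=> t; apply: cvgM; [exact: cvg_cst|exact: c1].
have g0 : 0 <= g 0.
  rewrite /g /G /riesz_fun Q0 rmorph0 addr0 normc0 expr0n/= addr0 subr_ge0.
  apply: (@le_trans _ _ ((normc P.[0] ^+ 2 + 2 * e) `^ a)).
    have := sqr_ge0 (normc P.[0]) => s0.
    by apply: ge0_ler_powR; rewrite ?nnegrE; lra.
  by rewrite ler_peMl ?powR_ge0// riesz_cst_ge1.
suff : g 0 <= mean (fun t => g (circle 1 t)).
  by rewrite /g /G /riesz_fun meanB// meanZ// => h; have := le_trans g0 h; rewrite subr_ge0.
have -> : g 0 = mean (fun t => g (circle 0 t)).
  rewrite -[LHS]mean_cst; apply: eq_mean => t.
  by rewrite (_ : circle 0 t = 0)// /circle !mul0r.
(* The four points move the values by at most [rho = K h]. With [h <= 1/2] one has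
   [8 (K h)^2 <= 4 K^2 h <= e], as [riesz_quad] requires. *)
pose h0 := Num.min (1 / 2) (e / (4 * K ^+ 2 + 1)).
have K0 : 0 <= K by rewrite !addr_ge0.
have E0 : 0 <= e `^ (a - 1) := powR_ge0 _ _.
pose L1 := e `^ (a - 1) * (8 * C * M + 2 * (1 + 4 * M)) * K.
pose L2 := C * (e `^ (a - 1) * (2 * M ^+ 2)) + e `^ (a - 1) * (4 * M ^+ 2).
have CM0 : 0 <= C * M by apply: mulr_ge0 => //; exact: ltW.
have L10 : 0 <= L1 by apply: mulr_ge0 => //; apply: mulr_ge0 => //; lra.
have L20 : 0 <= L2.
  have s0 := sqr_ge0 M; apply: addr_ge0; last by apply: mulr_ge0 => //; lra.
  by apply: mulr_ge0; [exact: ltW|apply: mulr_ge0 => //; lra].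
have PM z : normc z <= 1 -> normc P.[z] <= M.
  by move=> /B1[b _]; apply: (le_trans b); rewrite /M; lra.
have QM z : normc z <= 1 -> normc Q.[z] <= M.
  by move=> /B2[b _]; apply: (le_trans b); rewrite /M; lra.
have z01 : normc (0 : R[i]) <= 1 by rewrite normc0 ler01.
apply: (@mean_circle_le _ g (L1 + L2) h0) => //; last by rewrite lexx ler01.
- move=> r t; rewrite /g /G /riesz_fun; apply: cvgB; [exact: cC|exact: c2].
- have k0 := sqr_ge0 K; rewrite lt_min ge_min lexx/= andbT.
  by apply/andP; split; [rewrite divr_gt0|apply: divr_gt0 => //; move: k0; clear; lra].
- exact: addr_ge0.
- move=> z h z1 /andP[h1]; rewrite /h0 le_min => /andP[h2 h3].
  have k0 := sqr_ge0 K.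
  have he : 8 * (K * h) ^+ 2 <= e.
    move: h3; rewrite ler_pdivlMr; last by lra.
    have : h ^+ 2 <= h / 2 by nra.
    move=> hh h3; rewrite exprMn.
    have : K ^+ 2 * h ^+ 2 <= K ^+ 2 * (h / 2) by apply: ler_wpM2l.
    lra.
  have h12 : 0 <= h <= 1 / 2 by rewrite h1.
  have [n1 n2 n3 n4] := @quad_steps R h h12.
  have [a1 b1] := H1 z h z1 h12; have [a2 b2] := H2 z h z1 h12.
  have [a3 _] := H3 z h z1 h12.
  have zn := normc_ge0 z; have h30 : 0 <= h ^+ 3 by exact: exprn_ge0.
  have zh : 0 <= normc z * h ^+ 3 by exact: mulr_ge0.
  have KK k : 0 <= k -> k <= K -> k * normc z * h ^+ 3 <= K * normc z * h ^+ 3.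
    by move=> ? ?; rewrite -!mulrA; exact: ler_wpM2r.
  have Kh k (y : R[i]) : 0 <= k -> k <= K -> normc y = h -> k * normc z * normc y <= K * h.
    move=> ? ? ->; rewrite ler_wpM2r//; apply: (@le_trans _ _ k) => //.
    by rewrite ler_piMr.
  have l1 : K1 <= K by rewrite /K -addrA lerDl addr_ge0.
  have l2 : K2 <= K by rewrite /K addrAC lerDr addr_ge0.
  have l3 : K3 <= K by rewrite /K lerDr addr_ge0.
  rewrite (_ : quad g z h - 4 * g z = G P.[z * cayley h%:C] Q.[z * cayley h%:C] +
     G P.[z * cayley (- h%:C)] Q.[z * cayley (- h%:C)] +
     (G P.[z * cayley (h%:C * 'i)] Q.[z * cayley (h%:C * 'i)] +
      G P.[z * cayley (- (h%:C * 'i))] Q.[z * cayley (- (h%:C * 'i))]) -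
      4 * G P.[z] Q.[z])//.
  have rz := @riesz_quad a e P.[z] Q.[z] P.[z * cayley h%:C] P.[z * cayley (- h%:C)]
    P.[z * cayley (h%:C * 'i)] P.[z * cayley (- (h%:C * 'i))]
    Q.[z * cayley h%:C] Q.[z * cayley (- h%:C)]
    Q.[z * cayley (h%:C * 'i)] Q.[z * cayley (- (h%:C * 'i))]
    M (K * h) (K * normc z * h ^+ 3) a' e0 (PM z z1) (QM z z1) he.
  apply: le_trans (rz _ _ _ _ _).
  + rewrite lerN2; apply: (@le_trans _ _ (L1 * (normc z * h ^+ 3))).
      by rewrite le_eqVlt; apply/orP; left; apply/eqP; rewrite /L1 -/C; ring.
    by rewrite -[leRHS]mulrA ler_wpM2r// lerDl.
  + by split; apply: le_trans (b1 _ _) (Kh _ _ _ _ _); rewrite ?n1 ?n2 ?n3 ?n4.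
  + by split; apply: le_trans (b2 _ _) (Kh _ _ _ _ _); rewrite ?n1 ?n2 ?n3 ?n4.
  + exact: le_trans a1 (KK _ _ _).
  + exact: le_trans a2 (KK _ _ _).
  + by move: a3; rewrite /quad !hornerM => a3; exact: le_trans a3 (KK _ _ _).
- move=> z z1; have zn := normc_ge0 z.
  have lip (u v : R) : e <= u -> e <= v -> `|u `^ a - v `^ a| <= e `^ (a - 1) * `|u - v|.
    wlog uv : u v / v <= u.
      move=> hw; have [/hw|/ltW/hw] := leP v u; first by apply.
      by move=> h' eu ev; rewrite distrC (distrC u); exact: h'.
    move=> eu ev; have v0 : 0 < v by lra.
    have uvp : v `^ a <= u `^ a.
      by apply: ge0_ler_powR => //; rewrite ?nnegrE; move: a' v0 eu e0; clear; lra.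
    rewrite !ger0_norm ?subr_ge0//.
    have a01 : 0 < a <= 1 by move: a'; clear; lra.
    have u0 : 0 <= u by lra.
    have := powR_concave a01 v0 u0 => cc.
    have ve : v `^ (a - 1) <= e `^ (a - 1).
      by apply: ler_powRB1 => //; case/andP: a'.
    have : a * v `^ (a - 1) * (u - v) <= e `^ (a - 1) * (u - v).
      apply: ler_wpM2r; first by rewrite subr_ge0.
      by apply: le_trans ve; rewrite ler_piMl ?powR_ge0//; case/andP: a'.
    by move: cc; clear; lra.
  have sq (x y : R[i]) k : normc x <= M -> normc y <= M -> normc (x - y) <= k ->
      `|normc x ^+ 2 - normc y ^+ 2| <= 2 * M * k.
    move=> xM yM xy; rewrite subr_sqr normrM mulrC.
    apply: ler_pM => //; last exact: le_trans (normc_dist _ _) xy.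
    by rewrite ger0_norm ?addr_ge0 ?normc_ge0//; lra.
  have [b1 d1] := B1 z z1; have [b2 d2] := B2 z z1.
  have [b10 _] := B1 0 z01; have [b20 _] := B2 0 z01.
  have FM y : normc y <= 1 -> normc (P.[y] + (Q.[y])^*) <= M.
    move=> y1; apply: (le_trans (normcD _ _)); rewrite Defs.normcJ /M.
    by apply: lerD; [have [] := B1 y y1|have [] := B2 y y1].
  have dF : normc ((P.[z] + (Q.[z])^*) - (P.[0] + (Q.[0])^*)) <= M * normc z.
    have -> : (P.[z] + (Q.[z])^*) - (P.[0] + (Q.[0])^*) =
       (P.[z] - P.[0]) + (Q.[z] - Q.[0])^* by rewrite rmorphB/=; ring.
    by apply: (le_trans (normcD _ _)); rewrite Defs.normcJ /M mulrDl lerD.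
  have M1M : M1 * normc z <= M * normc z by rewrite ler_wpM2r// /M lerDl.
  have M2M : M2 * normc z <= M * normc z by rewrite ler_wpM2r// /M lerDr.
  have s1 := sq _ _ _ (FM z z1) (FM 0 z01) dF.
  have s2 := sq _ _ _ (PM z z1) (PM 0 z01) (le_trans d1 M1M).
  have s3 := sq _ _ _ (QM z z1) (QM 0 z01) (le_trans d2 M2M).
  rewrite /g /G /riesz_fun -/C; set x1 := P.[z] + _; set x0 := P.[0] + _.
  have t1 : `|(normc x1 ^+ 2 + 2 * e) `^ a - (normc x0 ^+ 2 + 2 * e) `^ a| <=
      e `^ (a - 1) * (2 * M * (M * normc z)).
    apply: le_trans (lip _ _ _ _) _.
    - by have := sqr_ge0 (normc x1); move: e0; clear; lra.
    - by have := sqr_ge0 (normc x0); move: e0; clear; lra.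
    apply: ler_wpM2l => //; apply: le_trans s1.
    by rewrite opprD addrACA subrr addr0.
  have t2 : `|(normc P.[z] ^+ 2 + normc Q.[z] ^+ 2 + e) `^ a -
       (normc P.[0] ^+ 2 + normc Q.[0] ^+ 2 + e) `^ a| <=
      e `^ (a - 1) * (4 * M * (M * normc z)).
    apply: le_trans (lip _ _ _ _) _.
    - by rewrite lerDr addr_ge0 ?sqr_ge0.
    - by rewrite lerDr addr_ge0 ?sqr_ge0.
    apply: ler_wpM2l => //.
    have -> : normc P.[z] ^+ 2 + normc Q.[z] ^+ 2 + e -
      (normc P.[0] ^+ 2 + normc Q.[0] ^+ 2 + e) =
      (normc P.[z] ^+ 2 - normc P.[0] ^+ 2) + (normc Q.[z] ^+ 2 - normc Q.[0] ^+ 2) by ring.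
    by apply: (le_trans (ler_normD _ _)); move: s2 s3; clear; lra.
  set A1 := _ `^ a in t1 *; set A2 := _ `^ a in t1 *.
  set A3 := _ `^ a in t2 *; set A4 := _ `^ a in t2 *.
  have -> : C * A1 - A3 - (C * A2 - A4) = C * (A1 - A2) - (A3 - A4) by ring.
  apply: (le_trans (ler_normB _ _)); rewrite normrM (gtr0_norm C0).
  have := ler_wpM2l (ltW C0) t1.
  by move: t2 (mulr_ge0 L10 zn); rewrite /L2; clear; lra.
Qed.

End riesz.

(** * From the regularised inequality to all exponents *)

Section riesz_bound.
Context {R : realType}.
Implicit Types (P Q : {poly R[i]}) (z w x d : R[i]) (p r t a e : R).

(** The normalisation [Q.[0] = 0] excludes pairs such as [P = c] and [Q = - conj c], for which the
    right side vanishes. *)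
Definition riesz_bound p (C : R) := forall P Q, Q.[0] = 0 ->
  mean (fun t => normc P.[circle 1 t] `^ p) + mean (fun t => normc Q.[circle 1 t] `^ p)
  <= C * mean (fun t => normc (P.[circle 1 t] + (Q.[circle 1 t])^*) `^ p).

Lemma powR_half p (x : R) : 0 <= x -> (x ^+ 2) `^ (p / 2) = x `^ p.
Proof. by move=> x0; rewrite -powR_mulrn// -powRrM mulrC divfK. Qed.

Lemma riesz_le2 p : 1 < p <= 2 -> exists2 C : R, 0 <= C & riesz_bound p C.
Proof.
move=> p12; pose a := p / 2; have a12 : 1 / 2 < a <= 1 by rewrite /a; lra.
pose C := riesz_cst a; pose D := C * 2 `^ a.
have C1 : 1 <= C := riesz_cst_ge1 a12.
have D0 : 0 <= D by rewrite mulr_ge0 ?powR_ge0//; lra.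
have p1 : 1 <= p by lra.
exists (2 * D) => [|P Q Q0]; first by lra.
have cP := @continuous_poly_circle R P 1; have cQ := @continuous_poly_circle R Q 1.
have cF : continuous (fun t => P.[circle 1 t] + (Q.[circle 1 t])^* : R[i]^o).
  by move=> t; apply: (@cvgD R[i] R[i]^o); [exact: cP|exact: (continuous_conjc cQ)].
pose mP := mean (fun t => normc P.[circle 1 t] `^ p).
pose mQ := mean (fun t => normc Q.[circle 1 t] `^ p).
pose mF := mean (fun t => normc (P.[circle 1 t] + (Q.[circle 1 t])^*) `^ p).
suff reg e : 0 < e -> mP <= D * (mF + (2 * e) `^ a) /\ mQ <= D * (mF + (2 * e) `^ a).
  apply/ler_addgt0Pr => eta eta0.
  (* [e] is chosen with [(2 e)^a = x], and [x] so small that the error [2 D x] of the two bounds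
     together is at most [eta]. *)
  pose x := eta / (2 * D + 1); have x0 : 0 < x by apply: divr_gt0; lra.
  have e0 : 0 < x `^ (a^-1) / 2 by rewrite divr_gt0// powR_gt0.
  have e2 : 2 * (x `^ (a^-1) / 2) = x `^ (a^-1) by rewrite mulrC divfK.
  have [] := reg _ e0; rewrite e2 -powRrM mulVf ?powRr1 ?(ltW x0)//; last first.
    by rewrite gt_eqF//; lra.
  have : 2 * D * x <= eta.
    apply: (@le_trans _ _ ((2 * D + 1) * x)); first by lra.
    by rewrite /x mulrC divfK// gt_eqF//; lra.
  rewrite -/mP -/mQ -/mF; lra.
move=> e0.
have c1 : continuous (fun t =>
    (normc (P.[circle 1 t] + (Q.[circle 1 t])^*) ^+ 2 + 2 * e) `^ a).
  apply: continuous_powR_pos => t; last by apply: ltr_wpDl; [exact: sqr_ge0|lra].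
  by apply: cvgD; [exact: continuous_sqr_normc|exact: cvg_cst].
have c2 : continuous (fun t =>
    (normc P.[circle 1 t] ^+ 2 + normc Q.[circle 1 t] ^+ 2 + e) `^ a).
  apply: continuous_powR_pos => t; last first.
    by apply: ltr_wpDl => //; apply: addr_ge0; exact: sqr_ge0.
  apply: cvgD; last exact: cvg_cst.
  by apply: cvgD; apply: continuous_sqr_normc; [exact: cP|exact: cQ].
have nP := continuous_norm_powR p1 cP; have nQ := continuous_norm_powR p1 cQ.
have nF := continuous_norm_powR p1 cF.
have upper : C * mean (fun t =>
    (normc (P.[circle 1 t] + (Q.[circle 1 t])^*) ^+ 2 + 2 * e) `^ a) <=
    D * (mF + (2 * e) `^ a).
  rewrite /D -mulrA ler_wpM2l//; first by lra.
  have cc : continuous (fun _ : R => (2 * e) `^ a) by move=> t; exact: cvg_cst.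
  have cs : continuous (fun t => normc (P.[circle 1 t] + (Q.[circle 1 t])^*) `^ p
      + (2 * e) `^ a) by move=> t; apply: cvgD; [exact: nF|exact: cc].
  rewrite -[X in _ + X](mean_cst ((2 * e) `^ a)) -meanD// -meanZ//.
  apply: le_mean => // [|t]; first by move=> t; apply: cvgM; [exact: cvg_cst|exact: cs].
  rewrite -(@powR_half p) ?normc_ge0//; apply: powRD_le; [lra|exact: sqr_ge0|lra].
have h := le_trans (@riesz_reg R a e P Q a12 e0 Q0) upper.
split; apply: le_trans h; apply: le_mean => // t; rewrite -(@powR_half p) ?normc_ge0//.
  have := sqr_ge0 (normc P.[circle 1 t]); have := sqr_ge0 (normc Q.[circle 1 t]).
  by move=> ? ?; apply: ge0_ler_powR; rewrite ?nnegrE -?/a; lra.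
have := sqr_ge0 (normc P.[circle 1 t]); have := sqr_ge0 (normc Q.[circle 1 t]).
by move=> ? ?; apply: ge0_ler_powR; rewrite ?nnegrE -?/a; lra.
Qed.

(* Apply the bound to [P^2] and [- Q^2]: [(P + Q^* ) (P - Q^* ) = P^2 - Q^*^2]. *)
Lemma riesz_double p (C : R) : 1 <= p -> 0 <= C -> riesz_bound p C ->
  riesz_bound (2 * p) (2 * C * (C + 1) * 4 `^ p).
Proof.
move=> p1 C0 H P Q Q0.
have p21 : 1 <= 2 * p by lra.
have cP := @continuous_poly_circle R P 1; have cQ := @continuous_poly_circle R Q 1.
have cF : continuous (fun t => P.[circle 1 t] + (Q.[circle 1 t])^* : R[i]^o).
  by move=> t; apply: (@cvgD R[i] R[i]^o); [exact: cP|exact: (continuous_conjc cQ)].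
have nP := continuous_norm_powR p21 cP; have nQ := continuous_norm_powR p21 cQ.
have nF := continuous_norm_powR p21 cF.
have Q20 : (- Q ^+ 2).[0] = 0 by rewrite hornerN horner_exp Q0 expr0n oppr0.
have sqE (x : R[i]) : normc (x ^+ 2) `^ p = normc x `^ (2 * p).
  by rewrite normcX -powR_mulrn ?normc_ge0// -powRrM.
pose mP := mean (fun t => normc P.[circle 1 t] `^ (2 * p)).
pose mQ := mean (fun t => normc Q.[circle 1 t] `^ (2 * p)).
pose mF := mean (fun t => normc (P.[circle 1 t] + (Q.[circle 1 t])^*) `^ (2 * p)).
pose m := mean (fun t =>
  normc ((P ^+ 2).[circle 1 t] + ((- Q ^+ 2).[circle 1 t])^*) `^ p).
rewrite -/mP -/mQ -/mF.
have h : mP + mQ <= C * m.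
  have -> : mP = mean (fun t => normc (P ^+ 2).[circle 1 t] `^ p).
    by apply: eq_mean => t; rewrite horner_exp sqE.
  have -> : mQ = mean (fun t => normc (- Q ^+ 2).[circle 1 t] `^ p).
    by apply: eq_mean => t; rewrite hornerN horner_exp normcN sqE.
  exact: H.
(* Weighted arithmetic-geometric inequality: the weight is such that after multiplication by [C] the
   second summand is at most half of [mP + mQ] and is absorbed into the left side. *)
suff : m <= (C + 1) * 4 `^ p * mF + (mP + mQ) / (2 * (C + 1)).
  move=> /(ler_wpM2l C0) /(le_trans h); rewrite mulrDr.
  have mPQ : 0 <= mP + mQ.
    by apply: addr_ge0; apply: mean_ge0 => t; exact: powR_ge0.
  have : C * ((mP + mQ) / (2 * (C + 1))) <= (mP + mQ) / 2.
    rewrite mulrA ler_pdivrMr; last by lra.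
    by nra.
  move=> h1 h2; have {h1 h2} := le_trans h2 (lerD (lexx _) h1).
  clear; lra.
have cs : continuous (fun t => (C + 1) * 4 `^ p *
    normc (P.[circle 1 t] + (Q.[circle 1 t])^*) `^ (2 * p) +
    (2 * (C + 1))^-1 * (normc P.[circle 1 t] `^ (2 * p) + normc Q.[circle 1 t] `^ (2 * p))).
  move=> t; apply: cvgD; first by apply: cvgM; [exact: cvg_cst|exact: nF].
  by apply: cvgM; [exact: cvg_cst|apply: cvgD; [exact: nP|exact: nQ]].
have cPQ : continuous (fun t =>
    normc P.[circle 1 t] `^ (2 * p) + normc Q.[circle 1 t] `^ (2 * p)).
  by move=> t; apply: cvgD; [exact: nP|exact: nQ].
apply: (@le_trans _ _ (mean (fun t => (C + 1) * 4 `^ p *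
    normc (P.[circle 1 t] + (Q.[circle 1 t])^*) `^ (2 * p) +
    (2 * (C + 1))^-1 * (normc P.[circle 1 t] `^ (2 * p) + normc Q.[circle 1 t] `^ (2 * p))))).
  apply: le_mean => //.
    have c2 : continuous (fun t =>
        (P ^+ 2).[circle 1 t] + ((- Q ^+ 2).[circle 1 t])^* : R[i]^o).
      move=> t; apply: (@cvgD R[i] R[i]^o); first exact: continuous_poly_circle.
      by apply: continuous_conjc; exact: continuous_poly_circle.
    exact: (continuous_norm_powR p1 c2).
  move=> t; rewrite hornerN !horner_exp.
  set x := P.[_]; set y := Q.[_].
  have -> : x ^+ 2 + (- y ^+ 2)^* = (x + y^*) * (x - y^*).
    by rewrite rmorphN rmorphXn/=; ring.
  rewrite normcM powRM ?normc_ge0// !powR_double ?normc_ge0//.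
  set f := normc (x + y^*) `^ p.
  have f0 : 0 <= f := powR_ge0 _ _.
  have : normc (x - y^*) `^ p <= 2 `^ p * (normc x `^ p + normc y `^ p).
    apply: le_trans (powRD_le _ _ _); rewrite ?normc_ge0//; last by lra.
    apply: ge0_ler_powR; rewrite ?nnegrE ?addr_ge0 ?normc_ge0//; first by lra.
    by apply: (le_trans (normcB _ _)); rewrite Defs.normcJ.
  have -> : 4 `^ p = 2 `^ p * 2 `^ p by rewrite -powRM//; congr (_ `^ _); lra.
  set g := 2 `^ p; set u := normc x `^ p; set v := normc y `^ p.
  set d := normc _ `^ p => dle.
  apply: (@le_trans _ _ (f * (g * (u + v)))); first exact: ler_wpM2l.
  have k0 : 0 < C + 1 by lra.
  rewrite -subr_ge0.
  have -> : (C + 1) * (g * g) * (f * f) + (2 * (C + 1))^-1 * (u * u + v * v) -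
    f * (g * (u + v)) =
    ((2 * (C + 1) * g * f - (u + v)) ^+ 2 + (u - v) ^+ 2) / (4 * (C + 1)).
    by field; lra.
  by apply: divr_ge0; [apply: addr_ge0; exact: sqr_ge0|lra].
rewrite meanD//; last by move=> t; apply: cvgM; [exact: cvg_cst|exact: cPQ].
  by rewrite !meanZ// meanD// [(2 * _)^-1 * _]mulrC.
by move=> t; apply: cvgM; [exact: cvg_cst|exact: nF].
Qed.

Lemma riesz_poly p : 1 < p -> exists2 C : R, 0 <= C & riesz_bound p C.
Proof.
have pow n : forall q : R, 1 < q <= 2 ^+ n.+1 -> exists2 C : R, 0 <= C & riesz_bound q C.
  elim: n => [|n IH] q /andP[q1 qn]; first by apply: riesz_le2; rewrite q1.
  have [q2|q2] := leP q 2; first by apply: riesz_le2; rewrite q1.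
  have [|C C0 HC] := IH (q / 2).
    by rewrite exprSr in qn; apply/andP; split; lra.
  have q21 : 1 <= q / 2 by lra.
  exists (2 * C * (C + 1) * 4 `^ (q / 2)).
    by rewrite mulr_ge0 ?powR_ge0//; nra.
  by have := riesz_double q21 C0 HC; rewrite [2 * (q / 2)]mulrC divfK.
move=> p1; apply: (pow (Num.truncn p)); rewrite p1/=.
apply: (@le_trans _ _ ((Num.truncn p).+1%:R)); first exact/ltW/truncnS_gt.
by rewrite -natrX ler_nat ltnW// ltn_expl.
Qed.

End riesz_bound.

(** * The disc algebra *)

HB.lock Definition pmean {R : realType} (p : R) (F : R[i] -> R[i]) (r : R) : R :=
  mean (fun t => normc (F (circle r t)) `^ p).
Canonical pmean_unlock := Unlockable pmean.unlock.

HB.lock Definition hmean {R : realType} (p : R) (F G : R[i] -> R[i]) : R :=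
  mean (fun t => normc (F (circle 1 t) + (G (circle 1 t))^*) `^ p).
Canonical hmean_unlock := Unlockable hmean.unlock.

Section disc_algebra.
Context {R : realType}.
Implicit Types (P Q : {poly R[i]}) (F G : R[i] -> R[i]) (z w a : R[i]) (p r t e : R).

(** Membership is approximability by polynomials, rather than continuity with analyticity inside, so
    that inequalities for polynomials pass to the limit directly. Values outside the closed disc are
    ignored. *)
Definition disc_algebra F := forall e, 0 < e -> exists P,
  forall z, normc z <= 1 -> normc (F z - P.[z]) <= e.

Lemma disc_algebra_poly P : disc_algebra (horner P).
Proof. by move=> e e0; exists P => z _; rewrite subrr normc0 ltW. Qed.

Lemma disc_algebra_ext F G : disc_algebra F ->
  (forall z, normc z <= 1 -> F z = G z) -> disc_algebra G.
Proof.
by move=> AF FG e /AF[P HP]; exists P => z z1; rewrite -FG//; exact: HP.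
Qed.

Lemma disc_algebra_cst a : disc_algebra (fun=> a).
Proof.
by move=> e e0; exists a%:P => z _; rewrite hornerC subrr normc0 ltW.
Qed.

Lemma disc_algebra_id : disc_algebra id.
Proof. by move=> e e0; exists 'X => z _; rewrite hornerX subrr normc0 ltW. Qed.

Lemma disc_algebra_bounded F : disc_algebra F ->
  exists2 M : R, 0 <= M & forall z, normc z <= 1 -> normc (F z) <= M.
Proof.
move=> /(_ 1 ltr01)[P HP]; have [M M0 HM] := poly_bound P.
exists (M + 1) => [|z z1]; first by rewrite addr_ge0.
have [h _] := HM z z1; have := HP z z1.
by have := normcD (F z - P.[z]) P.[z]; rewrite subrK; lra.
Qed.

Lemma disc_algebraD F G : disc_algebra F -> disc_algebra G ->
  disc_algebra (fun z => F z + G z).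
Proof.
move=> AF AG e e0; have e20 : 0 < e / 2 by rewrite divr_gt0.
have [P HP] := AF _ e20; have [Q HQ] := AG _ e20; exists (P + Q) => z z1.
rewrite hornerD opprD addrACA; apply: (le_trans (normcD _ _)).
by have := HP z z1; have := HQ z z1; lra.
Qed.

Lemma disc_algebraM F G : disc_algebra F -> disc_algebra G ->
  disc_algebra (fun z => F z * G z).
Proof.
move=> AF AG e e0.
have [M M0 HM] := disc_algebra_bounded AF; have [N N0 HN] := disc_algebra_bounded AG.
pose d := Num.min 1 (e / (M + N + 1)).
have d0 : 0 < d by rewrite lt_min ltr01 divr_gt0//; lra.
have [P HP] := AF _ d0; have [Q HQ] := AG _ d0; exists (P * Q) => z z1.
have -> : F z * G z - (P * Q).[z] =
   F z * (G z - Q.[z]) + (F z - P.[z]) * (G z - (G z - Q.[z])).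
  by rewrite hornerM; ring.
have d1 : d <= 1 by rewrite ge_min lexx.
apply: (@le_trans _ _ (M * d + d * (N + 1))).
  apply: (le_trans (normcD _ _)); rewrite !normcM; apply: lerD.
    by apply: ler_pM; rewrite ?normc_ge0//; [exact: HM|exact: HQ].
  apply: ler_pM; rewrite ?normc_ge0//; first exact: HP.
  apply: (le_trans (normcB _ _)); apply: lerD; first exact: HN.
  exact: le_trans (HQ z z1) d1.
have -> : M * d + d * (N + 1) = d * (M + N + 1) by ring.
by rewrite -ler_pdivlMr; [rewrite ge_min lexx orbT|lra].
Qed.

Lemma disc_algebraN F : disc_algebra F -> disc_algebra (fun z => - F z).
Proof.
move=> AF; apply: (disc_algebra_ext (disc_algebraM (disc_algebra_cst (-1)) AF)).
by move=> z _; rewrite mulN1r.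
Qed.

Lemma disc_algebraB F G : disc_algebra F -> disc_algebra G ->
  disc_algebra (fun z => F z - G z).
Proof. by move=> AF AG; apply: disc_algebraD AF (disc_algebraN AG). Qed.

Lemma disc_algebra_sum (I : Type) (s : seq I) (F : I -> R[i] -> R[i]) :
  (forall i, disc_algebra (F i)) -> disc_algebra (fun z => \sum_(i <- s) F i z).
Proof.
move=> AF; elim: s => [|i s IH].
  by apply: (disc_algebra_ext (disc_algebra_cst 0)) => z _; rewrite big_nil.
by apply: (disc_algebra_ext (disc_algebraD (AF i) IH)) => z _; rewrite big_cons.
Qed.

Lemma disc_algebra_prod (I : eqType) (s : seq I) (F : I -> R[i] -> R[i]) :
  (forall i, i \in s -> disc_algebra (F i)) ->
  disc_algebra (fun z => \prod_(i <- s) F i z).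
Proof.
elim: s => [|i s IH] AF.
  by apply: (disc_algebra_ext (disc_algebra_cst 1)) => z _; rewrite big_nil.
have Ai := AF i (mem_head _ _).
have As := IH (fun j js => AF j (mem_behead (js : j \in behead (i :: s)))).
by apply: (disc_algebra_ext (disc_algebraM Ai As)) => z _; rewrite big_cons.
Qed.

Lemma geom_denom a z : normc a < 1 -> normc z <= 1 -> 1 - normc a <= normc (1 - a * z).
Proof.
move=> a1 z1; have := normcD (1 - a * z) (a * z).
rewrite subrK normc1 normcM.
have : normc a * normc z <= normc a by rewrite ler_piMr// normc_ge0.
lra.
Qed.

Lemma geom_denom_neq0 a z : normc a < 1 -> normc z <= 1 -> 1 - a * z != 0.
Proof. by move=> a1 z1; rewrite -normc_gt0; have := geom_denom a1 z1; lra. Qed.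

Lemma disc_algebra_geom a : normc a < 1 -> disc_algebra (fun z => (1 - a * z)^-1).
Proof.
move=> a1 e e0; have a0 := normc_ge0 a.
have a01 : 0 <= normc a < 1 by rewrite a0.
have k0 : 0 < 1 - normc a by lra.
have [n hn] := @expr_lt_eps _ _ (e * (1 - normc a)) a01 (mulr_gt0 e0 k0).
exists (\sum_(k < n) (a ^+ k)%:P * 'X^k) => z z1.
have dn := geom_denom_neq0 a1 z1; have dl := geom_denom a1 z1.
have -> : (\sum_(k < n) (a ^+ k)%:P * 'X^k).[z] = \sum_(k < n) (a * z) ^+ k.
  rewrite horner_sum; apply: eq_bigr => k _.
  by rewrite hornerM hornerC hornerXn exprMn.
have := subrX1 (a * z) n; rewrite -opprB => /eqP; rewrite eqr_oppLR => /eqP E.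
have -> : (1 - a * z)^-1 - \sum_(k < n) (a * z) ^+ k = (a * z) ^+ n / (1 - a * z).
  apply: (mulIf dn); rewrite mulrBl mulVf// divfK//.
  move: E; set S := \sum_(k < n) _ => E; rewrite mulrC.
  have -> : (1 - a * z) * S = - ((a * z - 1) * S) by ring.
  by rewrite -E; ring.
rewrite normcM normcV normcX normcM exprMn ler_pdivrMr; last by lra.
apply: (@le_trans _ _ (normc a ^+ n)).
  by rewrite ler_piMr ?exprn_ge0// exprn_ile1 ?normc_ge0.
apply: (le_trans (ltW hn)); rewrite ler_wpM2l//; exact: ltW.
Qed.

Lemma disc_algebra_blaschke_factor w : normc w < 1 ->
  disc_algebra (blaschke_factor w).
Proof.
move=> w1; have wJ : normc w^* < 1 by rewrite Defs.normcJ.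
apply: disc_algebraM; last exact: disc_algebra_geom.
by apply: disc_algebraB; [exact: disc_algebra_cst|exact: disc_algebra_id].
Qed.

Lemma disc_algebra_dilation F r : disc_algebra F -> 0 <= r <= 1 ->
  disc_algebra (fun z => F (r%:C * z)).
Proof.
move=> AF /andP[r0 r1] e /AF[P HP]; exists (P \Po (r%:C *: 'X)) => z z1.
rewrite horner_comp hornerZ hornerX; apply: HP.
by rewrite normcM normc_real ger0_norm// mulr_ile1// normc_ge0.
Qed.

Lemma disc_algebra_continuous F r : disc_algebra F -> 0 <= r <= 1 ->
  continuous (fun t => F (circle r t) : R[i]^o).
Proof.
move=> AF /andP[r0 r1] t; apply/cvgrPdist_lt => e e0.
have [e' e'0 ->] : exists2 e' : R, 0 < e' & e = e'%:C.
  case: e e0 => a b; rewrite ltcE/= => /andP[/eqP b0 a0].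
  by exists a => //; rewrite b0.
have e30 : 0 < e' / 4 by rewrite divr_gt0.
have [P HP] := AF _ e30.
have e30' : 0 < (e' / 4)%:C :> R[i] by rewrite ltr0c.
have /cvgrPdist_lt/(_ _ e30') := @continuous_poly_circle R P r t.
apply: filterS => s; rewrite !normCE !ltcR => h.
have c1 u : normc (circle r u) <= 1 by rewrite normc_circle.
have -> : F (circle r t) - F (circle r s) =
   (F (circle r t) - P.[circle r t]) + (P.[circle r t] - P.[circle r s])
   - (F (circle r s) - P.[circle r s]) by ring.
apply: (le_lt_trans (normcB _ _)).
have h1 := HP _ (c1 t); have h2 := HP _ (c1 s).
have := normcD (F (circle r t) - P.[circle r t]) (P.[circle r t] - P.[circle r s]).
move: h h1 h2 e'0; clear; lra.
Qed.

Lemma dist_mean_powR p (f g : R -> R[i]) (M e : R) : 1 <= p ->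
  continuous (f : R -> R[i]^o) -> continuous (g : R -> R[i]^o) ->
  (forall t, [/\ normc (f t) <= M, normc (g t) <= M & normc (f t - g t) <= e]) ->
  `|mean (fun t => normc (f t) `^ p) - mean (fun t => normc (g t) `^ p)|
  <= p * M `^ (p - 1) * e.
Proof.
move=> p1 cf cg fg; have nf := continuous_norm_powR p1 cf.
have ng := continuous_norm_powR p1 cg; apply: dist_mean => // t.
have [fM gM fge] := fg t.
apply: (le_trans (@powR_lipschitz _ p M _ _ p1 _ _)); rewrite ?normc_ge0//.
rewrite ler_wpM2l ?mulr_ge0 ?powR_ge0//; first by lra.
exact: le_trans (normc_dist _ _) fge.
Qed.

Lemma pmeanE p F r : pmean p F r = mean (fun t => normc (F (circle r t)) `^ p).
Proof. by rewrite unlock. Qed.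

Lemma hmeanE p F G :
  hmean p F G = mean (fun t => normc (F (circle 1 t) + (G (circle 1 t))^*) `^ p).
Proof. by rewrite unlock. Qed.

Lemma pmean_ge0 p F r : 0 <= pmean p F r.
Proof. by rewrite pmeanE; apply: mean_ge0 => t; exact: powR_ge0. Qed.

Lemma continuous_sum_conj F G : disc_algebra F -> disc_algebra G ->
  continuous (fun t => F (circle 1 t) + (G (circle 1 t))^* : R[i]^o).
Proof.
have r1 : 0 <= (1 : R) <= 1 by rewrite lexx ler01.
move=> AF AG t; apply: (@cvgD R[i] R[i]^o); first exact: disc_algebra_continuous.
by apply: continuous_conjc; exact: disc_algebra_continuous.
Qed.

(** One pair of polynomials serves all three means. [Q] is corrected by a constant to have [Q.[0] =
    G 0] exactly, because the Riesz inequality demands an exact zero; the correction doubles its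
    error, whence the factor [3] in [L]. *)
Lemma hmean_approx p F G : 1 <= p -> disc_algebra F -> disc_algebra G ->
  exists2 L : R, 0 <= L & forall e, 0 < e <= 1 -> exists P Q,
  [/\ Q.[0] = G 0,
      normc (F 0 - P.[0]) <= e,
      `|pmean p F 1 - pmean p (horner P) 1| <= L * e,
      `|pmean p G 1 - pmean p (horner Q) 1| <= L * e &
      `|hmean p F G - hmean p (horner P) (horner Q)| <= L * e].
Proof.
move=> p1 AF AG; have r1 : 0 <= (1 : R) <= 1 by rewrite lexx ler01.
have [M M0 HM] := disc_algebra_bounded AF; have [N N0 HN] := disc_algebra_bounded AG.
pose B := M + N + 3; pose L := p * B `^ (p - 1) * 3.
have L0 : 0 <= L by rewrite /L !mulr_ge0 ?powR_ge0//; lra.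
exists L => // e /andP[e0 e1].
have [P HP] := AF _ e0; have [Q HQ] := AG _ e0.
pose Q' := Q - (Q.[0] - G 0)%:P.
have z01 : normc (0 : R[i]) <= 1 by rewrite normc0 ler01.
have HQ' z : normc z <= 1 -> normc (G z - Q'.[z]) <= 2 * e.
  move=> z1; rewrite hornerD hornerN hornerC opprD opprK addrA.
  apply: (le_trans (normcD _ _)); have := HQ z z1; have := HQ 0 z01.
  by rewrite -normcN opprB; lra.
have c1 t : normc (circle 1 t : R[i]) <= 1 by rewrite normc_circle// ler01.
have cF := disc_algebra_continuous AF r1; have cG := disc_algebra_continuous AG r1.
have cP := @continuous_poly_circle R P 1; have cQ := @continuous_poly_circle R Q' 1.
have bF t := HM _ (c1 t); have bG t := HN _ (c1 t).
have dP t := HP _ (c1 t); have dQ t := HQ' _ (c1 t).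
have bP t : normc P.[circle 1 t] <= M + 1.
  have := normcB (F (circle 1 t)) (F (circle 1 t) - P.[circle 1 t]).
  by rewrite subKr; move: (bF t) (dP t) e1; clear; lra.
have bQ t : normc Q'.[circle 1 t] <= N + 2.
  have := normcB (G (circle 1 t)) (G (circle 1 t) - Q'.[circle 1 t]).
  by rewrite subKr; move: (bG t) (dQ t) e1; clear; lra.
have Le k : k <= 3 * e -> p * B `^ (p - 1) * k <= L * e.
  move=> ke; have -> : L * e = p * B `^ (p - 1) * (3 * e) by rewrite /L; ring.
  apply: ler_wpM2l => //.
  by apply: mulr_ge0 (powR_ge0 _ _); move: p1; clear; lra.
exists P, Q'; split.
- by rewrite hornerD hornerN hornerC subKr.
- exact: HP.
- apply: le_trans (Le e _); last by move: e0; clear; lra.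
  rewrite !pmeanE; apply: (dist_mean_powR p1 cF cP) => t; split; last exact: dP.
    by move: (bF t) N0; rewrite /B; clear; lra.
  by move: (bP t) N0; rewrite /B; clear; lra.
- apply: le_trans (Le (2 * e) _); last by move: e0; clear; lra.
  rewrite !pmeanE; apply: (dist_mean_powR p1 cG cQ) => t; split; last exact: dQ.
    by move: (bG t) M0; rewrite /B; clear; lra.
  by move: (bQ t) M0; rewrite /B; clear; lra.
- apply: le_trans (Le (3 * e) (lexx _)).
  rewrite !hmeanE; apply: (dist_mean_powR p1 (continuous_sum_conj AF AG)
    (continuous_sum_conj (disc_algebra_poly P) (disc_algebra_poly Q'))) => t; split.
  + apply: (le_trans (normcD _ _)); rewrite Defs.normcJ.
    by move: (bF t) (bG t); rewrite /B; clear; lra.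
  + apply: (le_trans (normcD _ _)); rewrite Defs.normcJ.
    by move: (bP t) (bQ t); rewrite /B; clear; lra.
  + rewrite opprD addrACA -rmorphB/=; apply: (le_trans (normcD _ _)).
    by rewrite Defs.normcJ; move: (dP t) (dQ t); clear; lra.
Qed.

Lemma le_linear_eps (x y K : R) : 0 <= K ->
  (forall e, 0 < e <= 1 -> x <= y + K * e) -> x <= y.
Proof.
move=> K0 h; apply/ler_addgt0Pr => e e0.
pose d := Num.min 1 (e / (K + 1)).
have d0 : 0 < d by rewrite lt_min ltr01 divr_gt0//; lra.
have d1 : d <= 1 by rewrite ge_min lexx.
apply: (le_trans (h d _)); first by rewrite d0.
rewrite lerD2l; apply: (@le_trans _ _ (d * (K + 1))).
  by move: (d0); clear; lra.
by rewrite -ler_pdivlMr; [rewrite ge_min lexx orbT|lra].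
Qed.

(** The case of radius [0] in [harmonic_mean_le], where the mean is the value at the centre. *)
Lemma disc_algebra_center p F G : 1 <= p -> disc_algebra F -> disc_algebra G ->
  normc (F 0 + (G 0)^*) `^ p <= hmean p F G.
Proof.
move=> p1 AF AG; have [L L0 HL] := hmean_approx p1 AF AG.
pose M := normc (F 0) + normc (G 0) + 1.
pose K := p * M `^ (p - 1).
have K0 : 0 <= K by rewrite mulr_ge0 ?powR_ge0//; lra.
apply: (@le_linear_eps _ _ (K + L)); first exact: addr_ge0.
move=> e e01; have [P [Q [Q0 P0 _ _ HPQ]]] := HL e e01.
have := @harmonic_mean_le R p P Q 0 p1; rewrite lexx ler01 => /(_ isT).
have c0 t : circle 0 t = 0 :> R[i] by rewrite /circle !mul0r.
under eq_mean do rewrite c0.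
rewrite mean_cst -hmeanE Q0 => h.
have {}P0 : normc ((F 0 + (G 0)^*) - (P.[0] + (G 0)^*)) <= e.
  by rewrite opprD addrACA subrr addr0.
have b1 : normc (F 0 + (G 0)^*) <= M.
  by apply: (le_trans (normcD _ _)); rewrite Defs.normcJ /M; lra.
have b2 : normc (P.[0] + (G 0)^*) <= M.
  have := normcB (F 0 + (G 0)^*) ((F 0 + (G 0)^*) - (P.[0] + (G 0)^*)).
  rewrite subKr; have := normcD (F 0) (G 0)^*; rewrite Defs.normcJ.
  by move: P0 e01; rewrite /M; clear; lra.
have := @powR_lipschitz _ p M _ _ p1 (_ : 0 <= normc (F 0 + (G 0)^*) <= M)
  (_ : 0 <= normc (P.[0] + (G 0)^*) <= M).
rewrite !normc_ge0 b1 b2 => /(_ isT isT); rewrite -/K ler_norml => /andP[_ h2].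
have h3 := ler_wpM2l K0 (le_trans (normc_dist _ _) P0).
move: HPQ; rewrite ler_norml => /andP[h4 _].
by move: h h2 h3 h4; clear; lra.
Qed.

Lemma disc_algebra_riesz p : 1 < p -> exists2 C : R, 0 <= C &
  forall F G, disc_algebra F -> disc_algebra G -> G 0 = 0 ->
  pmean p F 1 + pmean p G 1 <= C * hmean p F G.
Proof.
move=> p1; have [C C0 HC] := riesz_poly p1; exists C => // F G AF AG G0.
have [L L0 HL] := hmean_approx (ltW p1) AF AG.
apply: (@le_linear_eps _ _ (2 * L + C * L)).
  by rewrite addr_ge0 ?mulr_ge0.
move=> e e01; have [P [Q [Q0 _ h1 h2 h3]]] := HL e e01.
rewrite G0 in Q0; have := HC P Q Q0.
rewrite -!pmeanE -hmeanE.
move: h1 h2 h3; rewrite !ler_norml => /andP[_ h1] /andP[_ h2] /andP[h3 _].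
have : hmean p (horner P) (horner Q) <= hmean p F G + L * e by move: h3; clear; lra.
move=> /(ler_wpM2l C0); move: h1 h2; clear; lra.
Qed.

Lemma pmean_dilation p F r s : pmean p (fun z => F (r%:C * z)) s = pmean p F (r * s).
Proof.
by rewrite !pmeanE; apply: eq_mean => t; rewrite circleE (circleE (r * s)) rmorphM -mulrA.
Qed.

Lemma pmean_le1 p F r : 1 <= p -> disc_algebra F -> 0 <= r <= 1 ->
  pmean p F r <= pmean p F 1.
Proof.
move=> p1 AF r01; have r1 : 0 <= (1 : R) <= 1 by rewrite lexx ler01.
have AFr := disc_algebra_dilation AF r01.
have [M M0 HM] := disc_algebra_bounded AF.
pose L := p * (M + 1) `^ (p - 1).
have L0 : 0 <= L by rewrite mulr_ge0 ?powR_ge0//; lra.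
apply: (@le_linear_eps _ _ (2 * L)); first by rewrite mulr_ge0.
move=> e /andP[e0 e1]; have [P HP] := AF _ e0.
have close s : 0 <= s <= 1 -> `|pmean p F s - pmean p (horner P) s| <= L * e.
  move=> /andP[s0 s1]; have s01 : 0 <= s <= 1 by rewrite s0.
  rewrite !pmeanE; apply: (dist_mean_powR p1 (disc_algebra_continuous AF s01)
    (@continuous_poly_circle R P s)) => t.
  have c1 : normc (circle s t : R[i]) <= 1 by rewrite normc_circle.
  have h1 := HM _ c1; have h2 := HP _ c1; split => //.
    by move: h1; clear; lra.
  have := normcB (F (circle s t)) (F (circle s t) - P.[circle s t]).
  by rewrite subKr; move: h1 h2 e1; clear; lra.
have := @harmonic_mean_le R p P 0 r p1 r01.
under eq_mean do rewrite horner0 rmorph0 addr0.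
under [X in _ <= X]eq_mean do rewrite horner0 rmorph0 addr0.
rewrite -!pmeanE => h.
have := close r r01; have := close 1 r1; rewrite !ler_norml => /andP[h1 _] /andP[_ h2].
by move: h h1 h2; clear; lra.
Qed.

(* On the circle [F / (1 - l z^* )] is the sum of the analytic [z Q + F l] and
   of a conjugate-analytic function vanishing at [0], where [Q] is the
   difference quotient of [F] at [l]. *)
Lemma poly_eval_le p P (l : R[i]) : 1 <= p -> normc l < 1 ->
  normc P.[l] `^ p <= (1 - normc l)^-1 `^ p * pmean p (horner P) 1.
Proof.
move=> p1 l1; have lJ : normc l^* < 1 by rewrite Defs.normcJ.
have [Q HQ] : exists Q, P - P.[l]%:P = Q * ('X - l%:P).
  by apply/factor_theorem; rewrite rootE hornerD hornerN hornerC subrr.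
pose W z := z * Q.[z] + P.[l].
pose Z z := (P.[l])^* * (l^* * z * (1 - l^* * z)^-1).
have AW : disc_algebra W.
  apply: disc_algebraD; last exact: disc_algebra_cst.
  by apply: disc_algebraM; [exact: disc_algebra_id|exact: disc_algebra_poly].
have AZ : disc_algebra Z.
  apply: disc_algebraM; first exact: disc_algebra_cst.
  apply: disc_algebraM; last exact: disc_algebra_geom.
  by apply: disc_algebraM; [exact: disc_algebra_cst|exact: disc_algebra_id].
have := disc_algebra_center p1 AW AZ.
rewrite {1}/W {1}/Z mul0r add0r mulr0 mul0r mulr0 rmorph0 addr0.
move=> /le_trans; apply; have r1 : 0 <= (1 : R) <= 1 by rewrite lexx ler01.
have cP : continuous (fun t => normc P.[circle 1 t] `^ p).
  by have := continuous_norm_powR p1 (@continuous_poly_circle R P 1).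
rewrite hmeanE pmeanE -meanZ//; apply: le_mean.
- exact: (continuous_norm_powR p1 (continuous_sum_conj AW AZ)).
- by move=> t; apply: cvgM; [exact: cvg_cst|exact: cP].
move=> t; set z := circle 1 t.
have z1 : normc z = 1 by rewrite normc_circle// ler01.
have zz : z * z^* = 1 by rewrite -sqr_normcJ z1 expr1n.
have zJ1 : normc z^* <= 1 by rewrite Defs.normcJ z1.
have dn := geom_denom_neq0 l1 zJ1; have dl := geom_denom l1 zJ1.
have -> : W z + (Z z)^* = P.[z] * (1 - l * z^*)^-1.
  have /(congr1 (horner^~ z)) := HQ.
  rewrite hornerM hornerXsubC hornerD hornerN hornerC => E.
  apply: (mulIf dn); rewrite mulfVK//.
  rewrite /W /Z !(conjcM, conjc_inv, conjcB, conjcK, conjc1).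
  have -> : (z * Q.[z] + P.[l] + P.[l] * (l * z^* / (1 - l * z^*))) * (1 - l * z^*) =
     Q.[z] * (z - l * (z * z^*)) + P.[l] by field.
  by rewrite zz mulr1 -E; ring.
rewrite normcM normcV powRM ?invr_ge0 ?normc_ge0// mulrC ler_wpM2r ?powR_ge0//.
apply: ge0_ler_powR; rewrite ?nnegrE ?invr_ge0 ?normc_ge0//; try lra.
by rewrite lef_pV2 ?posrE//; lra.
Qed.

Lemma disc_algebra_eval p F (l : R[i]) : 1 <= p -> disc_algebra F -> normc l < 1 ->
  normc (F l) `^ p <= (1 - normc l)^-1 `^ p * pmean p F 1.
Proof.
move=> p1 AF l1; have r1 : 0 <= (1 : R) <= 1 by rewrite lexx ler01.
have [M M0 HM] := disc_algebra_bounded AF.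
pose L := p * (M + 1) `^ (p - 1); pose k := (1 - normc l)^-1 `^ p.
have L0 : 0 <= L by rewrite mulr_ge0 ?powR_ge0//; lra.
have k0 : 0 <= k := powR_ge0 _ _.
apply: (@le_linear_eps _ _ (L + k * L)).
  by apply: addr_ge0 => //; exact: mulr_ge0.
move=> e /andP[e0 e1]; have [P HP] := AF _ e0.
have bP z : normc z <= 1 -> normc P.[z] <= M + 1.
  move=> z1; have := normcB (F z) (F z - P.[z]); rewrite subKr.
  by move: (HM z z1) (HP z z1) e1; clear; lra.
have bF z : normc z <= 1 -> normc (F z) <= M + 1.
  by move=> /HM; clear; lra.
have : `|pmean p F 1 - pmean p (horner P) 1| <= L * e.
  rewrite !pmeanE; apply: (dist_mean_powR p1 (disc_algebra_continuous AF r1)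
    (@continuous_poly_circle R P 1)) => t.
  have c1 : normc (circle 1 t : R[i]) <= 1 by rewrite normc_circle// ler01.
  by split; [exact: bF|exact: bP|exact: HP].
rewrite ler_norml => /andP[h1 _].
have := @powR_lipschitz _ p (M + 1) _ _ p1 (_ : 0 <= normc (F l) <= M + 1)
  (_ : 0 <= normc P.[l] <= M + 1).
have l1' := ltW l1; rewrite !normc_ge0 (bF _ l1') (bP _ l1') => /(_ isT isT).
rewrite -/L ler_norml => /andP[_ h2].
have h3 := ler_wpM2l L0 (le_trans (normc_dist _ _) (HP l (ltW l1))).
have h4 : pmean p (horner P) 1 <= pmean p F 1 + L * e by move: h1; clear; lra.
have := ler_wpM2l k0 h4; have := poly_eval_le P p1 l1; rewrite -/k.
by move: h2 h3; clear; lra.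
Qed.

End disc_algebra.

(** * Green's formula and Cauchy's theorem *)

Section goursat.
Context {R : realType}.
Local Notation mu := (@lebesgue_measure R).
Implicit Types (u v : R -> R) (P Q : R -> R -> R).

Definition segint u (x y : R) : R := \int[mu]_(t in `[x, y]) u t.

Lemma segment_integrable u (x y : R) :
  (forall t, x <= t <= y -> {for t, continuous u}) ->
  mu.-integrable `[x, y] (EFin \o u).
Proof.
move=> cu; apply: continuous_compact_integrable; first exact: segment_compact.
by apply: continuous_in_subspaceT => t; rewrite inE/= in_itv/=; exact: cu.
Qed.

Lemma segint_split u (x y z : R) : x <= y <= z ->
  (forall t, x <= t <= z -> {for t, continuous u}) ->
  segint u x z = segint u x y + segint u y z.
Proof.
move=> /andP[xy yz] cu; have iu := segment_integrable cu.
have := @Rintegral_itvB _ u (BLeft x) (BRight z) y iu.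
rewrite !bnd_simp => /(_ xy yz); rewrite Rintegral_itv_obnd_cbnd.
  by rewrite /segint => <-; rewrite addrC subrK.
apply: integrableS iu => //=; apply: subset_itvr.
by rewrite bnd_simp.
Qed.

Lemma segint_affine (x y c k t0 : R) : x <= y ->
  segint (fun t => c + k * (t - t0)) x y =
  c * (y - x) + k * (((y - t0) ^+ 2 - (x - t0) ^+ 2) / 2).
Proof.
rewrite /segint le_eqVlt => /predU1P[->|xy].
  by rewrite set_itv1 Rintegral_set1 !subrr mul0r !mulr0 addr0.
have h : \int[mu]_(t in `[x, y]) (c + k * (t - t0)) =
    (c * y + k * ((y - t0) ^+ 2 / 2)) - (c * x + k * ((x - t0) ^+ 2 / 2)).
  apply: (@Rintegral_primitive R (fun t => c + k * (t - t0))
    (fun t => c * t + k * ((t - t0) ^+ 2 / 2))) => //.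
    move=> t; apply: cvgD; first exact: cvg_cst.
    by apply: cvgM; [exact: cvg_cst|apply: cvgB; [exact: cvg_id|exact: cvg_cst]].
  move=> t _; apply: is_derive_eq.
  by rewrite /GRing.scale/= ?scaler0 ?mulr0 ?addr0 ?add0r; field.
by rewrite h; field.
Qed.

Lemma segint_affine_dist u (x y c k t0 e : R) : x <= y ->
  (forall t, x <= t <= y -> {for t, continuous u}) ->
  (forall t, x <= t <= y -> `|u t - (c + k * (t - t0))| <= e) ->
  `|segint u x y - (c * (y - x) + k * (((y - t0) ^+ 2 - (x - t0) ^+ 2) / 2))|
  <= e * (y - x).
Proof.
move=> xy cu ue; rewrite -segint_affine// /segint.
have ca : continuous (fun t => c + k * (t - t0)).
  move=> t; apply: cvgD; first exact: cvg_cst.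
  by apply: cvgM; [exact: cvg_cst|apply: cvgB; [exact: cvg_id|exact: cvg_cst]].
have ia := continuous_integrable x y ca; have iu := segment_integrable cu.
have cB : forall t, x <= t <= y -> {for t, continuous (fun t => u t - (c + k * (t - t0)))}.
  by move=> t xty; apply: cvgB; [exact: cu|exact: ca].
have iB := segment_integrable cB.
rewrite -RintegralB//; apply: (le_trans (le_normr_Rintegral _ iB)) => //.
have ce : continuous (fun _ : R => e) by move=> t; exact: cvg_cst.
have : \int[mu]_(t in `[x, y]) `|u t - (c + k * (t - t0))| <=
    \int[mu]_(t in `[x, y]) (fun=> e) t.
  apply: le_Rintegral => //.
  - apply: segment_integrable => t xty; apply: cvg_norm; exact: cB.
  - exact: continuous_integrable.
move=> /le_trans; apply; rewrite Rintegral_cst//= lebesgue_measure_itv/= lte_fin.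
case: ltP => // yx; rewrite /= mulr0 mulr_ge0// ?subr_ge0//.
by apply: le_trans (ue x _); rewrite ?normr_ge0// lexx.
Qed.

(** Total differentiability at one point with gradient [(a, b)]; nothing is assumed about the
    derivative nearby, in the spirit of Goursat. *)
Definition diff2 P (s0 t0 a b : R) := forall e : R, 0 < e -> exists2 d : R, 0 < d &
  forall s t, `|s - s0| < d -> `|t - t0| < d ->
  `|P s t - P s0 t0 - a * (s - s0) - b * (t - t0)| <= e * (`|s - s0| + `|t - t0|).

Lemma diff2_continuous P (s0 t0 a b : R) : diff2 P s0 t0 a b ->
  {for s0, continuous (P ^~ t0)} /\ {for t0, continuous (P s0)}.
Proof.
move=> h; have [d d0 hd] := h 1 ltr01.
pose K := 1 + `|a| + `|b| + 1; have K0 : 0 < K.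
  by rewrite /K; have := normr_ge0 a; have := normr_ge0 b; lra.
have mn (e : R) : 0 < e -> 0 < Num.min d (e / K) by move=> e0; rewrite lt_min d0 divr_gt0.
split; apply/cvgrPdist_lt => e e0.
- apply/nbhs_ballP; exists (Num.min d (e / K)); first exact: mn.
  move=> s; rewrite /ball/= distrC lt_min => /andP[s1 s2].
  have := hd s t0 s1; rewrite subrr normr0 => /(_ d0).
  rewrite mulr0 subr0 addr0 mul1r => h1; rewrite distrC.
  apply: (@le_lt_trans _ _ (K * `|s - s0|)); last by rewrite mulrC -ltr_pdivlMr.
  have := ler_normD (P s t0 - P s0 t0 - a * (s - s0)) (a * (s - s0)).
  rewrite subrK normrM; have := mulr_ge0 (normr_ge0 b) (normr_ge0 (s - s0)).
  have := normr_ge0 (s - s0); move: h1; rewrite /K; clear; lra.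
- apply/nbhs_ballP; exists (Num.min d (e / K)); first exact: mn.
  move=> t; rewrite /ball/= distrC lt_min => /andP[s1 s2].
  have := hd s0 t; rewrite subrr normr0 => /(_ d0 s1).
  rewrite mulr0 subr0 add0r mul1r => h1; rewrite distrC.
  apply: (@le_lt_trans _ _ (K * `|t - t0|)); last by rewrite mulrC -ltr_pdivlMr.
  have := ler_normD (P s0 t - P s0 t0 - b * (t - t0)) (b * (t - t0)).
  rewrite subrK normrM; have := mulr_ge0 (normr_ge0 a) (normr_ge0 (t - t0)).
  have := normr_ge0 (t - t0); move: h1; rewrite /K; clear; lra.
Qed.

(** The integral of [P ds + Q dt] counterclockwise around the rectangle with corner [(s, t)] and
    sides [l], [h]. *)
Definition boundary_int P Q (s t l h : R) : R :=
  segint (P ^~ t) s (s + l) + segint (Q (s + l)) t (t + h)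
  - segint (P ^~ (t + h)) s (s + l) - segint (Q s) t (t + h).

Implicit Types (a c L T : R).

(* Sharing [m] between the two derivatives makes the form [P ds + Q dt] closed. *)
Definition closed_form P Q a c L T := forall s t, a <= s <= a + L -> c <= t <= c + T ->
  exists p m q, diff2 P s t p m /\ diff2 Q s t m q.

Lemma closed_form_continuousl P Q a c L T s t : closed_form P Q a c L T ->
  a <= s <= a + L -> c <= t <= c + T -> {for s, continuous (P ^~ t)}.
Proof. by move=> d hs ht; have [p [m [q [/diff2_continuous[] ]]]] := d _ _ hs ht. Qed.

Lemma closed_form_continuousr P Q a c L T s t : closed_form P Q a c L T ->
  a <= s <= a + L -> c <= t <= c + T -> {for t, continuous (Q s)}.
Proof. by move=> d hs ht; have [p [m [q [_ /diff2_continuous[] ]]]] := d _ _ hs ht. Qed.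

Definition dyadic_int P Q L T k (x : R * R) :=
  boundary_int P Q x.1 x.2 (L / 2 ^+ k) (T / 2 ^+ k).

Definition dyadic_inside a c L T k (x : R * R) :=
  a <= x.1 /\ x.1 + L / 2 ^+ k <= a + L /\ c <= x.2 /\ x.2 + T / 2 ^+ k <= c + T.

Definition quarter L T k (i j : bool) (x : R * R) : R * R :=
  (x.1 + i%:R * (L / 2 ^+ k.+1), x.2 + j%:R * (T / 2 ^+ k.+1)).

Lemma halfE (x : R) k : x / 2 ^+ k = x / 2 ^+ k.+1 + x / 2 ^+ k.+1.
Proof. by rewrite exprS; field; rewrite expf_neq0. Qed.

Lemma pow2_div_ge0 (x : R) k : 0 <= x -> 0 <= x / 2 ^+ k.
Proof. by move=> x0; rewrite divr_ge0 ?exprn_ge0. Qed.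

Lemma dyadic_int_split P Q a c L T k x : 0 <= L -> 0 <= T ->
  closed_form P Q a c L T -> dyadic_inside a c L T k x ->
  dyadic_int P Q L T k x =
  dyadic_int P Q L T k.+1 (quarter L T k false false x) +
  dyadic_int P Q L T k.+1 (quarter L T k true false x) +
  (dyadic_int P Q L T k.+1 (quarter L T k false true x) +
   dyadic_int P Q L T k.+1 (quarter L T k true true x)).
Proof.
move=> L0 T0 d; case: x => s t [/= h1 [h2 [h3 h4]]].
have l0 := pow2_div_ge0 k.+1 L0; have m0 := pow2_div_ge0 k.+1 T0.
rewrite /dyadic_int /quarter/= (halfE L) (halfE T) !mul0r !mul1r !addr0.
move: h2 h4; rewrite (halfE L) (halfE T).
set l := L / _ in l0 *; set m := T / _ in m0 * => h2 h4.
rewrite /boundary_int !addrA.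
have sP y : c <= y <= c + T -> segint (P ^~ y) s (s + l + l) =
    segint (P ^~ y) s (s + l) + segint (P ^~ y) (s + l) (s + l + l).
  move=> hy; apply: segint_split; first by apply/andP; split; move: l0; clear; lra.
  by move=> w hw; apply: (closed_form_continuousl d) => //; move: hw h1 h2; clear; lra.
have sQ x : a <= x <= a + L -> segint (Q x) t (t + m + m) =
    segint (Q x) t (t + m) + segint (Q x) (t + m) (t + m + m).
  move=> hx; apply: segint_split; first by apply/andP; split; move: m0; clear; lra.
  by move=> w hw; apply: (closed_form_continuousr d) => //; move: hw h3 h4; clear; lra.
rewrite !sP; [|by move: m0 h3 h4; clear; lra..].
rewrite !sQ; [|by move: l0 h1 h2; clear; lra..].
clear; lra.
Qed.

Lemma dyadic_step P Q a c L T k x : 0 <= L -> 0 <= T ->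
  closed_form P Q a c L T -> dyadic_inside a c L T k x ->
  exists y, [/\ dyadic_inside a c L T k.+1 y,
  x.1 <= y.1, y.1 + L / 2 ^+ k.+1 <= x.1 + L / 2 ^+ k,
  x.2 <= y.2 /\ y.2 + T / 2 ^+ k.+1 <= x.2 + T / 2 ^+ k &
  `|dyadic_int P Q L T k x| <= 4 * `|dyadic_int P Q L T k.+1 y|].
Proof.
move=> L0 T0 dPQ xin; pose J := dyadic_int P Q L T.
have [h1 [h2 [h3 h4]]] := xin.
have l0 := pow2_div_ge0 k.+1 L0; have m0 := pow2_div_ge0 k.+1 T0.
have good i j : [/\ dyadic_inside a c L T k.+1 (quarter L T k i j x),
  x.1 <= (quarter L T k i j x).1,
  (quarter L T k i j x).1 + L / 2 ^+ k.+1 <= x.1 + L / 2 ^+ k &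
  x.2 <= (quarter L T k i j x).2 /\
  (quarter L T k i j x).2 + T / 2 ^+ k.+1 <= x.2 + T / 2 ^+ k].
  move: h1 h2 h3 h4 l0 m0; rewrite /dyadic_inside /quarter/= (halfE L) (halfE T); clear.
  set l := L / _; set m := T / _ => h1 h2 h3 h4 l0 m0.
  by case: i; case: j; rewrite /= ?mul1r ?mul0r; repeat split; lra.
pose b i j := `|J k x| <= 4 * `|J k.+1 (quarter L T k i j x)|.
suff [i [j bij]] : exists i j, b i j.
  by have [g1 g2 g3 g4] := good i j; exists (quarter L T k i j x).
apply: contrapT => nb.
have nbij i j : 4 * `|J k.+1 (quarter L T k i j x)| < `|J k x|.
  by rewrite ltNge; apply/negP => h; apply: nb; exists i, j.
have := nbij false false; have := nbij true false.
have := nbij false true; have := nbij true true.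
rewrite /J (dyadic_int_split L0 T0 dPQ xin) -/J.
set A := J k.+1 _; set B := J k.+1 _; set C := J k.+1 _; set D := J k.+1 _.
have := ler_normD (B + C) (D + A); have := ler_normD B C; have := ler_normD D A.
clear; lra.
Qed.

(** The affine parts of [P] and [Q] at [(s, t)] contribute nothing because they share the
    coefficient [m]. The remainders are at most [e (l + h)] on a boundary of length [2 (l + h)]. *)
Lemma boundary_int_local P Q a c L T s t :
  closed_form P Q a c L T -> a <= s <= a + L -> c <= t <= c + T -> forall e : R, 0 < e ->
  exists2 d : R, 0 < d & forall (x : R * R) (l h : R), 0 <= l -> 0 <= h -> l + h < d ->
    a <= x.1 -> x.1 + l <= a + L -> c <= x.2 -> x.2 + h <= c + T ->
    x.1 <= s <= x.1 + l -> x.2 <= t <= x.2 + h ->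
    `|boundary_int P Q x.1 x.2 l h| <= e * (2 * (l + h) ^+ 2).
Proof.
move=> dPQ hs ht e e0; have [p [m [q [dP dQ]]]] := dPQ s t hs ht.
have [d1 d10 H1] := dP _ e0; have [d2 d20 H2] := dQ _ e0.
exists (Num.min d1 d2); first by rewrite lt_min d10.
case=> x y l h l0 h0; rewrite lt_min => /andP[lh1 lh2] /= a1 a2 c1 c2 sx ty.
have bs (u : R) : x <= u <= x + l -> `|u - s| <= l.
  by rewrite ler_norml; move: sx; clear; lra.
have bt (u : R) : y <= u <= y + h -> `|u - t| <= h.
  by rewrite ler_norml; move: ty; clear; lra.
have xl : x <= x + l by rewrite lerDl.
have yh : y <= y + h by rewrite lerDl.
have eP y' : y <= y' <= y + h ->
  `|segint (P ^~ y') x (x + l) - ((P s t + m * (y' - t)) * (x + l - x) +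
     p * (((x + l - s) ^+ 2 - (x - s) ^+ 2) / 2))| <= e * (l + h) * (x + l - x).
  move=> hy; apply: segint_affine_dist => //.
    by move=> u hu; apply: (closed_form_continuousl dPQ); [move: hu a1 a2|move: hy c1 c2]; clear; lra.
  move=> u hu; have b1 := bs u hu; have b2 := bt y' hy.
  have -> : P u y' - (P s t + m * (y' - t) + p * (u - s)) =
    P u y' - P s t - p * (u - s) - m * (y' - t) by ring.
  apply: (le_trans (H1 _ _ _ _)).
  - by move: b1 h0 lh1; clear; lra.
  - by move: b2 l0 lh1; clear; lra.
  - by apply: ler_wpM2l; [exact: ltW|exact: lerD].
have eQ x' : x <= x' <= x + l ->
  `|segint (Q x') y (y + h) - ((Q s t + m * (x' - s)) * (y + h - y) +
     q * (((y + h - t) ^+ 2 - (y - t) ^+ 2) / 2))| <= e * (l + h) * (y + h - y).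
  move=> hx; apply: segint_affine_dist => //.
    by move=> u hu; apply: (closed_form_continuousr dPQ); [move: hx a1 a2|move: hu c1 c2]; clear; lra.
  move=> u hu; have b1 := bs x' hx; have b2 := bt u hu.
  have -> : Q x' u - (Q s t + m * (x' - s) + q * (u - t)) =
    Q x' u - Q s t - m * (x' - s) - q * (u - t) by ring.
  apply: (le_trans (H2 _ _ _ _)).
  - by move: b1 h0 lh2; clear; lra.
  - by move: b2 l0 lh2; clear; lra.
  - by apply: ler_wpM2l; [exact: ltW|exact: lerD].
have := eP y; rewrite lexx yh => /(_ isT); have := eP (y + h); rewrite lexx yh => /(_ isT).
have := eQ x; rewrite lexx xl => /(_ isT); have := eQ (x + l); rewrite lexx xl => /(_ isT).
rewrite /boundary_int !ler_norml => /andP[A1 A2] /andP[B1 B2] /andP[C1 C2] /andP[D1 D2].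
move: A1 A2 B1 B2 C1 C2 D1 D2.
move: (segint _ _ _) (segint _ _ _) (segint _ _ _) (segint _ _ _); clear => A B C D.
by move=> ? ? ? ? ? ? ? ?; apply/andP; split; lra.
Qed.

Lemma boundary_int_eq0 P Q a c L T : 0 <= L -> 0 <= T ->
  closed_form P Q a c L T -> boundary_int P Q a c L T = 0.
Proof.
move=> L0 T0 dPQ; pose J := dyadic_int P Q L T; pose inside := dyadic_inside a c L T.
have inside0 : inside 0%N (a, c).
  by rewrite /inside /dyadic_inside/= expr0 !divr1; repeat split.
have nxt (k : nat) (x : R * R) : exists y, inside k x -> [/\ inside k.+1 y,
    x.1 <= y.1, y.1 + L / 2 ^+ k.+1 <= x.1 + L / 2 ^+ k,
    x.2 <= y.2 /\ y.2 + T / 2 ^+ k.+1 <= x.2 + T / 2 ^+ k &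
    `|J k x| <= 4 * `|J k.+1 y|].
  have [/(dyadic_step L0 T0 dPQ)[y hy]|n] := pselect (inside k x); first by exists y.
  by exists x.
have /choice[F HF] : forall kx : nat * (R * R), exists y, inside kx.1 kx.2 ->
    [/\ inside kx.1.+1 y,
    kx.2.1 <= y.1, y.1 + L / 2 ^+ kx.1.+1 <= kx.2.1 + L / 2 ^+ kx.1,
    kx.2.2 <= y.2 /\ y.2 + T / 2 ^+ kx.1.+1 <= kx.2.2 + T / 2 ^+ kx.1 &
    `|J kx.1 kx.2| <= 4 * `|J kx.1.+1 y|] by case=> k x; exact: nxt.
pose x := fix x k := if k is j.+1 then F (j, x j) else (a, c).
have xin k : inside k (x k).
  by elim: k => [//|k IH]; have [] := HF (k, x k) IH.
have xs k := HF (k, x k) (xin k).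
have Jk k : `|J 0 (a, c)| <= 4 ^+ k * `|J k (x k)|.
  elim: k => [|k IH]; first by rewrite expr0 mul1r.
  apply: (le_trans IH); rewrite exprSr -mulrA ler_wpM2l ?exprn_ge0//.
  by have [] := xs k.
have mono1 k j : (x k).1 <= (x (k + j)%N).1 /\
    (x (k + j)%N).1 + L / 2 ^+ (k + j) <= (x k).1 + L / 2 ^+ k.
  elim: j => [|j [IH1 IH2]]; first by rewrite addn0.
  rewrite addnS; have [_ u1 u2 _ _] := xs (k + j)%N.
  by split; [exact: le_trans IH1 u1|exact: le_trans u2 IH2].
have mono2 k j : (x k).2 <= (x (k + j)%N).2 /\
    (x (k + j)%N).2 + T / 2 ^+ (k + j) <= (x k).2 + T / 2 ^+ k.
  elim: j => [|j [IH1 IH2]]; first by rewrite addn0.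
  rewrite addnS; have [_ _ _ [u1 u2] _] := xs (k + j)%N.
  by split; [exact: le_trans IH1 u1|exact: le_trans u2 IH2].
have cross1 k j : (x j).1 <= (x k).1 + L / 2 ^+ k.
  have [v1 v2] := mono1 k (maxn k j - k)%N; have [w1 _] := mono1 j (maxn k j - j)%N.
  rewrite subnKC ?leq_maxl// in v1 v2; rewrite subnKC ?leq_maxr// in w1.
  by move: w1 v2 (pow2_div_ge0 (maxn k j) L0); clear; lra.
have cross2 k j : (x j).2 <= (x k).2 + T / 2 ^+ k.
  have [v1 v2] := mono2 k (maxn k j - k)%N; have [w1 _] := mono2 j (maxn k j - j)%N.
  rewrite subnKC ?leq_maxl// in v1 v2; rewrite subnKC ?leq_maxr// in w1.
  by move: w1 v2 (pow2_div_ge0 (maxn k j) T0); clear; lra.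
(* The common point of the nested rectangles: by [cross1] and [cross2] every lower end lies below
   every upper end. *)
pose s := sup (range (fun k => (x k).1)); pose t := sup (range (fun k => (x k).2)).
have sk k : (x k).1 <= s <= (x k).1 + L / 2 ^+ k.
  apply/andP; split; last first.
    by apply: sup_le_ub => [|_ [j _ <-]]; [exists a, 0%N|exact: cross1].
  apply: sup_ubound; last by exists k.
  by exists ((x 0%N).1 + L / 2 ^+ 0) => _ [j _ <-]; exact: cross1.
have tk k : (x k).2 <= t <= (x k).2 + T / 2 ^+ k.
  apply/andP; split; last first.
    by apply: sup_le_ub => [|_ [j _ <-]]; [exists c, 0%N|exact: cross2].
  apply: sup_ubound; last by exists k.
  by exists ((x 0%N).2 + T / 2 ^+ 0) => _ [j _ <-]; exact: cross2.
have s0 : a <= s <= a + L by have := sk 0%N; rewrite /= expr0 divr1.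
have t0 : c <= t <= c + T by have := tk 0%N; rewrite /= expr0 divr1.
have -> : boundary_int P Q a c L T = J 0 (a, c) by rewrite /J /dyadic_int/= expr0 !divr1.
apply/eqP; rewrite -normr_eq0 eq_le normr_ge0 andbT.
(* At depth [k] the local estimate is [e B / 4^k], and the factor [4^k] lost in [Jk] restores
   [e B]. *)
pose B := 2 * (L + T) ^+ 2.
have B0 : 0 <= B by rewrite mulr_ge0// sqr_ge0.
apply: (@le_linear_eps _ _ _ B) => // e /andP[e0 _]; rewrite add0r.
have [d d0 Hd] := boundary_int_local dPQ s0 t0 e0.
have [k hk] : exists k, (L + T) / 2 ^+ k < d.
  have h01 : 0 <= (2^-1 : R) < 1 by lra.
  have LT1 : 0 < L + T + 1 by move: L0 T0; clear; lra.
  have [k hk] := expr_lt_eps h01 (divr_gt0 d0 LT1); exists k.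
  move: hk; rewrite ltr_pdivlMr// exprVn mulrC => /(le_lt_trans _); apply.
  by rewrite ler_wpM2r ?invr_ge0 ?exprn_ge0//; lra.
have [g1 [g2 [g3 g4]]] := xin k.
have := Hd (x k) (L / 2 ^+ k) (T / 2 ^+ k) (pow2_div_ge0 k L0) (pow2_div_ge0 k T0) _ g1 g2 g3 g4
  (sk k) (tk k); rewrite -mulrDl => /(_ hk) h.
apply: (le_trans (Jk k)).
apply: (@le_trans _ _ (4 ^+ k * (e * (2 * ((L + T) / 2 ^+ k) ^+ 2)))).
  by rewrite ler_wpM2l// exprn_ge0.
rewrite le_eqVlt; apply/orP; left; apply/eqP; rewrite /B expr_div_n -exprM mulnC exprM.
have -> : (2 ^+ 2 : R) = 4 by ring.
by field; rewrite expf_neq0.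
Qed.

End goursat.

Lemma derivable_littleo (K : numFieldType) (f : K^o -> K^o) (x : K^o) :
  derivable f x 1 -> exists d : K, forall e : K, 0 < e -> exists2 del : K, 0 < del &
  forall y : K, `|y - x| < del -> `|f y - f x - d * (y - x)| <= e * `|y - x|.
Proof.
move=> /cvg_ex[/= d /cvgrPdist_le hd]; exists d => e e0.
have /nbhs_ballP[del /= del0 hdel] := hd e e0; exists del => // y yx.
have [->|yx0] := eqVneq y x; first by rewrite !subrr mulr0 subr0 normr0 mulr0.
have yx0' : y - x != 0 by rewrite subr_eq0.
have /hdel/(_ yx0')/= : ball 0 del (y - x) by rewrite /ball/= sub0r normrN.
rewrite /GRing.scale/= mulr1 subrK => h.
have -> : f y - f x - d * (y - x) =
    - ((d - (y - x)^-1 * (f y - f x)) * (y - x)).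
  by field.
by rewrite normrN normrM ler_wpM2r.
Qed.

(** * Complex-valued functions of two real parameters *)

Section complex_differentiability.
Context {R : realType}.
Implicit Types (F G : R -> R -> R[i]) (f : R[i] -> R[i]) (A B D z w : R[i]) (s t r e : R).

Definition cdiff f z D := forall e, 0 < e -> exists2 d : R, 0 < d &
  forall w, normc (w - z) < d -> normc (f w - f z - D * (w - z)) <= e * normc (w - z).

Lemma derivable_cdiff (f : R[i]^o -> R[i]^o) z : derivable f z 1 -> exists D, cdiff f z D.
Proof.
move=> /derivable_littleo[D hD]; exists D => e e0.
have e0' : 0 < e%:C :> R[i] by rewrite ltr0c.
have [[d1 d2]] := hD _ e0'; rewrite ltcE/= => /andP[/eqP d20 d10] hd.
exists d1 => // w wz; have := hd w; rewrite !normCE d20.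
by rewrite (ltcR _ d1) -rmorphM lecR; apply.
Qed.

(** Product and chain rules are proved for complex values; [cdiff2_Re] and [cdiff2_Im] then hand the
    result to the real statement of Goursat's theorem. *)
Definition cdiff2 F (s0 t0 : R) A B := forall e, 0 < e -> exists2 d : R, 0 < d &
  forall s t, `|s - s0| < d -> `|t - t0| < d ->
  normc (F s t - F s0 t0 - A * (s - s0)%:C - B * (t - t0)%:C) <=
  e * (`|s - s0| + `|t - t0|).

Let ReB z w : complex.Re (z - w) = complex.Re z - complex.Re w.
Proof. by case: z => ? ?; case: w. Qed.
Let ImB z w : complex.Im (z - w) = complex.Im z - complex.Im w.
Proof. by case: z => ? ?; case: w. Qed.
Let ReZ z s : complex.Re (z * s%:C) = complex.Re z * s.
Proof. by case: z => ? ? /=; ring. Qed.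
Let ImZ z s : complex.Im (z * s%:C) = complex.Im z * s.
Proof. by case: z => ? ? /=; ring. Qed.

Lemma cdiff2_Re F (s0 t0 : R) A B : cdiff2 F s0 t0 A B ->
  diff2 (fun s t => complex.Re (F s t)) s0 t0 (complex.Re A) (complex.Re B).
Proof.
move=> h e /h[d d0 hd]; exists d => // s t ss tt.
apply: le_trans (hd s t ss tt); apply: le_trans (normc_Re _).
by rewrite !ReB !ReZ.
Qed.

Lemma cdiff2_Im F (s0 t0 : R) A B : cdiff2 F s0 t0 A B ->
  diff2 (fun s t => complex.Im (F s t)) s0 t0 (complex.Im A) (complex.Im B).
Proof.
move=> h e /h[d d0 hd]; exists d => // s t ss tt.
apply: le_trans (hd s t ss tt); apply: le_trans (normc_Im _).
by rewrite !ImB !ImZ.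
Qed.

Lemma cdiff2_lipschitz F (s0 t0 : R) A B : cdiff2 F s0 t0 A B ->
  exists2 d : R, 0 < d & forall s t, `|s - s0| < d -> `|t - t0| < d ->
  normc (F s t - F s0 t0) <= (1 + normc A + normc B) * (`|s - s0| + `|t - t0|).
Proof.
move=> /(_ 1 ltr01)[d d0 hd]; exists d => // s t ss tt.
have := hd s t ss tt; set x := F s t - F s0 t0.
set u := s - s0; set v := t - t0 => h.
have := normcD (x - A * u%:C - B * v%:C) (A * u%:C + B * v%:C).
have -> : x - A * u%:C - B * v%:C + (A * u%:C + B * v%:C) = x by ring.
have := normcD (A * u%:C) (B * v%:C); rewrite !normcM !normc_real.
have := mulr_ge0 (normc_ge0 A) (normr_ge0 v); have := mulr_ge0 (normc_ge0 B) (normr_ge0 u).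
by move: h; clear; lra.
Qed.

Lemma cdiff2M F G (s0 t0 : R) A B A' B' :
  cdiff2 F s0 t0 A B -> cdiff2 G s0 t0 A' B' ->
  cdiff2 (fun s t => F s t * G s t) s0 t0
    (A * G s0 t0 + F s0 t0 * A') (B * G s0 t0 + F s0 t0 * B').
Proof.
move=> dF dG e e0.
have [d1 d10 L1] := cdiff2_lipschitz dF; have [d2 d20 L2] := cdiff2_lipschitz dG.
set K1 := 1 + _ + _ in L1; set K2 := 1 + _ + _ in L2.
have K10 : 0 < K1 by rewrite /K1; have := normc_ge0 A; have := normc_ge0 B; lra.
have K20 : 0 < K2 by rewrite /K2; have := normc_ge0 A'; have := normc_ge0 B'; lra.
pose N := normc (F s0 t0) + normc (G s0 t0) + 1.
have F0 := normc_ge0 (F s0 t0); have G0 := normc_ge0 (G s0 t0).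
have N0 : 0 < N by rewrite /N; lra.
have e1 : 0 < e / (2 * N) by rewrite divr_gt0// mulr_gt0.
have [d3 d30 H1] := dF _ e1; have [d4 d40 H2] := dG _ e1.
(* As [rho <= 2 d5], the product of the two Lipschitz bounds, [K1 K2 rho^2], is at most
   [e / 2 * rho]. *)
pose d5 := e / (4 * (K1 * K2)).
have d50 : 0 < d5 by rewrite divr_gt0// !mulr_gt0.
exists (Num.min (Num.min d1 d2) (Num.min (Num.min d3 d4) d5)).
  by rewrite !lt_min d10 d20 d30 d40 d50.
move=> s t; rewrite !lt_min => /andP[/andP[s1 s2] /andP[/andP[s3 s4] s5]].
move=> /andP[/andP[t1 t2] /andP[/andP[t3 t4] t5]].
have {L1}L1 := L1 s t s1 t1; have {L2}L2 := L2 s t s2 t2.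
have {H1}H1 := H1 s t s3 t3; have {H2}H2 := H2 s t s4 t4.
set rho := `|s - s0| + `|t - t0| in L1 L2 H1 H2 *.
have rho0 : 0 <= rho by rewrite addr_ge0.
have rho5 : rho <= 2 * d5 by move: s5 t5; rewrite /rho; clear; lra.
set x := F s t in L1 H1 *; set x0 := F s0 t0 in L1 H1 F0 *.
set y := G s t in L2 H2 *; set y0 := G s0 t0 in L2 H2 G0 *.
have -> : x * y - x0 * y0 - (A * y0 + x0 * A') * (s - s0)%:C -
  (B * y0 + x0 * B') * (t - t0)%:C =
  (x - x0 - A * (s - s0)%:C - B * (t - t0)%:C) * y0 +
  x0 * (y - y0 - A' * (s - s0)%:C - B' * (t - t0)%:C) + (x - x0) * (y - y0) by ring.
apply: (le_trans (normcD _ _)); apply: (le_trans (lerD (normcD _ _) (lexx _))).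
rewrite !normcM.
have h1 := ler_wpM2r G0 H1; have h2 := ler_wpM2l F0 H2.
have h3 := ler_pM (normc_ge0 _) (normc_ge0 _) L1 L2.
apply: (le_trans (lerD (lerD h1 h2) h3)).
have h4 : e / (2 * N) * rho * normc y0 + normc x0 * (e / (2 * N) * rho) <= e / 2 * rho.
  have -> : e / (2 * N) * rho * normc y0 + normc x0 * (e / (2 * N) * rho) =
     (normc x0 + normc y0) / N * (e / 2 * rho) by field; rewrite gt_eqF.
  rewrite ler_piMl//; first by rewrite mulr_ge0// divr_ge0// ltW.
  by rewrite ler_pdivrMr// mul1r /N -/x0 -/y0 lerDl.
have h5 : K1 * rho * (K2 * rho) <= e / 2 * rho.
  have -> : K1 * rho * (K2 * rho) = (K1 * K2 * rho) * rho by ring.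
  rewrite ler_wpM2r//; apply: (@le_trans _ _ (K1 * K2 * (2 * d5))).
    by rewrite ler_wpM2l// ltW// mulr_gt0.
  rewrite le_eqVlt; apply/orP; left; apply/eqP; rewrite /d5; field.
  by apply/andP; split; rewrite gt_eqF.
by move: h4 h5; clear; lra.
Qed.

Lemma cdiff2_comp f F (s0 t0 : R) A B D : cdiff2 F s0 t0 A B ->
  cdiff f (F s0 t0) D -> cdiff2 (fun s t => f (F s t)) s0 t0 (D * A) (D * B).
Proof.
move=> dF df e e0; have [d1 d10 L1] := cdiff2_lipschitz dF.
set K := 1 + _ + _ in L1.
have K0 : 0 < K by rewrite /K; have := normc_ge0 A; have := normc_ge0 B; lra.
pose N := normc D + 1; have D0 := normc_ge0 D.
have N0 : 0 < N by rewrite /N; lra.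
have e1 : 0 < e / (2 * N) by rewrite divr_gt0// mulr_gt0.
have e2 : 0 < e / (2 * K) by rewrite divr_gt0// mulr_gt0.
have [d2 d20 H1] := dF _ e1; have [d3 d30 H2] := df _ e2.
pose d4 := d3 / (2 * K); have d40 : 0 < d4 by rewrite divr_gt0// mulr_gt0.
exists (Num.min d1 (Num.min d2 d4)); first by rewrite !lt_min d10 d20 d40.
move=> s t; rewrite !lt_min => /and3P[s1 s2 s3] /and3P[t1 t2 t3].
have {L1}L1 := L1 s t s1 t1; have {H1}H1 := H1 s t s2 t2.
set rho := `|s - s0| + `|t - t0| in L1 H1 *.
have rho0 : 0 <= rho by rewrite addr_ge0.
have rho4 : rho < 2 * d4 by move: s3 t3; rewrite /rho; clear; lra.
have Fd : normc (F s t - F s0 t0) < d3.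
  apply: (le_lt_trans L1); have -> : d3 = K * (2 * d4).
    by rewrite /d4; field; rewrite gt_eqF.
  by rewrite ltr_pM2l.
have {H2}H2 := H2 _ Fd.
set x := F s t in L1 H1 H2 Fd *; set x0 := F s0 t0 in L1 H1 H2 Fd df *.
have -> : f x - f x0 - D * A * (s - s0)%:C - D * B * (t - t0)%:C =
  (f x - f x0 - D * (x - x0)) + D * (x - x0 - A * (s - s0)%:C - B * (t - t0)%:C).
  by ring.
apply: (le_trans (normcD _ _)); rewrite [normc (D * _)]normcM.
have h1 : e / (2 * K) * normc (x - x0) <= e / 2 * rho.
  have -> : e / 2 * rho = e / (2 * K) * (K * rho) by field; rewrite gt_eqF.
  by rewrite ler_wpM2l// ltW.
have h2 : normc D * normc (x - x0 - A * (s - s0)%:C - B * (t - t0)%:C) <= e / 2 * rho.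
  apply: (le_trans (ler_wpM2l D0 H1)).
  have -> : normc D * (e / (2 * N) * rho) = normc D / N * (e / 2 * rho).
    by field; rewrite gt_eqF.
  rewrite ler_piMl//; first by rewrite mulr_ge0// divr_ge0// ltW.
  by rewrite ler_pdivrMr// mul1r /N lerDl.
by move: H2 h1 h2; clear; lra.
Qed.

Lemma cdiff2_fst (s0 t0 : R) : cdiff2 (fun s _ => s%:C) s0 t0 1 0.
Proof.
move=> e e0; exists 1 => // s t _ _.
rewrite mul1r mul0r subr0 -rmorphB subrr normc0.
by rewrite mulr_ge0 ?(ltW e0)// addr_ge0.
Qed.

Lemma cdiff2_cst z (s0 t0 : R) : cdiff2 (fun _ _ => z) s0 t0 0 0.
Proof.
move=> e e0; exists 1 => // s t _ _; rewrite subrr !mul0r !subr0 normc0.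
by rewrite mulr_ge0 ?(ltW e0)// addr_ge0.
Qed.

Lemma cdiff2D F G (s0 t0 : R) A B A' B' :
  cdiff2 F s0 t0 A B -> cdiff2 G s0 t0 A' B' ->
  cdiff2 (fun s t => F s t + G s t) s0 t0 (A + A') (B + B').
Proof.
move=> dF dG e e0; have e2 : 0 < e / 2 by rewrite divr_gt0.
have [d1 d10 H1] := dF _ e2; have [d2 d20 H2] := dG _ e2.
exists (Num.min d1 d2); first by rewrite lt_min d10.
move=> s t; rewrite !lt_min => /andP[s1 s2] /andP[t1 t2].
have := H1 s t s1 t1; have := H2 s t s2 t2.
set x := F s t - F s0 t0 - _ - _; set y := G s t - G s0 t0 - _ - _.
have -> : F s t + G s t - (F s0 t0 + G s0 t0) - (A + A') * (s - s0)%:C -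
  (B + B') * (t - t0)%:C = x + y by rewrite /x /y; ring.
by move=> h1 h2; apply: (le_trans (normcD _ _)); move: h1 h2; clear; lra.
Qed.

Lemma cdiff2_circle r (s0 t0 : R) :
  cdiff2 (fun _ t => circle r t) s0 t0 0 ('i * circle r t0).
Proof.
move=> e e0; have e1 : 0 < e / (2 * (`|r| + 1)).
  by rewrite divr_gt0// mulr_gt0//; have := normr_ge0 r; lra.
have eps (g : R -> R) g' : is_derive t0 (1 : R) g g' -> exists2 d : R, 0 < d &
    forall t, `|t - t0| < d -> `|g t - g t0 - g' * (t - t0)| <= e / (2 * (`|r| + 1)) * `|t - t0|.
  move=> [dg <-]; move: dg => /cvg_ex[/= l hl].
  have -> : 'D_1 g t0 = l by apply: cvg_lim => //; exact: Rhausdorff.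
  move/cvgrPdist_le : hl => /(_ _ e1) /nbhs_ballP[d /= d0 hd].
  exists d => // t tt; have [->|tn] := eqVneq t t0.
    by rewrite !subrr mulr0 subr0 normr0 mulr0.
  have tn' : t - t0 != 0 by rewrite subr_eq0.
  have /hd/(_ tn')/= : ball 0 d (t - t0) by rewrite /ball/= sub0r normrN.
  rewrite /GRing.scale/= mulr1 subrK => h.
  have -> : g t - g t0 - l * (t - t0) = - ((l - (t - t0)^-1 * (g t - g t0)) * (t - t0)).
    by field.
  by rewrite normrN normrM ler_wpM2r.
have [d1 d10 H1] := eps _ _ (is_derive_cos t0); have [d2 d20 H2] := eps _ _ (is_derive_sin t0).
exists (Num.min d1 d2); first by rewrite lt_min d10.
move=> s t _; rewrite lt_min => /andP[t1 t2].
have {}H1 := H1 t t1; have {}H2 := H2 t t2.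
set u := cos t - cos t0 - _ in H1; set v := sin t - sin t0 - _ in H2.
have -> : circle r t - circle r t0 - 0 * (s - s0)%:C - 'i * circle r t0 * (t - t0)%:C =
  (r * u)%:C + 'i * (r * v)%:C.
  by apply/eqP; rewrite eq_complex/= /u /v; apply/andP; split; apply/eqP; ring.
apply: (le_trans (normcD _ _)); rewrite normcM normc_i mul1r !normc_real !normrM.
have r0 := normr_ge0 r.
have h : `|r| * (`|u| + `|v|) <= e * `|t - t0|.
  apply: (@le_trans _ _ ((`|r| + 1) * (2 * (e / (2 * (`|r| + 1)) * `|t - t0|)))).
    apply: ler_pM => //; last by move: H1 H2; clear; lra.
    by rewrite lerDl.
  rewrite le_eqVlt; apply/orP; left; apply/eqP; field.
  by rewrite gt_eqF//; move: r0; clear; lra.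
have := mulr_ge0 (ltW e0) (normr_ge0 (s - s0)).
by move: h; clear; lra.
Qed.

End complex_differentiability.

HB.lock Definition cmean {R : realType} (u : R -> R[i]) : R[i] :=
  mean (fun t => complex.Re (u t)) +i* mean (fun t => complex.Im (u t)).
Canonical cmean_unlock := Unlockable cmean.unlock.

(** * Cauchy's formula by contracting a circle *)

Section cauchy.
Context {R : realType}.
Implicit Types (f : R[i]^o -> R[i]^o) (u v : R -> R[i]) (a c z w : R[i]) (r s t e : R).

(** On the rectangle [[eta, 1]] by [[0, 2 pi]] the edges [t = 0] and [t = 2 pi] cancel by
    periodicity, so the vanishing boundary integral equates the other two edges. *)
Lemma mean_homotopy (P Q : R -> R -> R) (eta : R) : 0 < eta <= 1 ->
  (forall s t, eta <= s <= 1 -> exists p m q, diff2 P s t p m /\ diff2 Q s t m q) ->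
  (forall s, P s (2 * pi) = P s 0) -> mean (Q 1) = mean (Q eta).
Proof.
move=> /andP[eta0 eta1] dPQ per.
have L0 : 0 <= 1 - eta by rewrite subr_ge0.
have cf : closed_form P Q eta 0 (1 - eta) (2 * pi).
  by move=> s t; rewrite subrKC => hs _; exact: dPQ.
have := boundary_int_eq0 L0 (ltW twopi_gt0) cf.
rewrite /boundary_int subrKC add0r (_ : (P ^~ (2 * pi)) = (P ^~ 0)); last exact/funext.
rewrite -addrA -opprD addrAC [_ - (_ + _)]addrC => h.
rewrite /mean; congr (_ * _).
by move: h; rewrite -/(segint (Q 1) 0 (2 * pi)) -/(segint (Q eta) 0 (2 * pi)); clear; lra.
Qed.

Lemma cmeanE u : cmean u =
  mean (fun t => complex.Re (u t)) +i* mean (fun t => complex.Im (u t)).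
Proof. by rewrite unlock. Qed.

Lemma continuous_Re u : continuous (u : R -> R[i]^o) ->
  continuous (fun t => complex.Re (u t)).
Proof.
move=> cu t; apply/cvgrPdist_lt => e e0.
have e0' : 0 < e%:C :> R[i] by rewrite ltr0c.
have /cvgrPdist_lt/(_ _ e0') := cu t; apply: filterS => s.
rewrite normCE ltcR; apply: le_lt_trans; apply: le_trans (normc_Re _).
by case: (u t) => ? ?; case: (u s).
Qed.

Lemma continuous_Im u : continuous (u : R -> R[i]^o) ->
  continuous (fun t => complex.Im (u t)).
Proof.
move=> cu t; apply/cvgrPdist_lt => e e0.
have e0' : 0 < e%:C :> R[i] by rewrite ltr0c.
have /cvgrPdist_lt/(_ _ e0') := cu t; apply: filterS => s.
rewrite normCE ltcR; apply: le_lt_trans; apply: le_trans (normc_Im _).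
by case: (u t) => ? ?; case: (u s).
Qed.

Lemma eq_cmean u v : u =1 v -> cmean u = cmean v.
Proof. by move=> /funext ->. Qed.

Lemma cmeanD u v : continuous (u : R -> R[i]^o) -> continuous (v : R -> R[i]^o) ->
  cmean (fun t => u t + v t) = cmean u + cmean v.
Proof.
move=> cu cv; rewrite !cmeanE -[RHS]/((_ + _) +i* (_ + _)).
rewrite -meanD; [|exact: continuous_Re|exact: continuous_Re].
rewrite -meanD; [|exact: continuous_Im|exact: continuous_Im].
by congr (_ +i* _); apply: eq_mean => t; case: (u t) => ? ?; case: (v t).
Qed.

Lemma cmeanZ c u : continuous (u : R -> R[i]^o) ->
  cmean (fun t => c * u t) = c * cmean u.
Proof.
move=> cu; have cR := continuous_Re cu; have cI := continuous_Im cu.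
have cZ (k : R) (g : R -> R) : continuous g -> continuous (fun t => k * g t).
  by move=> cg t; apply: cvgM; [exact: cvg_cst|exact: cg].
case: c => x y; rewrite !cmeanE -[RHS]/((_ - _) +i* (_ + _)) -!meanZ//.
rewrite -meanB; [|exact: cZ|exact: cZ]; rewrite -meanD; [|exact: cZ|exact: cZ].
by congr (_ +i* _); apply: eq_mean => t; case: (u t).
Qed.

Lemma cmeanB u v : continuous (u : R -> R[i]^o) -> continuous (v : R -> R[i]^o) ->
  cmean (fun t => u t - v t) = cmean u - cmean v.
Proof.
move=> cu cv.
have cN : continuous ((fun t => -1 * v t) : R -> R[i]^o).
  move=> t; exact: (@cvgM R[i] _ _ _ (fun=> -1) v _ _ (cvg_cst _) (cv t)).
rewrite -[- cmean v]mulN1r -(cmeanZ (-1) cv) -(cmeanD cu cN).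
by apply: eq_cmean => t; rewrite mulN1r.
Qed.

Lemma cmean_cst c : cmean (fun=> c) = c.
Proof. by rewrite !cmeanE !mean_cst; case: c. Qed.

(** The factor [2] comes from estimating real and imaginary parts separately; it is harmless, as the
    bound is used only for quantities that become arbitrarily small. *)
Lemma normc_cmean_le u e : continuous (u : R -> R[i]^o) ->
  (forall t, normc (u t) <= e) -> normc (cmean u) <= 2 * e.
Proof.
move=> cu ue; have c0 : continuous (fun _ : R => 0 : R) by move=> t; exact: cvg_cst.
have h1 : `|mean (fun t => complex.Re (u t))| <= e.
  rewrite -[X in `|X|]subr0 -(mean_cst 0); apply: dist_mean => // [|t].
    exact: continuous_Re.
  by rewrite subr0; exact: le_trans (normc_Re _) (ue t).
have h2 : `|mean (fun t => complex.Im (u t))| <= e.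
  rewrite -[X in `|X|]subr0 -(mean_cst 0); apply: dist_mean => // [|t].
    exact: continuous_Im.
  by rewrite subr0; exact: le_trans (normc_Im _) (ue t).
have -> : cmean u = (mean (fun t => complex.Re (u t)))%:C +
    'i * (mean (fun t => complex.Im (u t)))%:C.
  by rewrite cmeanE; apply/eqP; rewrite eq_complex/=; apply/andP; split; apply/eqP; ring.
apply: (le_trans (normcD _ _)); rewrite normcM normc_i mul1r !normc_real.
by move: h1 h2; clear; lra.
Qed.

Lemma cmean_shift u s : continuous (u : R -> R[i]^o) ->
  (forall t, u (t + 2 * pi) = u t) -> cmean (fun t => u (t + s)) = cmean u.
Proof.
move=> cu per; rewrite !cmeanE; congr (_ +i* _).
  rewrite (@mean_shift _ (fun t => complex.Re (u t)) s)//; first exact: continuous_Re.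
  by move=> t; rewrite per.
rewrite (@mean_shift _ (fun t => complex.Im (u t)) s)//; first exact: continuous_Im.
by move=> t; rewrite per.
Qed.

Lemma circle_exp s n : circle 1 s ^+ n = circle 1 (n%:R * s) :> R[i].
Proof.
elim: n => [|n IH].
  by rewrite expr0 mul0r /circle cos0 sin0 mulr0 mulr1.
by rewrite exprSr IH -circleD -natr1 mulrDl mul1r.
Qed.

Lemma continuous_circle_inv r : 0 < r ->
  continuous (fun t => (circle r t)^-1 : R[i]^o).
Proof.
move=> r0 t; apply: (@cvgV R[i] R); last exact: continuous_circle.
by rewrite -normc_gt0 normc_circle// ltW.
Qed.

Lemma continuous_exp u n : continuous (u : R -> R[i]^o) ->
  continuous (fun t => u t ^+ n : R[i]^o).
Proof.
move=> cu; elim: n => [|n IH].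
  have -> : (fun t => u t ^+ 0) = (fun=> 1) by apply/funext => t; rewrite expr0.
  by move=> t; exact: cvg_cst.
have -> : (fun t => u t ^+ n.+1) = (fun t => u t * u t ^+ n).
  by apply/funext => t; rewrite exprS.
by move=> t; apply: (@cvgM R[i]); [exact: cu|exact: IH].
Qed.

(** For a positive exponent [n] the rotation by [pi / n] changes the sign of the integrand but not
    its mean. *)
Lemma cmean_circle_inv r n : 0 < r -> cmean (fun t => (circle r t)^-1 ^+ n) = (n == 0%N)%:R.
Proof.
move=> r0; case: n => [|n].
  by under eq_cmean do rewrite expr0; rewrite cmean_cst.
set u := fun t => _; have cu : continuous (u : R -> R[i]^o).
  exact: continuous_exp (continuous_circle_inv r0).
have per t : u (t + 2 * pi) = u t by rewrite /u circle_periodic.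
have neg t : u (t + pi / n.+1%:R) = -1 * u t.
  have e : n.+1%:R * (pi / n.+1%:R) = pi :> R by rewrite mulrC divfK ?pnatr_eq0.
  rewrite /u circleD invfM exprMn [X in _ * X]exprVn circle_exp e mulrC.
  have -> : circle 1 pi = -1 :> R[i].
    rewrite /circle cospi sinpi mulr0 mul1r; apply/eqP.
    by rewrite eq_complex/= oppr0 !eqxx.
  by rewrite invrN1.
have := cmean_shift (pi / n.+1%:R) cu per; rewrite (eq_cmean neg) cmeanZ// mulN1r.
by move/eqP; rewrite eqNr => /eqP.
Qed.

Lemma cmean_sum (I : Type) (l : seq I) (F : I -> R -> R[i]) :
  (forall i, continuous (F i : R -> R[i]^o)) ->
  continuous ((fun t => \sum_(i <- l) F i t) : R -> R[i]^o) /\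
  cmean (fun t => \sum_(i <- l) F i t) = \sum_(i <- l) cmean (F i).
Proof.
move=> cF; elim: l => [|i l [IH1 IH2]].
  have -> : (fun t => \sum_(i <- [::]) F i t) = (fun=> 0).
    by apply/funext => t; rewrite big_nil.
  by rewrite big_nil cmean_cst; split => // t; exact: cvg_cst.
have -> : (fun t => \sum_(j <- i :: l) F j t) = (fun t => F i t + \sum_(j <- l) F j t).
  by apply/funext => t; rewrite big_cons.
split; last first.
  transitivity (cmean (F i) + cmean (fun t => \sum_(j <- l) F j t)).
    exact: (@cmeanD (F i) (fun t => \sum_(j <- l) F j t) (cF i) IH1).
  by rewrite IH2 big_cons.
move=> t.
exact: (@cvgD R[i] R[i]^o _ _ _ (F i) (fun t => \sum_(j <- l) F j t) _ _ (cF i t) (IH1 t)).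
Qed.

Lemma geom_remainder (c x y z : R[i]) : 1 - x != 0 -> y - 1 = (x - 1) * z ->
  c * (1 - x)^-1 - c * z = c * (y * (1 - x)^-1).
Proof.
move=> x1 E; have -> : y = 1 + (x - 1) * z by rewrite -E; ring.
by field.
Qed.

(** The kernel [u / (u - a)] is expanded in powers of [a / u]. With [g = 1] this gives the mean of
    the kernel; with [g = f] the partial sums are the polynomials in [a] that approximate [f]. *)
Lemma cmean_geom (g : R -> R[i]) a r (M : R) N : normc a < r ->
  continuous (g : R -> R[i]^o) -> (forall t, normc (g t) <= M) ->
  normc (cmean (fun t => g t * (circle r t / (circle r t - a))) -
         \sum_(n < N) a ^+ n * cmean (fun t => g t * (circle r t)^-1 ^+ n)) <=
  2 * (M * ((normc a / r) ^+ N * (r / (r - normc a)))).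
Proof.
move=> ar cg gM; have a0 := normc_ge0 a; have r0 : 0 < r by exact: le_lt_trans ar.
have M0 : 0 <= M := le_trans (normc_ge0 _) (gM 0).
pose u t : R[i] := circle r t.
have nu t : normc (u t) = r by rewrite normc_circle// ltW.
have u0 t : u t != 0 by rewrite -normc_gt0 nu.
have ua t : r - normc a <= normc (u t - a).
  by have := normcD (u t - a) a; rewrite subrK nu; lra.
have ua0 t : u t - a != 0 by rewrite -normc_gt0; have := ua t; lra.
have cu : continuous (u : R -> R[i]^o) by exact: continuous_circle.
have cV n : continuous (fun t => (u t)^-1 ^+ n : R[i]^o).
  exact: continuous_exp (continuous_circle_inv r0).
have cgV n : continuous (fun t => g t * (u t)^-1 ^+ n : R[i]^o).
  by move=> t; apply: (@cvgM R[i]); [exact: cg|exact: cV].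
have cgZ n : continuous (fun t => a ^+ n * (g t * (u t)^-1 ^+ n) : R[i]^o).
  by move=> t; apply: (@cvgM R[i]); [exact: cvg_cst|exact: cgV].
have cq : continuous (fun t => u t / (u t - a) : R[i]^o).
  move=> t; apply: (@cvgM R[i]); first exact: cu.
  apply: (@cvgV R[i] R); first exact: ua0.
  by apply: (@cvgB R[i] R[i]^o); [exact: cu|exact: cvg_cst].
have cgq : continuous (fun t => g t * (u t / (u t - a)) : R[i]^o).
  by move=> t; apply: (@cvgM R[i]); [exact: cg|exact: cq].
have [cS eS] := cmean_sum (index_enum 'I_N) (fun n : 'I_N => cgZ n).
have -> : \sum_(n < N) a ^+ n * cmean (fun t => g t * (u t)^-1 ^+ n) =
    cmean (fun t => \sum_(n < N) a ^+ n * (g t * (u t)^-1 ^+ n)).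
  by rewrite eS; apply: eq_bigr => n _; rewrite (cmeanZ _ (cgV n)).
rewrite -(cmeanB cgq cS); apply: normc_cmean_le => [t|t].
  exact: (@cvgB R[i] R[i]^o _ _ _ _ _ _ _ (cgq t) (cS t)).
have -> : \sum_(n < N) a ^+ n * (g t * (u t)^-1 ^+ n) =
    g t * \sum_(n < N) (a / u t) ^+ n.
  by rewrite mulr_sumr; apply: eq_bigr => n _; rewrite exprMn; ring.
have -> : g t * (u t / (u t - a)) - g t * \sum_(n < N) (a / u t) ^+ n =
    g t * ((a / u t) ^+ N * (u t / (u t - a))).
  have dE : 1 - a / u t = (u t - a) / u t by rewrite mulrBl mulfV.
  have d0 : 1 - a / u t != 0 by rewrite dE mulf_neq0// invr_neq0.
  have -> : u t / (u t - a) = (1 - a / u t)^-1 by rewrite dE invf_div.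
  exact: geom_remainder d0 (subrX1 (a / u t) N).
rewrite !(normcX, normcV, normcM) nu.
have x0 : 0 <= (normc a / r) ^+ N by apply: exprn_ge0; exact: divr_ge0 a0 (ltW r0).
apply: ler_pM; [exact: normc_ge0| |exact: gM|].
  by apply: mulr_ge0 => //; apply: divr_ge0; [exact: ltW|exact: normc_ge0].
apply: ler_wpM2l => //; apply: ler_wpM2l; first exact: ltW.
have ra0 : 0 < r - normc a by rewrite subr_gt0.
by rewrite lef_pV2 ?posrE// (lt_le_trans ra0).
Qed.

Lemma cmean_cauchy_kernel a r : normc a < r ->
  cmean (fun t => circle r t / (circle r t - a)) = 1.
Proof.
move=> ar; have a0 := normc_ge0 a; have r0 : 0 < r by exact: le_lt_trans ar.
apply/eqP; rewrite -subr_eq0; apply/eqP; apply: eq0_normc; apply/eqP.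
rewrite eq_le normc_ge0 andbT; pose k := r / (r - normc a).
have k0 : 0 < k by rewrite divr_gt0// subr_gt0.
apply: (@le_linear_eps _ _ _ (2 * k)); first by rewrite mulr_ge0// ltW.
move=> e /andP[e0 _]; rewrite add0r.
have q01 : 0 <= normc a / r < 1.
  by rewrite divr_ge0 ?(ltW r0)//= ltr_pdivrMr// mul1r.
have [N hN] := expr_lt_eps q01 e0.
have c1 : continuous ((fun=> 1) : R -> R[i]^o) by move=> t; exact: cvg_cst.
have n1 (t : R) : normc (1 : R[i]) <= 1 by rewrite normc1.
(* [N.+1] terms, so that the term [n = 0], the only one with nonzero mean, is present. *)
have := @cmean_geom (fun=> 1) a r 1 N.+1 ar c1 n1.
have -> : \sum_(n < N.+1) a ^+ n * cmean (fun t => 1 * (circle r t)^-1 ^+ n) = 1.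
  rewrite big_ord_recl big1 ?addr0 => [|i _].
    by under eq_cmean do rewrite mul1r; rewrite cmean_circle_inv// mulr1.
  by under eq_cmean do rewrite mul1r; rewrite cmean_circle_inv// mulr0.
under eq_cmean do rewrite mul1r.
move=> /le_trans; apply; rewrite mul1r exprSr -/k.
have q0 : 0 <= (normc a / r) ^+ N by apply: exprn_ge0; case/andP: q01.
have : (normc a / r) ^+ N * (normc a / r) <= e.
  apply: le_trans (ltW hN); rewrite ler_piMr//; case/andP: q01 => _; exact: ltW.
by move=> /(ler_wpM2r (ltW k0)); clear; lra.
Qed.

(* Equality of the two mixed partial derivatives computed by [cdiff2M] and
   [cdiff2_comp]. *)
Lemma homotopy_closed (D J S U A F D1 D2 : R[i]) : J ^+ 2 = -1 -> S != 0 -> U - A != 0 ->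
  ((D * (0 + (0 * (U - A) + S * (J * U + 0))) + 0) / S + F * (D1 * 0)) * - J
    + F / S * 0 =
  (D * (0 + (1 * (U - A) + S * (0 + 0))) + 0) * (U / (U - A))
    + F * (0 / (U - A) + U * (D2 * (0 + 0))).
Proof.
move=> J2 S0 UA; transitivity (D * U * - J ^+ 2); first by field.
by rewrite J2 opprK mulr1; field.
Qed.

(** The circle is contracted to [a] without changing the mean. Subtracting [f a] makes the integrand
    tend to [0] there, while the kernel stays bounded by [r / (r - normc a)]. *)
Lemma cauchy_mean_eq0 f a r : analytic_on_disc f -> normc a < r < 1 ->
  cmean (fun t => (f (circle r t) - f a) * (circle r t / (circle r t - a))) = 0.
Proof.
move=> fa /andP[ar r1]; have a0 := normc_ge0 a; have r0 : 0 < r by exact: le_lt_trans ar.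
pose u t : R[i] := circle r t.
have nu t : normc (u t) = r by rewrite normc_circle// ltW.
have ua t : r - normc a <= normc (u t - a).
  by have := normcD (u t - a) a; rewrite subrK nu; lra.
have ua0 t : u t - a != 0 by rewrite -normc_gt0; have := ua t; lra.
(* [P ds + Q dt] is the pullback of [- i (f z - f a) / (z - a) dz] under [Z], since
   [dZ / (Z - a) = ds / s + i u / (u - a) dt]. Differences are written as sums with opposites to
   match the rules for [cdiff2]. *)
pose Z s t : R[i] := a + s%:C * (u t + - a).
pose P s t := (f (Z s t) + - f a) * (s%:C)^-1 * (- 'i).
pose Q s t := (f (Z s t) + - f a) * (u t * (u t + - a)^-1).
have inv_cdiff (w : R[i]) : w != 0 -> exists D, cdiff (fun z => z^-1) w D.
  by move=> w0; apply: derivable_cdiff; apply: derivableV => //; exact: derivable_id.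
have dPQ s0 t0 : 0 < s0 <= 1 -> exists p m q, cdiff2 P s0 t0 p m /\ cdiff2 Q s0 t0 m q.
  move=> /andP[s00 s01].
  have dE := @cdiff2_circle R r s0 t0.
  have dEa := cdiff2D dE (cdiff2_cst (- a) s0 t0).
  have dZ := cdiff2D (cdiff2_cst a s0 t0) (cdiff2M (cdiff2_fst s0 t0) dEa).
  have Z1 : normc (Z s0 t0) < 1.
    have -> : Z s0 t0 = (1 - s0)%:C * a + s0%:C * u t0.
      by rewrite /Z rmorphB rmorph1; ring.
    apply: (le_lt_trans (normcD _ _)); rewrite !normcM !normc_real nu.
    by rewrite !ger0_norm; [nra|lra|lra].
  have [D hD] := derivable_cdiff (fa _ Z1).
  have dF := cdiff2D (cdiff2_comp dZ hD) (cdiff2_cst (- f a) s0 t0).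
  have s0C : s0%:C != 0 :> R[i] by rewrite -normc_gt0 normc_real gtr0_norm.
  have [D1 hD1] := inv_cdiff _ s0C.
  have dP := cdiff2M (cdiff2M dF (cdiff2_comp (cdiff2_fst s0 t0) hD1))
    (cdiff2_cst (- 'i) s0 t0).
  have [D2 hD2] := inv_cdiff _ (ua0 t0).
  have dQ := cdiff2M dF (cdiff2M dE (cdiff2_comp dEa hD2)).
  move: dP dQ; set p := (X in cdiff2 P _ _ X _); set m := (X in cdiff2 P _ _ _ X).
  set m' := (X in cdiff2 Q _ _ X _); set q := (X in cdiff2 Q _ _ _ X).
  move=> dP dQ; exists p, m, q; split=> //; suff -> : m = m' by [].
  rewrite /m /m' -/(u t0).
  exact: (@homotopy_closed D 'i s0%:C (u t0) a _ D1 D2 (sqr_i R) s0C (ua0 t0)).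
have cQ s : 0 < s <= 1 -> continuous (Q s : R -> R[i]^o).
  move=> s01 t; have [p [m [q [_ /cdiff2_lipschitz[d d0 hd]]]]] := dPQ s t s01.
  apply/cvgrPdist_lt => e e0.
  have [e' e'0 ->] : exists2 e' : R, 0 < e' & e = e'%:C.
    case: e e0 => x y; rewrite ltcE/= => /andP[/eqP b0 x0].
    by exists x => //; rewrite b0.
  set K := 1 + _ + _ in hd.
  have K0 : 0 < K by rewrite /K; have := normc_ge0 m; have := normc_ge0 q; lra.
  apply/nbhs_ballP; exists (Num.min d (e' / K)) => /=.
    by rewrite lt_min d0 divr_gt0.
  move=> t'; rewrite /ball/= distrC lt_min => /andP[t1 t2].
  rewrite distrC normCE ltcR; have := hd s t'; rewrite subrr normr0 => /(_ d0 t1).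
  move=> /le_lt_trans; apply; rewrite add0r mulrC -ltr_pdivlMr//.
have homo (eta : R) : 0 < eta <= 1 -> cmean (Q 1) = cmean (Q eta).
  move=> heta; have /andP[eta0 eta1] := heta.
  have per s : P s (2 * pi) = P s 0.
    by rewrite /P /Z /u -[2 * pi]add0r circle_periodic.
  have pos s : eta <= s <= 1 -> 0 < s <= 1.
    by move=> /andP[h1 ->]; rewrite (lt_le_trans eta0 h1).
  rewrite !cmeanE; congr (_ +i* _).
    apply: (@mean_homotopy (fun s t => complex.Re (P s t)) (fun s t => complex.Re (Q s t))) => //.
      move=> s t /pos hs; have [p [m [q [dP dQ]]]] := dPQ s t hs.
      by exists (complex.Re p), (complex.Re m), (complex.Re q); split; exact: cdiff2_Re.
    by move=> s; rewrite per.
  apply: (@mean_homotopy (fun s t => complex.Im (P s t)) (fun s t => complex.Im (Q s t))) => //.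
    move=> s t /pos hs; have [p [m [q [dP dQ]]]] := dPQ s t hs.
    by exists (complex.Im p), (complex.Im m), (complex.Im q); split; exact: cdiff2_Im.
  by move=> s; rewrite per.
have Q1 : cmean (fun t => (f (circle r t) - f a) * (circle r t / (circle r t - a))) =
    cmean (Q 1).
  by apply: eq_cmean => t; rewrite /Q /Z rmorph1 mul1r subrKC.
rewrite Q1; apply: eq0_normc; apply/eqP; rewrite eq_le normc_ge0 andbT.
have a1 : normc a < 1 by exact: lt_trans ar r1.
have [D hD] := derivable_cdiff (fa _ a1); have [d d0 hd] := hD 1 ltr01.
pose k := r / (r - normc a); have k0 : 0 < k by rewrite divr_gt0// subr_gt0.
pose K := 2 * ((1 + normc D) * 2 * k).
have D0 := normc_ge0 D; have K0 : 0 <= K.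
  by rewrite /K; apply: mulr_ge0 => //; apply: mulr_ge0; [lra|exact: ltW].
apply: (@le_linear_eps _ _ _ K) => // e /andP[e0 e1]; rewrite add0r.
pose eta := Num.min e (d / 4).
have eta0 : 0 < eta by rewrite lt_min e0 divr_gt0.
have etae : eta <= e by rewrite ge_min lexx.
have etad : eta <= d / 4 by rewrite ge_min lexx orbT.
have eta01 : 0 < eta <= 1 by rewrite eta0 (le_trans etae).
rewrite (homo _ eta01).
have -> : K * e = 2 * ((1 + normc D) * (2 * e) * k) by rewrite /K; ring.
apply: normc_cmean_le => [|t]; first exact: cQ.
rewrite /Q normcM; apply: ler_pM; rewrite ?normc_ge0//; last first.
  rewrite normcM normcV nu; apply: ler_wpM2l; first exact: ltW.
  by rewrite lef_pV2 ?posrE//; have := ua t; lra.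
have Za : normc (Z eta t - a) <= 2 * eta.
  rewrite /Z addrAC subrr add0r normcM normc_real gtr0_norm// mulrC ler_wpM2r ?(ltW eta0)//.
  by apply: (le_trans (normcB _ _)); rewrite nu; move: r1 a1; clear; lra.
have Zd : normc (Z eta t - a) < d.
  by apply: (le_lt_trans Za); move: etad d0; clear; lra.
have := hd _ Zd; rewrite mul1r => h.
have := normcD (f (Z eta t) - f a - D * (Z eta t - a)) (D * (Z eta t - a)).
rewrite subrK normcM => h'; apply: (le_trans h').
apply: (@le_trans _ _ ((1 + normc D) * normc (Z eta t - a))).
  by move: h; clear; lra.
apply: ler_wpM2l; first by rewrite addr_ge0.
by apply: (le_trans Za); rewrite ler_pM2l.
Qed.

(** Cauchy's formula on a circle of radius [r] strictly between [rho] and [1]: there the expansion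
    of the kernel converges uniformly for [normc a <= rho], at the rate [(rho / r)^N]. *)
Lemma analytic_disc_algebra f (rho : R) : analytic_on_disc f -> 0 <= rho < 1 ->
  disc_algebra (fun z => f (rho%:C * z)).
Proof.
move=> fa /andP[rho0 rho1] e e0.
pose r := (1 + rho) / 2; have r0 : 0 < r by rewrite /r; lra.
have r1 : r < 1 by rewrite /r; lra.
have rhor : rho < r by rewrite /r; lra.
have r01 : 0 < r < 1 by rewrite r0.
have cf : continuous (fun t => f (circle r t) : R[i]^o).
  move=> t; apply: (@continuous_comp _ R[i]^o _ (circle r) f); first exact: continuous_circle.
  apply/differentiable_continuous/derivable1_diffP/fa.
  by rewrite normc_circle// ltW.
have [M fM] : exists M, forall t, normc (f (circle r t)) <= M.
  have cn := continuous_on_circle fa r01.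
  have cn' : {within `[0, 2 * pi], continuous (fun t => normc (f (circle r t)))}.
    exact: continuous_subspaceT.
  have [c _ hc] := EVT_max (ltW twopi_gt0) cn'.
  exists (normc (f (circle r c))) => t.
  have [s s2 ->] := circle_surj (circle r t); rewrite normc_circle ?(ltW r0)//.
  exact: hc.
have M0 : 0 <= M := le_trans (normc_ge0 _) (fM 0).
pose k := r / (r - rho); have k0 : 0 < k by rewrite divr_gt0// subr_gt0.
have q01 : 0 <= rho / r < 1 by rewrite divr_ge0 ?(ltW r0)//= ltr_pdivrMr// mul1r.
pose K := 2 * (M * k) + 1.
have K0 : 0 < K by rewrite /K ltr_wpDl// mulr_ge0// mulr_ge0// ltW.
have [N hN] := expr_lt_eps q01 (divr_gt0 e0 K0).
pose c n := cmean (fun t => f (circle r t) * (circle r t)^-1 ^+ n).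
exists (\sum_(n < N) (rho%:C ^+ n * c n)%:P * 'X^n) => z z1.
pose a := rho%:C * z.
have arho : normc a <= rho.
  by rewrite normcM normc_real ger0_norm// ler_piMr.
have ar : normc a < r by exact: le_lt_trans rhor.
have a0 := normc_ge0 a.
have -> : (\sum_(n < N) (rho%:C ^+ n * c n)%:P * 'X^n).[z] = \sum_(n < N) a ^+ n * c n.
  rewrite horner_sum; apply: eq_bigr => n _.
  by rewrite hornerM hornerC hornerXn exprMn; ring.
rewrite -/a.
have -> : f a = cmean (fun t => f (circle r t) * (circle r t / (circle r t - a))).
  have r1' : normc a < r < 1 by rewrite ar.
  have ua0 t : circle r t - a != 0.
    have := normcD (circle r t - a) a; rewrite subrK normc_circle ?(ltW r0)// => h.
    by rewrite -normc_gt0; move: h ar; clear; lra.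
  have cq : continuous (fun t => circle r t / (circle r t - a) : R[i]^o).
    move=> t; apply: (@cvgM R[i]); first exact: continuous_circle.
    apply: (@cvgV R[i] R); first exact: ua0.
    by apply: (@cvgB R[i] R[i]^o); [exact: continuous_circle|exact: cvg_cst].
  have c1 : continuous (fun t => (f (circle r t) - f a) *
      (circle r t / (circle r t - a)) : R[i]^o).
    move=> t; apply: (@cvgM R[i]); last exact: cq.
    by apply: (@cvgB R[i] R[i]^o); [exact: cf|exact: cvg_cst].
  have c2 : continuous (fun t => f a * (circle r t / (circle r t - a)) : R[i]^o).
    by move=> t; apply: (@cvgM R[i]); [exact: cvg_cst|exact: cq].
  have := cmeanD c1 c2; rewrite cauchy_mean_eq0// cmeanZ// cmean_cauchy_kernel// mulr1 add0r.
  by move=> <-; apply: eq_cmean => t; rewrite -mulrDl subrK.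
apply: (le_trans (cmean_geom N ar cf fM)).
have h1 : (normc a / r) ^+ N * (r / (r - normc a)) <= (e / K) * k.
  apply: ler_pM.
  - by apply: exprn_ge0; exact: divr_ge0 a0 (ltW r0).
  - by apply: divr_ge0; [exact: ltW|rewrite subr_ge0 ltW].
  - apply: le_trans (ltW hN); apply: lerXn2r; rewrite ?nnegrE.
    + exact: divr_ge0 a0 (ltW r0).
    + exact: divr_ge0 rho0 (ltW r0).
    + by rewrite ler_pM2r ?invr_gt0.
  - apply: ler_wpM2l; first exact: ltW.
    by rewrite lef_pV2 ?posrE ?subr_gt0//; lra.
apply: (@le_trans _ _ (2 * (M * (e / K * k)))).
  by rewrite ler_pM2l// ler_wpM2l.
have -> : 2 * (M * (e / K * k)) = (2 * (M * k)) / K * e by ring.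
rewrite ler_piMl ?(ltW e0)// ler_pdivrMr// mul1r /K.
by rewrite lerDl.
Qed.

End cauchy.

(** * Hardy norms and boundary means *)

Section hardy_pmean.
Context {R : realType}.
Implicit Types (f : R[i]^o -> R[i]^o) (F G : R[i] -> R[i]) (p r s e : R) (z : R[i]).
Local Notation mu := (@lebesgue_measure R).

Lemma integral_mean_pmean p f r : 1 <= p -> analytic_on_disc f -> 0 < r < 1 ->
  integral_mean p f r = ((pmean p f r) `^ p^-1)%:E.
Proof.
move=> p1 fa r01.
have cf : continuous (fun t => f (circle r t) : R[i]^o).
  move=> t; apply: (@continuous_comp _ R[i]^o _ (circle r) f); first exact: continuous_circle.
  apply/differentiable_continuous/derivable1_diffP/fa.
  by case/andP: r01 => r0 r1; rewrite normc_circle// ltW.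
have ci := continuous_integrable 0 (2 * pi) (continuous_norm_powR p1 cf).
rewrite /integral_mean pmeanE /mean -[RHS]poweR_EFin EFinM; congr (_ `^ _)%E.
congr (_ * _)%E; rewrite /Rintegral fineK//.
exact: integrable_fin_num.
Qed.

Variables (p : R) (p1 : 1 <= p).

Definition hnorm (h : hardy p1) : R := fine (hardy_norm p (val h)).

Lemma hnorm_ge0 h : 0 <= hnorm h.
Proof. exact: fine_ge0 (hardy_norm_ge0 _ _). Qed.

Lemma hnormE (h : hardy p1) : `|h| = (hnorm h)%:C.
Proof. by []. Qed.

Lemma pmean_le_hnorm (h : hardy p1) r : 0 < r < 1 ->
  pmean p (val h) r <= hnorm h `^ p.
Proof.
move=> r01; have [ha _ hfin] := hardyP h.
have p0 : 0 < p by rewrite (lt_le_trans ltr01).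
have : (integral_mean p (val h) r <= hardy_norm p (val h))%E.
  by rewrite unlock; apply: ereal_sup_ubound; exists r.
rewrite integral_mean_pmean// -(fineK hfin) lee_fin -/(hnorm h) => le1.
rewrite -[leLHS]powRr1 ?pmean_ge0// -(mulVf (lt0r_neq0 p0)) powRrM.
by apply: ge0_ler_powR; rewrite ?nnegrE ?powR_ge0 ?hnorm_ge0// ltW.
Qed.

Lemma hnorm_le (h : hardy p1) (K : R) : 0 <= K ->
  (forall r, 0 < r < 1 -> pmean p (val h) r <= K `^ p) -> hnorm h <= K.
Proof.
move=> K0 hK; have [ha _ hfin] := hardyP h.
have p0 : 0 < p by rewrite (lt_le_trans ltr01).
rewrite -lee_fin /hnorm fineK// unlock; apply: ge_ereal_sup => _ [r /= r01 <-].
have {}r01 : 0 < r < 1 by move: r01; rewrite in_itv.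
rewrite integral_mean_pmean// lee_fin.
rewrite -[leRHS]powRr1// -(mulfV (lt0r_neq0 p0)) powRrM.
apply: ge0_ler_powR; rewrite ?nnegrE ?pmean_ge0 ?powR_ge0//; last exact: hK.
by rewrite invr_ge0 ltW.
Qed.

End hardy_pmean.

(** * Means up to the boundary for the disc algebra *)

Section boundary_values.
Context {R : realType}.
Implicit Types (F G : R[i] -> R[i]) (P : {poly R[i]}) (p r s e : R) (z : R[i]).

Lemma poly_dilation_close P : exists2 L : R, 0 <= L & forall s z, 0 <= s <= 1 ->
  normc z <= 1 -> normc (P.[s%:C * z] - P.[z]) <= L * (1 - s).
Proof.
elim/poly_ind: P => [|P c [L L0 IH]].
  by exists 0 => // s z _ _; rewrite !horner0 subr0 normc0 mul0r.
have [M M0 HM] := poly_bound P.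
exists (L + M); first exact: addr_ge0.
move=> s z s01 z1; have /andP[s0 s1] := s01.
rewrite !hornerMXaddC opprD addrACA subrr addr0.
have -> : P.[s%:C * z] * (s%:C * z) - P.[z] * z =
   (P.[s%:C * z] - P.[z]) * (s%:C * z) - P.[z] * ((1 - s)%:C * z).
  by rewrite rmorphB rmorph1; ring.
apply: (le_trans (normcB _ _)); rewrite (mulrDl L M) !normcM !normc_real.
rewrite (ger0_norm s0) (ger0_norm (_ : 0 <= 1 - s)) ?subr_ge0//.
have h := IH s z s01 z1; have [h2 _] := HM z z1; have z0 := normc_ge0 z.
have s10 : 0 <= 1 - s by rewrite subr_ge0.
apply: lerD.
  apply: le_trans h; rewrite ler_piMr ?normc_ge0//.
  by rewrite mulr_ile1.
by apply: ler_pM; rewrite ?normc_ge0 ?mulr_ge0// ler_piMr.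
Qed.

Lemma disc_algebra_dilation_close F e : disc_algebra F -> 0 < e ->
  exists2 s0 : R, 0 <= s0 < 1 & forall s z, s0 <= s <= 1 -> normc z <= 1 ->
  normc (F (s%:C * z) - F z) <= e.
Proof.
move=> AF e0; have e30 : 0 < e / 4 by rewrite divr_gt0.
have [P HP] := AF _ e30; have [L L0 HL] := poly_dilation_close P.
pose d := Num.min 1 (e / (4 * (L + 1))).
have L1 : 0 < L + 1 by rewrite ltr_wpDl.
have d0 : 0 < d by rewrite lt_min ltr01 divr_gt0// mulr_gt0.
have d1 : d <= 1 by rewrite ge_min lexx.
exists (1 - d) => [|s z /andP[hs s1] z1]; first by apply/andP; split; lra.
have s0 : 0 <= s by lra.
have s01 : 0 <= s <= 1 by rewrite s0.
have sz1 : normc (s%:C * z) <= 1.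
  by rewrite normcM normc_real ger0_norm// mulr_ile1// normc_ge0.
have -> : F (s%:C * z) - F z = (F (s%:C * z) - P.[s%:C * z]) +
    (P.[s%:C * z] - P.[z]) - (F z - P.[z]) by ring.
apply: (le_trans (normcB _ _)); apply: (le_trans (lerD (normcD _ _) (lexx _))).
have h1 := HP _ sz1; have h2 := HP _ z1; have h3 := HL s z s01 z1.
have h4 : L * (1 - s) <= e / 4.
  apply: (@le_trans _ _ ((L + 1) * d)).
    by apply: ler_pM => //; [rewrite subr_ge0|rewrite lerDl|lra].
  rewrite mulrC -ler_pdivlMr//; apply: (@le_trans _ _ (e / (4 * (L + 1)))).
    by rewrite ge_min lexx orbT.
  by rewrite le_eqVlt invfM mulrA eqxx.
by move: h1 h2 h3 h4 e0; clear; lra.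
Qed.

Lemma pmean_dist_eps p F : 1 <= p -> disc_algebra F -> exists2 L : R, 0 <= L &
  forall (G : R[i] -> R[i]) r e, 0 <= r <= 1 -> 0 < e <= 1 ->
  continuous (fun t => G (circle r t) : R[i]^o) ->
  (forall t, normc (F (circle r t) - G (circle r t)) <= e) ->
  `|pmean p F r - pmean p G r| <= L * e.
Proof.
move=> p1 AF; have [M M0 HM] := disc_algebra_bounded AF.
exists (p * (M + 1) `^ (p - 1)); first by rewrite mulr_ge0 ?powR_ge0//; lra.
move=> G r e r01 /andP[e0 e1] cG FG; rewrite !pmeanE.
apply: (dist_mean_powR p1 (disc_algebra_continuous AF r01) cG) => t.
have c1 : normc (circle r t : R[i]) <= 1.
  by case/andP: r01 => r0 r1; rewrite normc_circle.
have h1 := HM _ c1; have h2 := FG t; split => //; first by move: h1; clear; lra.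
have := normcB (F (circle r t)) (F (circle r t) - G (circle r t)).
by rewrite subKr; move: h1 h2 e1; clear; lra.
Qed.

Lemma pmean1_le p F (K : R) : 1 <= p -> disc_algebra F ->
  (forall r, 0 < r < 1 -> pmean p F r <= K) -> pmean p F 1 <= K.
Proof.
move=> p1 AF FK; have [L L0 HL] := pmean_dist_eps p1 AF.
apply: (@le_linear_eps _ _ _ L) => // e /andP[e0 e1].
have [s0 /andP[s00 s01] hs] := disc_algebra_dilation_close AF e0.
pose s := (s0 + 1) / 2; have s1 : 0 < s < 1 by rewrite /s; lra.
have s01' : 0 <= s <= 1 by rewrite /s; lra.
have r1 : 0 <= (1 : R) <= 1 by rewrite lexx ler01.
have As := disc_algebra_dilation AF s01'.
have e01 : 0 < e <= 1 by rewrite e0.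
have := HL _ 1 e r1 e01 (disc_algebra_continuous As r1) _.
have cl t : normc (F (circle 1 t) - F (s%:C * circle 1 t)) <= e.
  rewrite -normcN opprB; apply: hs; last by rewrite normc_circle ?ler01.
  by rewrite /s; lra.
move=> /(_ cl); rewrite pmean_dilation mulr1 ler_norml => /andP[_ h].
by have := FK s s1; move: h; clear; lra.
Qed.

Variables (p : R) (p1 : 1 <= p).

Lemma eq_pmean F G r : 0 <= r < 1 -> (forall z, normc z < 1 -> F z = G z) ->
  pmean p F r = pmean p G r.
Proof.
move=> /andP[r0 r1] FG; rewrite !pmeanE; apply: eq_mean => t.
by rewrite FG// normc_circle.
Qed.

(** For such [F] the means increase with the radius and converge to the mean over the unit circle,
    which is thus the supremum in the Hardy norm. *)
Lemma hnorm_disc_algebra (h : hardy p1) F : disc_algebra F ->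
  (forall z, normc z < 1 -> val h z = F z) -> hnorm h `^ p = pmean p F 1.
Proof.
move=> AF hF; have p0 : 0 < p by rewrite (lt_le_trans ltr01).
have eqr r : 0 < r < 1 -> pmean p (val h) r = pmean p F r.
  by move=> /andP[r0 r1]; apply: eq_pmean => //; rewrite r1 ltW.
apply/eqP; rewrite eq_le; apply/andP; split; last first.
  by apply: pmean1_le => // r r01; rewrite -eqr//; exact: pmean_le_hnorm.
have m0 := pmean_ge0 p F 1.
have : hnorm h <= pmean p F 1 `^ p^-1.
  apply: hnorm_le; first exact: powR_ge0.
  move=> r r01; rewrite -powRrM mulVf ?gt_eqF// powRr1// eqr//.
  by apply: pmean_le1 => //; case/andP: r01 => r0 r1; rewrite !ltW.
move=> /(ge0_ler_powR (ltW p0) (hnorm_ge0 h) (powR_ge0 _ _)).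
by rewrite -powRrM mulVf ?gt_eqF// powRr1.
Qed.

Lemma pmean_mono_loc F r s : (forall u : R, 0 <= u < 1 -> disc_algebra (fun z => F (u%:C * z))) ->
  0 <= r <= s -> s < 1 -> pmean p F r <= pmean p F s.
Proof.
move=> AF /andP[r0 rs] s1; have [s0|s0] := eqVneq s 0.
  by have -> : r = s by lra.
have sp : 0 < s by rewrite lt_neqAle eq_sym s0 (le_trans r0).
have As := AF s ltac:(by rewrite s1 ltW).
have rs01 : 0 <= r / s <= 1.
  by rewrite divr_ge0 ?(ltW sp)//= ler_pdivrMr// mul1r.
have := pmean_le1 p1 As rs01.
by rewrite !pmean_dilation mulr1 mulrC divfK.
Qed.

End boundary_values.

(** * Uniform convexity and dilations *)

Section uniform_convexity.
Context {R : realType}.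
Implicit Types (a p e tau x y : R) (z w m d : R[i]).

Lemma parallelogram m d :
  normc (m + d) ^+ 2 + normc (m - d) ^+ 2 = 2 * (normc m ^+ 2 + normc d ^+ 2).
Proof. by rewrite !sqr_normcE; case: m => ? ?; case: d => ? ? /=; ring. Qed.

Lemma powR_superadd a x y : 1 <= a -> 0 <= x -> 0 <= y ->
  x `^ a + y `^ a <= (x + y) `^ a.
Proof.
move=> a1 x0 y0; have a0 : 0 < a by lra.
have xy0 : 0 <= x + y by exact: addr_ge0.
rewrite -(mulr_powRB1 x0 a0) -(mulr_powRB1 y0 a0) -(mulr_powRB1 xy0 a0) mulrDl.
apply: lerD; apply: ler_wpM2l => //.
  by apply: ge0_ler_powR; rewrite ?nnegrE ?lerDl//; lra.
by apply: ge0_ler_powR; rewrite ?nnegrE ?lerDr//; lra.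
Qed.

Lemma powR_subadd a x y : 0 < a <= 1 -> 0 < x -> 0 < y ->
  (x + y) `^ a <= x `^ a + y `^ a.
Proof.
move=> /andP[a0 a1] x0 y0; have xy0 : 0 < x + y by exact: addr_gt0.
rewrite -(mulr_powRB1 (ltW x0) a0) -(mulr_powRB1 (ltW y0) a0).
rewrite -(mulr_powRB1 (ltW xy0) a0) mulrDl; apply: lerD.
  by apply: ler_wpM2l; [exact: ltW|apply: ler_powRB1 => //; rewrite lerDl ltW].
by apply: ler_wpM2l; [exact: ltW|apply: ler_powRB1 => //; rewrite lerDr ltW].
Qed.

Lemma powR_midpoint a x y : 1 <= a -> 0 <= x -> 0 <= y ->
  ((x + y) / 2) `^ a <= (x `^ a + y `^ a) / 2.
Proof.
move=> a1 x0 y0; have m0 : 0 <= (x + y) / 2 by rewrite divr_ge0// addr_ge0.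
have := powR_tangent a1 m0 x0; have := powR_tangent a1 m0 y0.
set c := a * _; clear; lra.
Qed.

(** Clarkson's inequality: the parallelogram law, with superadditivity and midpoint convexity of the
    power [p / 2 >= 1]. *)
Lemma clarkson p m d : 2 <= p ->
  normc m `^ p + normc d `^ p <= (normc (m + d) `^ p + normc (m - d) `^ p) / 2.
Proof.
move=> p2; rewrite -!(@powR_half _ p) ?normc_ge0//.
have a1 : 1 <= p / 2 by lra.
apply: (le_trans (powR_superadd a1 (sqr_ge0 _) (sqr_ge0 _))).
apply: le_trans (powR_midpoint a1 (sqr_ge0 _) (sqr_ge0 _)).
by rewrite parallelogram mulrAC divff ?mul1r ?pnatr_eq0.
Qed.

(** Take [k] with [k^a = tau]. If [x <= k y] the first term suffices; otherwise
    [x^(a-1) <= (k y)^(a-1)], and the second one does. *)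
Lemma powR_young a tau : 0 < a <= 1 -> 0 < tau -> exists2 K : R, 0 <= K &
  forall x y, 0 <= x -> 0 < y -> x `^ a <= tau * y `^ a + K * (y `^ (a - 1) * x).
Proof.
move=> /andP[a0 a1] tau0; pose k := tau `^ a^-1.
have k0 : 0 < k by rewrite powR_gt0.
exists (k `^ (a - 1)) => [|x y x0 y0]; first exact: powR_ge0.
have ka : k `^ a = tau by rewrite -powRrM mulVf ?gt_eqF// powRr1// ltW.
have ky0 : 0 < k * y by exact: mulr_gt0.
have [xy|xy] := leP x (k * y).
  apply: (@le_trans _ _ (tau * y `^ a)).
    rewrite -ka -powRM ?(ltW k0) ?(ltW y0)//.
    by apply: ge0_ler_powR; rewrite ?nnegrE ?(ltW a0) ?(ltW ky0).
  by rewrite lerDl !mulr_ge0 ?powR_ge0.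
apply: (@le_trans _ _ (k `^ (a - 1) * (y `^ (a - 1) * x))); last first.
  by rewrite lerDr mulr_ge0 ?powR_ge0// ltW.
rewrite mulrA -powRM ?(ltW k0) ?(ltW y0)// -(mulr_powRB1 x0 a0) mulrC.
by rewrite ler_wpM2r//; apply: ler_powRB1 => //; exact: ltW.
Qed.

(** Adding [sqr_norm_powR_convex] for [d] and [- d] cancels the linear terms and leaves a gain of
    order [E^(a-1) |d|^2], where [E] is about [|m+d|^2 + |m-d|^2]. [powR_young] converts this
    weighted square into [|d|^p], at the price of the term with [tau]. *)
Lemma powR_uniform_convex_le2 p tau : 1 < p <= 2 -> 0 < tau ->
  exists2 C : R, 0 <= C & forall m d, normc d `^ p <=
    tau * (normc (m + d) `^ p + normc (m - d) `^ p)
    + C * ((normc (m + d) `^ p + normc (m - d) `^ p) / 2 - normc m `^ p).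
Proof.
move=> p12 tau0; pose a := p / 2.
have a12 : 1 / 2 < a <= 1 by rewrite /a; lra.
have a01 : 0 < a <= 1 by lra.
have [K K0 HK] := powR_young a01 tau0.
pose c := a * (2 * a - 1); have c0 : 0 < c by rewrite /c mulr_gt0//; lra.
exists (K / c) => [|m d]; first by rewrite divr_ge0// ltW.
rewrite -!(@powR_half _ p) ?normc_ge0// -/a.
set X := normc (m + d) ^+ 2; set Y := normc (m - d) ^+ 2.
set M := normc m ^+ 2; set D := normc d ^+ 2.
have X0 : 0 <= X := sqr_ge0 _; have Y0 : 0 <= Y := sqr_ge0 _.
have M0 : 0 <= M := sqr_ge0 _; have D0 : 0 <= D := sqr_ge0 _.
have par : X + Y = 2 * (M + D) := parallelogram m d.
have subadd x e : 0 <= x -> 0 < e -> (x + e) `^ a <= x `^ a + e `^ a.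
  rewrite le_eqVlt => /predU1P[<-|x0] e0; last exact: powR_subadd.
  by rewrite add0r powR0 ?add0r// gt_eqF//; case/andP: a01.
apply: (@le_linear_eps _ _ _ (tau + K / c + tau)).
  by rewrite addr_ge0 ?(ltW tau0)// addr_ge0 ?(ltW tau0)// divr_ge0// ltW.
move=> eta /andP[eta0 _].
pose e := eta `^ a^-1; have e0 : 0 < e by rewrite powR_gt0.
have ea : e `^ a = eta.
  rewrite -powRrM mulVf ?powRr1 ?(ltW eta0)// gt_eqF//.
  by case/andP: a01.
pose E := X + Y + e; have E0 : 0 < E by rewrite /E; lra.
have hE d' : normc d' = normc d -> forall t : R, 0 <= t <= 1 ->
    normc (m + t%:C * d') ^+ 2 + e <= E.
  move=> dd t /andP[t0 t1]; rewrite /E par lerD2r.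
  apply: (le_trans (sqr_normcD_le _ _)); rewrite mulrDr lerD2l ler_pM2l//.
  rewrite normcM normc_real ger0_norm// exprMn dd -/D ler_piMl//.
  by rewrite exprn_ile1.
have g1 := sqr_norm_powR_convex a12 e0 (hE d erefl).
have g2 := sqr_norm_powR_convex a12 e0 (hE (- d) (normcN d)).
have hm : K * (E `^ (a - 1) * D) <=
    K / c * (((X + e) `^ a + (Y + e) `^ a) / 2 - (M + e) `^ a).
  rewrite -[leRHS]mulrA ler_wpM2l// [leRHS]mulrC ler_pdivlMr//.
  move: g1 g2; rewrite -/X -/Y -/M -/c normcN -/D.
  have -> : complex.Re (m^* * - d) = - complex.Re (m^* * d).
    by case: (m) => ? ?; case: (d) => ? ? /=; ring.
  by clear; lra.
have hy := HK D E D0 E0.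
have sX := subadd X e X0 e0; have sY := subadd Y e Y0 e0; rewrite ea in sX sY.
have sE : E `^ a <= X `^ a + Y `^ a + eta.
  have XY0 : 0 <= X + Y by exact: addr_ge0.
  apply: (le_trans (subadd _ _ XY0 e0)); rewrite ea lerD2r.
  move: Y0; rewrite le_eqVlt => /predU1P[<-|Yp].
    by rewrite addr0 powR0 ?addr0// gt_eqF//; case/andP: a01.
  move: X0; rewrite le_eqVlt => /predU1P[<-|Xp].
    by rewrite add0r powR0 ?add0r// gt_eqF//; case/andP: a01.
  exact: powR_subadd.
have sM : M `^ a <= (M + e) `^ a.
  by apply: ge0_ler_powR; rewrite ?nnegrE ?addr_ge0 ?lerDl ?(ltW e0)//; case/andP: a01 => /ltW.
have Kc0 : 0 <= K / c by rewrite divr_ge0// ltW.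
have h1 : K / c * (((X + e) `^ a + (Y + e) `^ a) / 2 - (M + e) `^ a) <=
    K / c * ((X `^ a + Y `^ a) / 2 - M `^ a + eta).
  by apply: ler_wpM2l => //; move: sX sY sM; clear; lra.
have h2 := ler_wpM2l (ltW tau0) sE.
have te : 0 <= tau * eta by rewrite mulr_ge0// ltW.
apply: (le_trans hy); apply: (le_trans (lerD h2 (le_trans hm h1))).
by move: te; set k := K / c; clear; lra.
Qed.

(** Uniform convexity in a pointwise form, which can be integrated over a circle. The factor [2^p]
    in the proof comes from the half difference [d = (z - w) / 2]. *)
Lemma powR_uniform_convex p tau : 1 < p -> 0 < tau ->
  exists2 C : R, 0 <= C & forall z w, normc (z - w) `^ p <=
    tau * (normc z `^ p + normc w `^ p)
    + C * ((normc z `^ p + normc w `^ p) / 2 - normc ((z + w) / 2) `^ p).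
Proof.
move=> p1 tau0.
suff [C C0 HC] : exists2 C : R, 0 <= C & forall m d, normc d `^ p <=
    tau / 2 `^ p * (normc (m + d) `^ p + normc (m - d) `^ p)
    + C * ((normc (m + d) `^ p + normc (m - d) `^ p) / 2 - normc m `^ p).
  have t0 : 0 < 2 `^ p :> R by rewrite powR_gt0.
  exists (2 `^ p * C) => [|z w]; first by rewrite mulr_ge0// ltW.
  have := HC ((z + w) / 2) ((z - w) / 2).
  have -> : (z + w) / 2 + (z - w) / 2 = z by field.
  have -> : (z + w) / 2 - (z - w) / 2 = w by field.
  have n2 : normc (2 : R[i]) = 2 by rewrite normc_nat.
  have -> : normc ((z - w) / 2) `^ p = normc (z - w) `^ p / 2 `^ p.
    rewrite normcM normcV n2 powRM ?normc_ge0 ?invr_ge0//; congr (_ * _).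
    apply: (mulIf (lt0r_neq0 t0)).
    by rewrite mulVf ?gt_eqF// -powRM// mulVf ?powR1// pnatr_eq0.
  rewrite ler_pdivrMr// => h; apply: (le_trans h).
  set U := _ + normc w `^ p; set V := normc _ `^ p.
  rewrite mulrDl; apply: lerD.
    by rewrite mulrAC divfK// gt_eqF.
  by rewrite le_eqVlt; apply/orP; left; apply/eqP; ring.
have [p2|p2] := leP p 2.
  by apply: powR_uniform_convex_le2; [rewrite p1|rewrite divr_gt0// powR_gt0].
exists 1 => // m d; have := clarkson m d (ltW p2).
have : 0 <= tau / 2 `^ p * (normc (m + d) `^ p + normc (m - d) `^ p).
  by rewrite mulr_ge0 ?addr_ge0 ?powR_ge0// divr_ge0 ?powR_ge0// ltW.
by clear; lra.
Qed.

End uniform_convexity.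

(** * Convergence of dilations in the mean *)

Section dilation_density.
Context {R : realType}.
Variables (p : R) (p1 : 1 < p).

(* By monotonicity of the means, the midpoint of [f] and of a dilation of [f]
   has almost the norm of [f] on all circles close to the boundary; uniform
   convexity then forces their difference to be small. *)
Lemma dilation_pmean (f : R[i] -> R[i]) (K eta : R) :
  (forall u : R, 0 <= u < 1 -> disc_algebra (fun z => f (u%:C * z))) ->
  (forall r : R, 0 < r < 1 -> pmean p f r <= K) -> 0 < eta ->
  exists2 rho : R, 0 <= rho < 1 &
  forall r : R, 0 < r < 1 -> pmean p (fun z => f (rho%:C * z) - f z) r <= eta.
Proof.
move=> Af fK eta0; have p1' := ltW p1.
pose S := [set pmean p f r | r in [set r : R | 0 < r < 1]].
have half : 0 < (1 / 2 : R) < 1 by lra.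
have S0 : S (pmean p f (1 / 2)) by exists (1 / 2).
have supS : has_sup S.
  by split; [exists (pmean p f (1 / 2))|exists K => _ [r r01 <-]; exact: fK].
pose M := sup S.
have fM r : 0 < r < 1 -> pmean p f r <= M.
  by move=> r01; apply: sup_ubound; [case: supS|exists r].
have M0 : 0 <= M := le_trans (pmean_ge0 _ _ _) (fM _ half).
(* [tau], and [del] below, make each of the two terms of the convexity inequality at most
   [eta / 2]. *)
have tau0 : 0 < eta / (4 * (M + 1)) by rewrite divr_gt0// mulr_gt0//; lra.
have [C C0 HC] := powR_uniform_convex p1 tau0.
set tau := eta / _ in tau0 HC.
pose del := eta / (4 * (C + 1)).
have del0 : 0 < del by rewrite divr_gt0// mulr_gt0//; lra.
have [_ [r0 r001 <-] hr0] := sup_adherent del0 supS; rewrite -/M in hr0.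
have /andP[r00 r01] := r001; have r001' : 0 <= r0 < 1 by rewrite r01 ltW.
have [L L0 HL] := pmean_dist_eps p1' (Af r0 r001').
pose e := Num.min 1 (del / (L + 1)).
have e0 : 0 < e by rewrite lt_min ltr01 divr_gt0//; lra.
have e1 : 0 < e <= 1 by rewrite e0 ge_min lexx.
have Le : L * e <= del.
  apply: (@le_trans _ _ ((L + 1) * e)); first by rewrite ler_wpM2r ?lerDl// ltW.
  by rewrite mulrC -ler_pdivlMr; [rewrite ge_min lexx orbT|lra].
have e2 : 0 < e by [].
have [s0 /andP[s00 s01] hs] := disc_algebra_dilation_close (Af r0 r001') e2.
pose rho := (s0 + 1) / 2.
have rho01 : 0 <= rho < 1 by rewrite /rho; lra.
have rhop : 0 < rho < 1 by rewrite /rho; lra.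
exists rho => //.
pose g z := f (rho%:C * z).
have Ag (u : R) : 0 <= u < 1 -> disc_algebra (fun z => g (u%:C * z)).
  move=> /andP[u0 u1]; have ru : 0 <= u * rho < 1.
    by case/andP: rhop => h1 h2; rewrite mulr_ge0 ?(ltW h1)// mulr_ilt1// ltW.
  apply: (disc_algebra_ext (Af _ ru)) => z _.
  by rewrite /g rmorphM mulrA (mulrC u%:C).
have g_f r : 0 < r < 1 -> pmean p g r <= M.
  move=> /andP[h1 h2]; rewrite pmean_dilation; apply: fM.
  by case/andP: rhop => h3 h4; rewrite mulr_gt0//= mulr_ilt1// ltW.
have AB (u : R) : 0 <= u < 1 -> disc_algebra (fun z => g (u%:C * z) - f (u%:C * z)).
  by move=> u01; apply: disc_algebraB; [exact: Ag|exact: Af].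
have AD (u : R) : 0 <= u < 1 -> disc_algebra (fun z => (g (u%:C * z) + f (u%:C * z)) / 2).
  move=> u01; apply: disc_algebraM; last exact: disc_algebra_cst.
  by apply: disc_algebraD; [exact: Ag|exact: Af].
have circ (F : R[i] -> R[i]) r : (forall u : R, 0 <= u < 1 -> disc_algebra (fun z => F (u%:C * z))) ->
    0 <= r < 1 -> continuous (fun t => F (circle r t) : R[i]^o).
  move=> AF h; have one : 0 <= (1 : R) <= 1 by rewrite lexx ler01.
  have := disc_algebra_continuous (AF r h) one.
  by rewrite (_ : (fun t => F (r%:C * circle 1 t)) = (fun t => F (circle r t)))//;
    apply/funext => t; rewrite -circleE.
(* Radii below [r0] follow from [r0] itself, because the means of the difference also increase with
   the radius. *)
suff big r : r0 <= r < 1 -> pmean p (fun z => f (rho%:C * z) - f z) r <= eta.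
  move=> r /andP[h1 h2]; have [h|h] := leP r0 r; first by apply: big; rewrite h.
  apply: le_trans (big r0 _); last by rewrite lexx.
  by apply: (pmean_mono_loc p1' AB) => //; rewrite (ltW h1) (ltW h).
move=> /andP[h1 h2]; have rp : 0 < r < 1 by rewrite h2 (lt_le_trans r00).
have r0' : 0 <= r < 1 by rewrite h2 (le_trans (ltW r00)).
have cf := circ f r Af r0'; have cg := circ g r Ag r0'.
have cd := circ (fun z => (g z + f z) / 2) r AD r0'.
have cb := circ (fun z => g z - f z) r AB r0'.
have nf := continuous_norm_powR p1' cf; have ng := continuous_norm_powR p1' cg.
have nd := continuous_norm_powR p1' cd; have nb := continuous_norm_powR p1' cb.
have cs : continuous (fun t => normc (g (circle r t)) `^ p + normc (f (circle r t)) `^ p).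
  by move=> t; apply: cvgD; [exact: ng|exact: nf].
have cs2 : continuous (fun t => (normc (g (circle r t)) `^ p + normc (f (circle r t)) `^ p) / 2).
  by move=> t; apply: cvgM; [exact: cs|exact: cvg_cst].
have cs3 : continuous (fun t => (normc (g (circle r t)) `^ p + normc (f (circle r t)) `^ p) / 2
    - normc ((g (circle r t) + f (circle r t)) / 2) `^ p).
  by move=> t; apply: cvgB; [exact: cs2|exact: nd].
have cZ (k : R) (u : R -> R) : continuous u -> continuous (fun t => k * u t).
  by move=> cu t; apply: cvgM; [exact: cvg_cst|exact: cu].
have conv : pmean p (fun z => g z - f z) r <= tau * (pmean p g r + pmean p f r) +
    C * ((pmean p g r + pmean p f r) / 2 - pmean p (fun z => (g z + f z) / 2) r).
  rewrite !pmeanE -(meanD ng nf) -(meanZ tau cs).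
  rewrite [_ / 2]mulrC -(meanZ 2^-1 cs).
  have -> : mean (fun t => 2^-1 * (normc (g (circle r t)) `^ p + normc (f (circle r t)) `^ p)) =
    mean (fun t => (normc (g (circle r t)) `^ p + normc (f (circle r t)) `^ p) / 2).
    by apply: eq_mean => t; rewrite mulrC.
  rewrite -(meanB cs2 nd) -(meanZ C cs3) -(meanD (cZ tau _ cs) (cZ C _ cs3)).
  apply: (le_mean nb) => [|t]; last exact: HC.
  by move=> t; apply: cvgD; [exact: (cZ tau _ cs)|exact: (cZ C _ cs3)].
apply: (le_trans conv).
have mid : M - 2 * del <= pmean p (fun z => (g z + f z) / 2) r.
  have : pmean p (fun z => (g z + f z) / 2) r0 <= pmean p (fun z => (g z + f z) / 2) r.
    by apply: (pmean_mono_loc p1' AD) => //; rewrite (ltW r00).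
  apply: le_trans; have one : 0 <= (1 : R) <= 1 by rewrite lexx ler01.
  have one' : normc (0 : R[i]) <= 1 by rewrite normc0.
  have := HL (fun z => (g (r0%:C * z) + f (r0%:C * z)) / 2) 1 e one e1.
  rewrite (pmean_dilation p f) (pmean_dilation p (fun z => (g z + f z) / 2)) mulr1.
  move=> /(_ (disc_algebra_continuous (AD r0 r001') one)) h.
  have {}h : `|pmean p f r0 - pmean p (fun z => (g z + f z) / 2) r0| <= L * e.
    apply: h => t; set z := circle 1 t.
    have z1 : normc z <= 1 by rewrite normc_circle// ler01.
    have -> : f (r0%:C * z) - (g (r0%:C * z) + f (r0%:C * z)) / 2 =
       - ((g (r0%:C * z) - f (r0%:C * z)) / 2) by field.
    rewrite normcN normcM normcV normc_nat.
    have rr : s0 <= rho <= 1 by rewrite /rho; lra.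
    have := hs rho z rr z1; rewrite (mulrCA r0%:C) => hh.
    by have := normc_ge0 (f (rho%:C * (r0%:C * z)) - f (r0%:C * z)); move: hh; clear; lra.
  by move: h hr0 Le; rewrite ler_norml => /andP[_]; clear; lra.
have b1 := g_f r rp; have b2 := fM r rp.
have t1 : tau * (pmean p g r + pmean p f r) <= eta / 2.
  apply: (@le_trans _ _ (tau * (2 * (M + 1)))).
    by apply: ler_wpM2l; [exact: ltW|move: b1 b2; clear; lra].
  rewrite le_eqVlt; apply/orP; left; apply/eqP; rewrite /tau; field.
  by rewrite gt_eqF//; lra.
have t2 : C * ((pmean p g r + pmean p f r) / 2 - pmean p (fun z => (g z + f z) / 2) r) <= eta / 2.
  apply: (@le_trans _ _ ((C + 1) * (2 * del))).
    apply: (@le_trans _ _ (C * (2 * del))).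
      by apply: ler_wpM2l => //; move: b1 b2 mid; clear; lra.
    by rewrite ler_wpM2r ?lerDl// mulr_ge0// ltW.
  rewrite le_eqVlt; apply/orP; left; apply/eqP; rewrite /del; field.
  by rewrite gt_eqF//; lra.
by move: t1 t2; clear; lra.
Qed.

End dilation_density.

(** * Limits of polynomials *)

Section completeness.
Context {R : realType}.
Implicit Types (P Q : {poly R[i]}) (a z : R[i]) (p r e : R).

Lemma complex_cauchy (u : nat -> R[i]) :
  (forall e, 0 < e -> exists N, forall i j, (N <= i)%N -> (N <= j)%N ->
    normc (u i - u j) <= e) ->
  exists l, forall e, 0 < e -> exists N, forall i, (N <= i)%N -> normc (u i - l) <= e.
Proof.
move=> cu.
have real (v : nat -> R) : (forall e, 0 < e -> exists N, forall i j, (N <= i)%N -> (N <= j)%N ->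
    `|v i - v j| <= e) -> exists l, forall e, 0 < e -> exists N, forall i, (N <= i)%N ->
    `|v i - l| <= e.
  move=> cv; have : cvg (v @ \oo).
    apply/cauchy_cvgP; apply: cauchy_exP => e e0.
    have e20 : 0 < e / 2 by rewrite divr_gt0.
    have [N HN] := cv _ e20; exists (v N); exists N => // i /= Ni.
    rewrite /ball/=; apply: (le_lt_trans (HN _ _ (leqnn _) Ni)).
    by rewrite ltr_pdivrMr// mulr2n mulrDr mulr1 ltrDl.
  move=> /cvg_ex[l hl]; exists l => e e0.
  move/cvgrPdist_le : hl => /(_ e e0)[N _ HN]; exists N => i Ni.
  by rewrite distrC; exact: HN.
have [|x hx] := real (fun i => complex.Re (u i)).
  move=> e /cu[N HN]; exists N => i j Ni Nj; apply: le_trans (HN i j Ni Nj).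
  by apply: le_trans (normc_Re _); case: (u i) => ? ?; case: (u j).
have [|y hy] := real (fun i => complex.Im (u i)).
  move=> e /cu[N HN]; exists N => i j Ni Nj; apply: le_trans (HN i j Ni Nj).
  by apply: le_trans (normc_Im _); case: (u i) => ? ?; case: (u j).
exists (x +i* y) => e e0; have e20 : 0 < e / 2 by rewrite divr_gt0.
have [N1 H1] := hx _ e20; have [N2 H2] := hy _ e20.
exists (maxn N1 N2) => i; rewrite geq_max => /andP[i1 i2].
have -> : u i - (x +i* y) = (complex.Re (u i) - x)%:C + 'i * (complex.Im (u i) - y)%:C.
  by case: (u i) => ? ?; apply/eqP; rewrite eq_complex/=; apply/andP; split; apply/eqP; ring.
apply: (le_trans (normcD _ _)); rewrite normcM normc_i mul1r !normc_real.
by have := H1 i i1; have := H2 i i2; clear; lra.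
Qed.

Lemma powR_le_inv p (x A : R) : 0 < p -> 0 <= x -> 0 <= A -> x `^ p <= A -> x <= A `^ p^-1.
Proof.
move=> p0 x0 A0 xA; rewrite -[leLHS]powRr1// -(mulfV (lt0r_neq0 p0)) powRrM.
by apply: ge0_ler_powR; rewrite ?nnegrE ?powR_ge0// invr_ge0 ltW.
Qed.

Lemma continuous_norm_poly p P : 1 <= p ->
  continuous (fun t => normc P.[circle 1 t] `^ p).
Proof. by move=> p1; exact: (continuous_norm_powR p1 (@continuous_poly_circle R P 1)). Qed.

(** On the unit circle [normc (z - a) >= 1 - normc a], and [P.[a]] is controlled by [poly_eval_le];
    hence division by [z - a] is bounded in the mean, uniformly in [P]. *)
Lemma poly_quotient p a : 1 <= p -> normc a < 1 -> exists2 K : R, 0 <= K &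
  forall P, exists2 Q, P - P.[a]%:P = Q * ('X - a%:P) &
  pmean p (horner Q) 1 <= K * pmean p (horner P) 1.
Proof.
move=> p1 a1; have a0 := normc_ge0 a.
pose k := (1 - normc a)^-1 `^ p; have k0 : 0 <= k := powR_ge0 _ _.
exists (k * (2 `^ p * (1 + k))) => [|P].
  by rewrite mulr_ge0// mulr_ge0 ?powR_ge0// addr_ge0.
have [Q HQ] : exists Q, P - P.[a]%:P = Q * ('X - a%:P).
  by apply/factor_theorem; rewrite rootE hornerD hornerN hornerC subrr.
exists Q => //; have ev := poly_eval_le P p1 a1; rewrite -/k in ev.
have cP := @continuous_norm_poly p P p1; have cQ := @continuous_norm_poly p Q p1.
have cc : continuous (fun _ : R => normc P.[a] `^ p) by move=> t; exact: cvg_cst.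
have cs : continuous (fun t => normc P.[circle 1 t] `^ p + normc P.[a] `^ p).
  by move=> t; apply: cvgD; [exact: cP|exact: cc].
have cz : continuous (fun t => k * 2 `^ p * (normc P.[circle 1 t] `^ p + normc P.[a] `^ p)).
  by move=> t; apply: cvgM; [exact: cvg_cst|exact: cs].
apply: (@le_trans _ _ (k * 2 `^ p * (pmean p (horner P) 1 + normc P.[a] `^ p))).
  rewrite !pmeanE -[X in _ + X](mean_cst (normc P.[a] `^ p)) -(meanD cP cc) -(meanZ _ cs).
  apply: (le_mean cQ cz) => t; set z := circle 1 t.
  have z1 : normc z = 1 by rewrite normc_circle// ler01.
  have za : 1 - normc a <= normc (z - a).
    by have := normcD (z - a) a; rewrite subrK z1; lra.
  have za0 : z - a != 0 by rewrite -normc_gt0; move: za a1; clear; lra.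
  have -> : Q.[z] = (P.[z] - P.[a]) / (z - a).
    have /(congr1 (horner^~ z)) := HQ; rewrite hornerM hornerXsubC hornerD hornerN hornerC.
    by move=> ->; rewrite mulfK.
  rewrite normcM normcV powRM ?invr_ge0 ?normc_ge0// mulrC -mulrA; apply: ler_pM;
    rewrite ?powR_ge0//.
    apply: ge0_ler_powR; rewrite ?nnegrE ?invr_ge0 ?normc_ge0//; try by move: p1 a1; clear; lra.
    by rewrite lef_pV2 ?posrE//; move: za a1; clear; lra.
  apply: le_trans (powRD_le _ _ _); rewrite ?normc_ge0//; last by move: p1; clear; lra.
  apply: ge0_ler_powR; rewrite ?nnegrE ?addr_ge0 ?normc_ge0//; last exact: normcB.
  by move: p1; clear; lra.
rewrite -!mulrA ler_wpM2l// ler_wpM2l ?powR_ge0// mulrDl mul1r lerD2l.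
exact: ev.
Qed.

(** Two applications of [poly_quotient] write the Taylor remainder as [(z - a)^2 S], with [S]
    bounded by the mean of [P]. Being uniform in [P], the estimate survives limits of
    polynomials. *)
Lemma poly_taylor p a : 1 <= p -> normc a < 1 -> exists2 K : R, 0 <= K &
  forall P, normc P^`().[a] `^ p <= K * pmean p (horner P) 1 /\
  forall z, normc z <= (1 + normc a) / 2 ->
    normc (P.[z] - P.[a] - P^`().[a] * (z - a)) `^ p <=
    K * pmean p (horner P) 1 * (normc (z - a) ^+ 2) `^ p.
Proof.
move=> p1 a1; have a0 := normc_ge0 a; have [K K0 HK] := poly_quotient p1 a1.
pose k := (1 - normc a)^-1 `^ p; have k0 : 0 <= k := powR_ge0 _ _.
pose b := (1 + normc a) / 2; pose l := (1 - b)^-1 `^ p.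
have b1 : b < 1 by rewrite /b; lra.
have l0 : 0 <= l := powR_ge0 _ _.
exists (k * K + l * (K * K)) => [|P]; first by rewrite addr_ge0 ?mulr_ge0.
have m0 := pmean_ge0 p (horner P) 1.
have [Q HQ mQ] := HK P; have [S HS mS] := HK Q.
have dQ : P^`().[a] = Q.[a].
  have := congr1 (fun q => q^`().[a]) HQ.
  rewrite derivB derivC subr0 derivM derivB derivX derivC subr0 mulr1 hornerD.
  by rewrite hornerM hornerXsubC subrr mulr0 add0r.
rewrite dQ; split.
  apply: (le_trans (poly_eval_le Q p1 a1)); rewrite -/k.
  apply: (le_trans (ler_wpM2l k0 mQ)); rewrite [k * (_ * _)]mulrA; apply: ler_wpM2r => //.
  by rewrite lerDl mulr_ge0// mulr_ge0.
move=> z zb; have z1 : normc z < 1 by exact: le_lt_trans zb b1.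
have -> : P.[z] - P.[a] - Q.[a] * (z - a) = (z - a) ^+ 2 * S.[z].
  have /(congr1 (horner^~ z)) := HQ; rewrite hornerM hornerXsubC hornerD hornerN hornerC => ->.
  have /(congr1 (horner^~ z)) := HS; rewrite hornerM hornerXsubC hornerD hornerN hornerC => E.
  by rewrite -mulrBl E; ring.
rewrite normcM normcX powRM ?exprn_ge0 ?normc_ge0// mulrC; apply: ler_wpM2r; first exact: powR_ge0.
apply: (le_trans (poly_eval_le S p1 z1)).
apply: (@le_trans _ _ (l * (K * (K * pmean p (horner P) 1)))).
  apply: ler_pM; rewrite ?powR_ge0 ?pmean_ge0//.
    apply: ge0_ler_powR; rewrite ?nnegrE ?invr_ge0 ?subr_ge0 ?(ltW z1) ?(ltW b1)//.
      by move: p1; clear; lra.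
    by rewrite lef_pV2 ?posrE ?subr_gt0// lerD2l lerN2.
  by apply: (le_trans mS); rewrite ler_wpM2l.
have -> : l * (K * (K * pmean p (horner P) 1)) = l * (K * K) * pmean p (horner P) 1 by ring.
by apply: ler_wpM2r => //; rewrite lerDr mulr_ge0.
Qed.

Lemma powR_le_cancel p (x y : R) : 0 < p -> 0 <= x -> 0 <= y -> x `^ p <= y `^ p -> x <= y.
Proof.
move=> p0 x0 y0 /(powR_le_inv p0 x0 (powR_ge0 _ _)).
by rewrite -powRrM mulfV ?gt_eqF// powRr1.
Qed.

Lemma derivable_quadratic (f : R[i]^o -> R[i]^o) a (d : R[i]) (L del : R) : 0 <= L -> 0 < del ->
  (forall z, normc (z - a) <= del -> normc (f z - f a - d * (z - a)) <= L * normc (z - a) ^+ 2) ->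
  derivable f a 1.
Proof.
move=> L0 del0 H; apply/cvg_ex; exists d; apply/cvgrPdist_le => e' e'0.
have [e e0 ->] : exists2 e : R, 0 < e & e' = e%:C.
  case: e' e'0 => x y; rewrite ltcE/= => /andP[/eqP y0 x0].
  by exists x => //; rewrite y0.
have L1 : 0 < L + 1 by rewrite ltr_wpDl.
have d0 : 0 < Num.min del (e / (L + 1)) by rewrite lt_min del0 divr_gt0.
apply/nbhs_ballP; exists (Num.min del (e / (L + 1)))%:C; first by rewrite /= ltr0c.
move=> h; rewrite /ball/= sub0r normrN normCE (ltcR _ (Num.min _ _)) lt_min => /andP[hd he] h0.
have h0' : 0 < normc h by rewrite normc_gt0.
rewrite normCE lecR /GRing.scale/= mulr1.
have := H (h + a); rewrite addrK => /(_ (ltW hd)).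
set X := _ - _ - _ => HX.
have -> : d - h^-1 * (f (h + a) - f a) = - (X / h) by rewrite /X; field.
rewrite -[- _]mulN1r !(normcM, normcV) normcN normc1 mul1r.
apply: (@le_trans _ _ (L * normc h)).
  by rewrite ler_pdivrMr// -mulrA -expr2.
move: he; rewrite ltr_pdivlMr// mulrDr mulr1 mulrC.
by move: h0'; clear; lra.
Qed.

Lemma continuousD_complex (f g : R -> R[i]^o) : continuous f -> continuous g ->
  continuous (fun t => f t + g t : R[i]^o).
Proof. by move=> cf cg t; exact: (@cvgD R[i] R[i]^o _ _ _ f g _ _ (cf t) (cg t)). Qed.

Lemma continuousB_complex (f g : R -> R[i]^o) : continuous f -> continuous g ->
  continuous (fun t => f t - g t : R[i]^o).
Proof. by move=> cf cg t; exact: (@cvgB R[i] R[i]^o _ _ _ f g _ _ (cf t) (cg t)). Qed.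

(** A substitute for Minkowski's inequality at the level of [p]-th powers; the constant [2^p] is
    affordable, since only smallness matters. *)
Lemma pmeanD_le p (F G : R[i] -> R[i]) r : 1 <= p ->
  continuous (fun t => F (circle r t) : R[i]^o) ->
  continuous (fun t => G (circle r t) : R[i]^o) ->
  pmean p (fun z => F z + G z) r <= 2 `^ p * (pmean p F r + pmean p G r).
Proof.
move=> p1 cF cG; have p0 : 0 <= p by apply: le_trans p1.
have cFG : continuous (fun t => F (circle r t) + G (circle r t) : R[i]^o).
  exact: continuousD_complex cF cG.
have nF := continuous_norm_powR p1 cF; have nG := continuous_norm_powR p1 cG.
have nS : continuous (fun t => normc (F (circle r t)) `^ p + normc (G (circle r t)) `^ p).
  by move=> t; apply: cvgD; [exact: nF|exact: nG].
rewrite !pmeanE -(meanD nF nG) -(meanZ _ nS).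
apply: (le_mean (continuous_norm_powR p1 cFG)) => [t|t].
  by apply: cvgM; [exact: cvg_cst|exact: nS].
apply: (@le_trans _ _ ((normc (F (circle r t)) + normc (G (circle r t))) `^ p)); last first.
  by apply: powRD_le; rewrite ?normc_ge0.
by apply: ge0_ler_powR; rewrite ?nnegrE ?addr_ge0 ?normc_ge0//; exact: normcD.
Qed.

Lemma analytic_circle_continuous (f : R[i]^o -> R[i]^o) r : analytic_on_disc f ->
  0 <= r < 1 -> continuous (fun t => f (circle r t) : R[i]^o).
Proof.
move=> fa /andP[r0 r1] t.
apply: (@continuous_comp _ R[i]^o _ (circle r) f); first exact: continuous_circle.
by apply/differentiable_continuous/derivable1_diffP/fa; rewrite normc_circle.
Qed.

(** It serves both for evaluations at all points of a smaller disc and for the derivative at one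
    point; the index [u] carries the uniformity. *)
Lemma bounded_functional_cauchy p (P : nat -> {poly R[i]}) (T : Type) (A : T -> Prop)
    (phi : T -> {poly R[i]} -> R[i]) (K : R) :
  0 < p -> 0 <= K -> (forall e, 0 < e -> exists N, forall i j, (N <= i)%N -> (N <= j)%N ->
    pmean p (horner (P i - P j)) 1 <= e) ->
  (forall (u : T) Q S, phi u (Q - S) = phi u Q - phi u S) ->
  (forall (u : T) Q, A u -> normc (phi u Q) `^ p <= K * pmean p (horner Q) 1) ->
  forall e, 0 < e -> exists N, forall u : T, A u -> forall i j, (N <= i)%N -> (N <= j)%N ->
  normc (phi u (P i) - phi u (P j)) <= e.
Proof.
move=> p0 K0 cauchyP lin bd e e0; have K1 : 0 < K + 1 by rewrite ltr_wpDl.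
have ep : 0 < e `^ p / (K + 1) by rewrite divr_gt0// powR_gt0.
have [N HN] := cauchyP _ ep; exists N => z Az i j Ni Nj.
apply: (powR_le_cancel p0 (normc_ge0 _) (ltW e0)); rewrite -lin.
apply: (le_trans (bd _ _ Az)); apply: (le_trans (ler_wpM2l K0 (HN i j Ni Nj))).
rewrite mulrCA ler_piMr ?powR_ge0// ler_pdivrMr// mul1r lerDl.
exact: ler01.
Qed.

(** Completeness of [H^p] along polynomials. Bounded evaluations give locally uniform convergence,
    the uniform Taylor estimate gives differentiability of the limit, and the mean over a fixed
    circle passes to the limit. *)
Lemma hardy_limit p (p1 : 1 <= p) (P : nat -> {poly R[i]}) :
  (forall e, 0 < e -> exists N, forall i j, (N <= i)%N -> (N <= j)%N ->
    pmean p (horner (P i - P j)) 1 <= e) ->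
  exists h : hardy p1, forall e, 0 < e -> exists N, forall k, (N <= k)%N ->
  forall r, 0 < r < 1 -> pmean p (fun z => (P k).[z] - val h z) r <= e.
Proof.
move=> cauchyP; have p0 : 0 < p := lt_le_trans ltr01 p1.
have unif r : 0 <= r < 1 -> forall e, 0 < e -> exists N, forall z, normc z <= r ->
    forall i j, (N <= i)%N -> (N <= j)%N -> normc ((P i).[z] - (P j).[z]) <= e.
  move=> /andP[r0 r1].
  apply: (@bounded_functional_cauchy p P _ (fun z => normc z <= r) (fun z Q => Q.[z]) ((1 - r)^-1 `^ p)) => //.
  - exact: powR_ge0.
  - by move=> z Q S; rewrite hornerD hornerN.
  - move=> z Q zr; have z1 : normc z < 1 := le_lt_trans zr r1.
    apply: (le_trans (poly_eval_le Q p1 z1)); apply: ler_wpM2r; first exact: pmean_ge0.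
    apply: ge0_ler_powR; rewrite ?nnegrE ?invr_ge0 ?subr_ge0 ?(ltW z1) ?(ltW r1) ?(ltW p0)//.
    by rewrite lef_pV2 ?posrE ?subr_gt0// lerD2l lerN2.
(* The limit is set to [0] off the open disc, as membership in [hardy_pred] demands. *)
have lim z : exists l, if normc z < 1 then
    forall e, 0 < e -> exists N, forall i, (N <= i)%N -> normc ((P i).[z] - l) <= e else l = 0.
  case: (boolP (normc z < 1)) => z1; last by exists 0.
  apply: complex_cauchy => e e0; have zz : 0 <= normc z < 1 by rewrite normc_ge0 z1.
  have [N HN] := unif (normc z) zz e e0.
  by exists N; exact: HN.
have {lim} [y hy] := choice lim.
have y0 z : 1 <= normc z -> y z = 0 by move=> z1; have := hy z; rewrite ltNge z1.
have yunif r : 0 <= r < 1 -> forall e, 0 < e -> exists N, forall z, normc z <= r ->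
    forall i, (N <= i)%N -> normc ((P i).[z] - y z) <= e.
  move=> r01 e e0; have e20 : 0 < e / 2 by rewrite divr_gt0.
  have [N HN] := unif r r01 _ e20; exists N => z zr i Ni.
  have z1 : normc z < 1 by apply: (le_lt_trans zr); case/andP: r01.
  have := hy z; rewrite z1 => /(_ _ e20)[M HM].
  have h1 := HN z zr i (maxn N M) Ni (leq_maxl _ _); have h2 := HM _ (leq_maxr N M).
  have := normcD ((P i).[z] - (P (maxn N M)).[z]) ((P (maxn N M)).[z] - y z).
  by rewrite addrA subrK; move: h1 h2; clear; lra.
have an : analytic_on_disc y.
  move=> a a1; have [K K0 HK] := poly_taylor p1 a1.
  have a0 := normc_ge0 a; pose b := (1 + normc a) / 2.
  have b01 : 0 <= b < 1 by rewrite /b; apply/andP; split; lra.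
  have ab : normc a <= b by rewrite /b; lra.
  have [d hd] : exists d, forall e, 0 < e -> exists N, forall i, (N <= i)%N ->
      normc ((P i)^`().[a] - d) <= e.
    apply: complex_cauchy => e e0.
    have [||N HN] := @bounded_functional_cauchy p P unit xpredT (fun _ Q => Q^`().[a]) K p0 K0 cauchyP _ _ e e0.
    - by move=> _ Q S; rewrite derivB hornerD hornerN.
    - by move=> _ Q _; have [] := HK Q.
    - by exists N; exact: (HN tt isT).
  have [N HN] := cauchyP _ ltr01.
  pose m := pmean p (horner (P N)) 1; have m0 : 0 <= m := pmean_ge0 _ _ _.
  (* [P i] is split as [P N + (P i - P N)], where the second summand has mean at most [1] for all
     large [i]; this makes the quadratic bound independent of [i]. *)
  pose L := (K * m) `^ p^-1 + K `^ p^-1.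
  have taylor Q (c : R) z : 0 <= c -> pmean p (horner Q) 1 <= c -> normc z <= b ->
      normc (Q.[z] - Q.[a] - Q^`().[a] * (z - a)) <= (K * c) `^ p^-1 * normc (z - a) ^+ 2.
    move=> c0 Qc zb; have s0 : 0 <= normc (z - a) ^+ 2 by rewrite exprn_ge0 ?normc_ge0.
    apply: (powR_le_cancel p0 (normc_ge0 _)); first by rewrite mulr_ge0 ?powR_ge0.
    rewrite powRM ?powR_ge0// -powRrM mulVf ?gt_eqF// powRr1 ?mulr_ge0//.
    have [_ /(_ z zb) h] := HK Q; apply: (le_trans h).
    by apply: ler_wpM2r; [exact: powR_ge0|exact: ler_wpM2l].
  apply: (@derivable_quadratic _ _ d L ((1 - normc a) / 2)).
  - by rewrite addr_ge0 ?powR_ge0.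
  - by rewrite divr_gt0 ?subr_gt0.
  move=> z za; have zb : normc z <= b.
    by have := normcD (z - a) a; rewrite subrK /b; move: za; clear; lra.
  apply: (@le_linear_eps _ _ _ (2 + normc (z - a))); first by rewrite addr_ge0 ?normc_ge0.
  move=> e /andP[e0 _]; have [N1 H1] := yunif b b01 e e0; have [N2 H2] := hd e e0.
  pose i := maxn N (maxn N1 N2).
  have hz := H1 z zb i ltac:(by rewrite /i leq_max leq_max leqnn orbT).
  have ha := H1 a ab i ltac:(by rewrite /i leq_max leq_max leqnn orbT).
  have hdi := H2 i ltac:(by rewrite /i leq_max leq_max leqnn !orbT).
  have t1 := taylor (P N) m z m0 (lexx _) zb.
  have t2 := taylor (P i - P N) 1 z ler01 (HN _ _ (leq_maxl _ _) (leqnn _)) zb.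
  rewrite mulr1 derivB !hornerD !hornerN in t2.
  have n0 := normc_ge0 (z - a).
  set s := normc (z - a) in n0 t1 t2 *; rewrite /L.
  have -> : y z - y a - d * (z - a) =
     ((P N).[z] - (P N).[a] - (P N)^`().[a] * (z - a)) +
     ((P i).[z] - (P N).[z] - ((P i).[a] - (P N).[a])
        - ((P i)^`().[a] - (P N)^`().[a]) * (z - a)) +
     (- ((P i).[z] - y z) + ((P i).[a] - y a) + ((P i)^`().[a] - d) * (z - a)) by ring.
  rewrite [(_ + K `^ _) * _]mulrDl; apply: (le_trans (normcD _ _)); apply: lerD.
    by apply: (le_trans (normcD _ _)); exact: lerD t1 t2.
  apply: (le_trans (normcD _ _)); apply: (@le_trans _ _ (e + e + e * s)).
    apply: lerD; first by apply: (le_trans (normcD _ _)); rewrite normcN; exact: lerD hz ha.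
    by rewrite normcM; exact: ler_wpM2r n0 _ _ hdi.
  by move: n0 e0; clear; lra.
have yA k r : 0 <= r < 1 -> disc_algebra (fun z => (P k).[r%:C * z] - y (r%:C * z)).
  move=> /andP[r0 r1]; apply: disc_algebraB.
    by apply: (disc_algebra_dilation (disc_algebra_poly (P k))); rewrite r0 ltW.
  by apply: analytic_disc_algebra => //; rewrite r0.
have close e : 0 < e -> exists N, forall k, (N <= k)%N ->
    forall r, 0 < r < 1 -> pmean p (fun z => (P k).[z] - y z) r <= e.
  move=> e0; have [N HN] := cauchyP _ e0; exists N => k Nk r /andP[r0 r1].
  have r01 : 0 <= r < 1 by rewrite ltW.
  have [L L0 HL] := pmean_dist_eps p1 (yA k r r01).
  have eq1 : pmean p (fun z => (P k).[z] - y z) r =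
      pmean p (fun z => (P k).[r%:C * z] - y (r%:C * z)) 1.
    by rewrite (pmean_dilation p (fun z => (P k).[z] - y z)) mulr1.
  rewrite eq1; apply: (@le_linear_eps _ _ _ L) => // eta e01.
  have [N2 H2] := yunif r r01 eta ltac:(by case/andP: e01).
  pose i := maxn N N2.
  have one : 0 <= (1 : R) <= 1 by rewrite lexx ler01.
  have rr : 0 <= r <= 1 by rewrite !ltW.
  have A1 : disc_algebra (horner (P k - P i)) by exact: disc_algebra_poly.
  have A2 := disc_algebra_dilation A1 rr.
  have cl t : normc ((P k).[r%:C * circle 1 t] - y (r%:C * circle 1 t)
      - (P k - P i).[r%:C * circle 1 t]) <= eta.
    rewrite hornerD hornerN.
    have -> (x u v : R[i]) : x - u - (x - v) = v - u by ring.
    apply: H2; last exact: leq_maxr.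
    by rewrite normcM normc_real normc_circle ?ler01// mulr1 (ger0_norm (ltW r0)).
  have := HL _ 1 eta one e01 (disc_algebra_continuous A2 one) cl.
  rewrite (pmean_dilation p (horner (P k - P i))) mulr1 ler_norml => /andP[_].
  have := pmean_le1 p1 A1 rr; have := HN k i Nk (leq_maxl _ _).
  by clear; lra.
have fin : y \in hardy_pred p1.
  rewrite inE; split => //; have [N /(_ N (leqnn _)) HN] := close 1 ltr01.
  pose B := 2 `^ p * (1 + pmean p (horner (P N)) 1).
  apply: (@le_lt_trans _ _ (B `^ p^-1)%:E); last by rewrite ltry.
  rewrite unlock; apply: ge_ereal_sup => _ [r /= r01 <-].
  have {}r01 : 0 < r < 1 by move: r01; rewrite in_itv.
  rewrite (integral_mean_pmean p1 an r01) lee_fin.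
  apply: ge0_ler_powR; rewrite ?nnegrE ?invr_ge0 ?pmean_ge0 ?(ltW p0)//.
    by rewrite mulr_ge0 ?powR_ge0// addr_ge0 ?pmean_ge0.
  have /andP[r0 r1] := r01; have rr : 0 <= r < 1 by rewrite ltW.
  have cy := analytic_circle_continuous an rr.
  have cP : continuous (fun t => (P N).[circle r t] : R[i]^o) by exact: continuous_poly_circle.
  have cS : continuous (fun t => y (circle r t) - (P N).[circle r t] : R[i]^o).
    exact: continuousB_complex cy cP.
  have := @pmeanD_le p (fun z => y z - (P N).[z]) (horner (P N)) r p1 cS cP.
  have -> : (fun z => y z - (P N).[z] + (P N).[z]) = y by apply/funext => z; rewrite subrK.
  move=> h; apply: (le_trans h); apply: ler_wpM2l; first exact: powR_ge0.
  apply: lerD.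
    apply: le_trans (HN r r01); rewrite le_eqVlt; apply/orP; left; apply/eqP.
    by rewrite !pmeanE; apply: eq_mean => t; rewrite -normcN opprB.
  by apply: (pmean_le1 p1 (disc_algebra_poly _)); rewrite !ltW.
by exists (Hardy fin).
Qed.

End completeness.

(** * Finite Blaschke sums *)

Section blaschke_sums.
Context {R : realType}.
Implicit Types (lam : nat -> R[i]) (a d : nat -> R[i]) (z w u : R[i]) (p delta e : R) (m n k N : nat).

Lemma disc_algebraZ (c : R[i]) (F : R[i] -> R[i]) : disc_algebra F ->
  disc_algebra (fun z => c * F z).
Proof. by move=> AF; apply: disc_algebraM => //; exact: disc_algebra_cst. Qed.

Lemma normc_blaschke_factor w z : normc w < 1 -> normc z = 1 ->
  normc (blaschke_factor w z) = 1.
Proof.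
move=> w1 z1.
have zz : z * z^* = 1 by rewrite -sqr_normcJ z1 expr1n.
have zJ : normc z^* = 1 by rewrite Defs.normcJ.
have D : normc (1 - w^* * z) = normc (w - z).
  have -> : 1 - w^* * z = z * (w - z)^* * -1 by rewrite conjcB mulrBr zz; ring.
  by rewrite !normcM Defs.normcJ z1 mul1r normcN normc1 mulr1.
have D0 : 0 < normc (1 - w^* * z).
  by apply: (lt_le_trans _ (geom_denom _ _)); rewrite ?Defs.normcJ ?z1// subr_gt0.
rewrite /blaschke_factor normcM normcV -D divff// gt_eqF//.
Qed.

(** [B_k] is [bprod lam 1 k.+1]; other lower indices are needed for quotients [B_k / B_n]. Unlike
    [blaschke] it is not cut off at the unit circle, where its modulus is [1]. *)
Definition bprod lam m n z : R[i] := \prod_(m <= k < n) blaschke_factor (lam k) z.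

Definition bsum lam a n z : R[i] := \sum_(0 <= k < n) a k * bprod lam 1 k.+1 z.

Definition in_disc lam := forall k, (1 <= k)%N -> normc (lam k) < 1.

Lemma disc_algebra_bprod lam m n : in_disc lam -> (0 < m)%N -> disc_algebra (bprod lam m n).
Proof.
move=> lam1 m0; apply: disc_algebra_prod => k; rewrite mem_index_iota => /andP[mk _].
by apply: disc_algebra_blaschke_factor; apply: lam1; exact: leq_trans mk.
Qed.

Lemma disc_algebra_bsum lam a n : in_disc lam -> disc_algebra (bsum lam a n).
Proof.
by move=> lam1; apply: disc_algebra_sum => k; apply: disc_algebraZ; exact: disc_algebra_bprod.
Qed.

Lemma bprod_cat lam m n k z : (m <= n)%N -> (n <= k)%N ->
  bprod lam m k z = bprod lam m n z * bprod lam n k z.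
Proof. by move=> mn nk; rewrite /bprod (big_cat_nat mn nk). Qed.

Lemma bprodS lam n z : (0 < n)%N -> bprod lam 1 n.+1 z = bprod lam 1 n z * blaschke_factor (lam n) z.
Proof. by move=> n0; rewrite /bprod big_nat_recr. Qed.

Lemma normc_bprod lam m n z : in_disc lam -> (0 < m)%N -> normc z = 1 ->
  normc (bprod lam m n z) = 1.
Proof.
move=> lam1 m0 z1; rewrite /bprod big_nat_cond.
apply: (big_ind (fun w => normc w = 1)) => [|x y x1 y1|k /andP[/andP[mk _] _]].
- exact: normc1.
- by rewrite normcM x1 y1 mulr1.
- by apply: normc_blaschke_factor => //; apply: lam1; exact: leq_trans mk.
Qed.

Lemma blaschke_factor_diag w : blaschke_factor w w = 0.
Proof. by rewrite /blaschke_factor subrr mul0r. Qed.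

(* On the circle multiplication by the unimodular [conj B_n] turns the sum into
   [g + conj Z], where [Z] carries the [n] first terms and vanishes at [lam n];
   the Riesz projection bounds [Z] up to its constant term, which is recovered
   from that zero. *)
Lemma bsum_le p delta : 1 < p -> delta < 1 -> exists2 C : R, 0 <= C &
  forall lam a n N, in_disc lam -> ((0 < n)%N -> normc (lam n) <= delta) -> (n <= N)%N ->
  pmean p (bsum lam a n) 1 <= C * pmean p (bsum lam a N) 1.
Proof.
move=> p1 d1; have [C C0 HC] := disc_algebra_riesz p1; have p1' := ltW p1.
pose k := (1 - delta)^-1 `^ p; have k0 : 0 <= k := powR_ge0 _ _.
exists (2 `^ p * (1 + k) * C) => [|lam a n N lam1 ln nN].
  by rewrite mulr_ge0// mulr_ge0 ?powR_ge0// addr_ge0.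
have T0 := pmean_ge0 p (bsum lam a N) 1.
have [n0|n0] := posnP n.
  rewrite n0 pmeanE (_ : mean _ = 0).
    by rewrite mulr_ge0// mulr_ge0// mulr_ge0 ?powR_ge0// addr_ge0.
  rewrite -[RHS](mean_cst 0); apply: eq_mean => t.
  by rewrite /bsum big_geq// normc0 powR0// gt_eqF// (lt_trans ltr01).
(* On the circle [conj B_n = 1 / B_n]: the terms with [k >= n] contribute the products [B_k / B_n],
   and those with [k < n] the conjugates of [B_n / B_k], each of which contains the factor that
   vanishes at [lam n]. *)
pose g z := \sum_(n <= k < N) a k * bprod lam n.+1 k.+1 z.
pose Z z := \sum_(0 <= k < n) (a k)^* * bprod lam k.+1 n.+1 z.
have Ag : disc_algebra g.
  by apply: disc_algebra_sum => j; apply: disc_algebraZ; exact: disc_algebra_bprod.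
have AZ : disc_algebra Z.
  by apply: disc_algebra_sum => j; apply: disc_algebraZ; exact: disc_algebra_bprod.
have Zl : Z (lam n) = 0.
  rewrite /Z big_nat_cond big1// => j /andP[/andP[_ jn] _].
  by rewrite /bprod big_nat_recr//= blaschke_factor_diag !mulr0.
(* The constant [Z 0] moves to the analytic part, because the Riesz inequality needs a conjugate
   part that vanishes at [0]. *)
pose g' z := g z + (Z 0)^*; pose Z' z := Z z - Z 0.
have Ag' : disc_algebra g' by apply: disc_algebraD => //; exact: disc_algebra_cst.
have AZ' : disc_algebra Z' by apply: disc_algebraB => //; exact: disc_algebra_cst.
have unim j i z : (0 < j)%N -> normc z = 1 -> bprod lam j i z * (bprod lam j i z)^* = 1.
  by move=> j0 z1; rewrite -sqr_normcJ normc_bprod// expr1n.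
have SE z : normc z = 1 -> bsum lam a n z = bprod lam 1 n.+1 z * (Z z)^*.
  move=> z1; rewrite /bsum /Z (big_morph conjc conjcD (conjc0 _)) big_distrr/=.
  apply: eq_big_nat => j /andP[_ jn].
  rewrite conjcM conjcK (@bprod_cat lam 1 j.+1 n.+1)//; last by rewrite ltnS ltnW.
  rewrite mulrACA [X in _ = X * _]mulrC -mulrA; congr (_ * _).
  by rewrite [bprod lam j.+1 _ z * _]unim// mulr1.
have TE z : normc z = 1 -> bsum lam a N z = bprod lam 1 n.+1 z * (g z + (Z z)^*).
  move=> z1; rewrite /bsum (big_cat_nat (leq0n n) nN)/= mulrDr -SE// addrC; congr (_ + _).
  rewrite /g big_distrr/=; apply: eq_big_nat => j /andP[nj _].
  by rewrite (@bprod_cat lam 1 n.+1 j.+1)// mulrCA.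
have c1 t : normc (circle 1 t : R[i]) = 1 by rewrite normc_circle// ler01.
have hT : hmean p g' Z' = pmean p (bsum lam a N) 1.
  rewrite pmeanE hmeanE; apply: eq_mean => t; rewrite TE// normcM normc_bprod// mul1r.
  by rewrite /g' /Z' conjcB addrACA subrr addr0.
have hS : pmean p (bsum lam a n) 1 = pmean p Z 1.
  by rewrite !pmeanE; apply: eq_mean => t; rewrite SE// normcM normc_bprod// mul1r Defs.normcJ.
have Z'0 : Z' 0 = 0 by rewrite /Z' subrr.
have := HC g' Z' Ag' AZ' Z'0; rewrite hT.
have := pmean_ge0 p g' 1 => g0 hR.
have mZ' : pmean p Z' 1 <= C * pmean p (bsum lam a N) 1 by move: g0 hR; clear; lra.
have ln1 : normc (lam n) < 1 := lam1 _ n0.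
(* At [lam n] the function [Z'] takes the value [- Z 0], which evaluation bounds by the mean of
   [Z']. *)
have hZ0 : normc (Z 0) `^ p <= k * pmean p Z' 1.
  have := disc_algebra_eval p1' AZ' ln1; rewrite {1}/Z' Zl sub0r normcN => h.
  apply: (le_trans h); apply: ler_wpM2r; first exact: pmean_ge0.
  apply: ge0_ler_powR; rewrite ?nnegrE ?invr_ge0 ?subr_ge0 ?(ltW ln1) ?(ltW d1)//.
    by move: p1; clear; lra.
  by rewrite lef_pV2 ?posrE ?subr_gt0// lerD2l lerN2 ln.
have one : 0 <= (1 : R) <= 1 by rewrite lexx ler01.
have A0 := disc_algebra_cst (Z 0).
have := pmeanD_le p1' (disc_algebra_continuous AZ' one) (disc_algebra_continuous A0 one).
have -> : (fun z => Z' z + Z 0) = Z by apply/funext => z; rewrite /Z' subrK.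
have -> : pmean p (fun=> Z 0) 1 = normc (Z 0) `^ p.
  by rewrite pmeanE; exact: mean_cst.
rewrite hS => h; apply: (le_trans h); rewrite -!mulrA; apply: ler_wpM2l; first exact: powR_ge0.
apply: (@le_trans _ _ ((1 + k) * pmean p Z' 1)); last first.
  by apply: ler_wpM2l => //; rewrite addr_ge0.
by rewrite mulrDl mul1r; apply: lerD.
Qed.

Lemma bsumS lam a n z : bsum lam a n.+1 z = bsum lam a n z + a n * bprod lam 1 n.+1 z.
Proof. by rewrite /bsum big_nat_recr. Qed.

Lemma pmean_bprod p lam (c : R[i]) n : in_disc lam ->
  pmean p (fun z => c * bprod lam 1 n z) 1 = normc c `^ p.
Proof.
move=> lam1; rewrite pmeanE -[RHS](mean_cst (normc c `^ p)); apply: eq_mean => t.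
by rewrite normcM normc_bprod ?mulr1// normc_circle// ler01.
Qed.

(** The term with index [m] is a difference of two consecutive partial sums. The constant may depend
    on [m], so no separation from the unit circle is required. *)
Lemma bsum_coef_le p lam m : 1 < p -> in_disc lam -> exists2 K : R, 0 <= K &
  forall a N, (m < N)%N -> normc (a m) `^ p <= K * pmean p (bsum lam a N) 1.
Proof.
move=> p1 lam1; have p1' := ltW p1.
have [C1 C10 H1] := bsum_le p1 (lam1 m.+1 isT).
(* [lam 0] is unconstrained; for [m = 0] the shorter partial sum is empty, and any value below [1]
   will do. *)
pose l := if (0 < m)%N then normc (lam m) else 0.
have l1 : l < 1 by rewrite /l; case: ifPn => // m0; exact: lam1.
have [C2 C20 H2] := bsum_le p1 l1.
exists (2 `^ p * (C1 + C2)) => [|a N mN]; first by rewrite mulr_ge0 ?powR_ge0// addr_ge0.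
have h1 := H1 lam a m.+1 N lam1 (fun _ => lexx _) mN.
have h2 : pmean p (bsum lam a m) 1 <= C2 * pmean p (bsum lam a N) 1.
  by apply: H2 => //; [rewrite /l => ->|exact: ltnW].
have one : 0 <= (1 : R) <= 1 by rewrite lexx ler01.
have A1 := disc_algebra_bsum a m.+1 lam1; have A2 := disc_algebraN (disc_algebra_bsum a m lam1).
rewrite -(pmean_bprod p (a m) m.+1 lam1).
have -> : (fun z => a m * bprod lam 1 m.+1 z) = (fun z => bsum lam a m.+1 z + - bsum lam a m z).
  by apply/funext => z; rewrite bsumS addrAC subrr add0r.
apply: (le_trans (pmeanD_le p1' (disc_algebra_continuous A1 one) (disc_algebra_continuous A2 one))).
rewrite -mulrA; apply: ler_wpM2l; first exact: powR_ge0.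
rewrite mulrDl; apply: lerD => //; apply: le_trans h2.
by rewrite le_eqVlt !pmeanE; apply/orP; left; apply/eqP; apply: eq_mean => t; rewrite normcN.
Qed.

End blaschke_sums.

(** * Density of finite Blaschke sums *)

Section density.
Context {R : realType}.
Implicit Types (lam : nat -> R[i]) (a d : nat -> R[i]) (z w u c : R[i]) (p delta e : R) (m n k N : nat).
Implicit Types (F G : R[i] -> R[i]).

(** From [1 - |b|^2 = (1 - |w|^2) (1 - |z|^2) / |1 - conj w z|^2], whose denominator is at most
    [4]. *)
Lemma normc_blaschke_factor_sqr w z : normc w < 1 -> normc z < 1 ->
  normc (blaschke_factor w z) ^+ 2 <= 1 - (1 - normc w) * (1 - normc z) / 4.
Proof.
move=> w1 z1; have d0 := blaschke_denom_neq0 w1 z1.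
have d1 : 0 < normc (1 - w^* * z) by rewrite normc_gt0.
have w0 := normc_ge0 w; have z0 := normc_ge0 z.
have D2 : normc (1 - w^* * z) <= 2.
  have := normcB 1 (w^* * z); rewrite normc1 normcM Defs.normcJ => h; apply: (le_trans h).
  by rewrite -[2]/(1 + 1) lerD2l mulr_ile1 ?(ltW w1) ?(ltW z1).
have E : normc (1 - w^* * z) ^+ 2 - normc (w - z) ^+ 2 = (1 - normc w ^+ 2) * (1 - normc z ^+ 2).
  rewrite !sqr_normcE; case: w z {w1 z1 d0 d1 w0 z0 D2} => [x y] [s t] /=; ring.
rewrite /blaschke_factor normcM normcV exprMn exprVn ler_pdivrMr ?exprn_gt0//.
have D4 : normc (1 - w^* * z) ^+ 2 <= 4.
  have -> : 4 = 2 ^+ 2 :> R by ring.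
  by rewrite ler_pXn2r ?nnegrE// ltW.
have h : (1 - normc w) * (1 - normc z) <= (1 - normc w ^+ 2) * (1 - normc z ^+ 2).
  by apply: ler_pM; rewrite ?subr_ge0 ?(ltW w1) ?(ltW z1) ?lerD2l ?lerN2 // expr2
    ler_piMr ?(ltW w1) ?(ltW z1).
have q0 : 0 <= (1 - normc w) * (1 - normc z) by rewrite mulr_ge0 ?subr_ge0 ?(ltW w1) ?(ltW z1).
move: E D4 h q0; set X := (1 - normc w) * _; set D := normc (1 - _) ^+ 2; set Y := normc (w - z) ^+ 2.
move=> E D4 h q0.
have : X / 4 * D <= X / 4 * 4 by apply: ler_wpM2l D4; rewrite divr_ge0.
rewrite mulrBl mul1r divfK//.
by move: E h; clear; lra.
Qed.

(** One more factor changes the remainder by a multiple of [B (1 - conj l b)], that is, by a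
    combination of the current and the next Blaschke product. *)
Lemma geom_telescope_step (l z u B : R[i]) : 1 - l^* * z != 0 -> 1 - u * z != 0 ->
  1 - l * u != 0 -> 1 - l * l^* != 0 ->
  B * blaschke_factor l^* u * blaschke_factor l z / (1 - u * z) - B / (1 - u * z) =
  B * ((l * blaschke_factor l^* u - 1) / (1 - l * l^*)) * (1 - l^* * blaschke_factor l z).
Proof.
have fE w v : blaschke_factor w v = (w - v) / (1 - w^* * v) by [].
by rewrite !fE conjcK => h1 h2 h3 h4; field; rewrite h1 h2 h3 h4.
Qed.

Definition dual_prod lam u n := \prod_(1 <= k < n) blaschke_factor (lam k)^* u.

(* The poles of [B_n (z) / (1 - u z)] other than [1/u] are those of [B_n], and
   [dual_prod] normalises the residue at [1/u]. *)
Lemma geom_bsum lam u n : in_disc lam -> normc u < 1 -> exists a, forall z, normc z <= 1 ->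
  (1 - u * z)^-1 - bsum lam a n.+1 z = dual_prod lam u n.+1 * bprod lam 1 n.+1 z / (1 - u * z).
Proof.
move=> lam1 u1; elim: n => [|n [a IH]].
  exists (fun=> 0) => z z1; rewrite /bsum big_nat1 mul0r subr0.
  by rewrite /dual_prod /bprod !big_geq// !mul1r.
pose l := lam n.+1; have l1 : normc l < 1 := lam1 n.+1 isT.
have lJ1 : normc l^* < 1 by rewrite Defs.normcJ.
have lu : 1 - l * u != 0 by apply: geom_denom_neq0 => //; exact: ltW.
have ll : 1 - l * l^* != 0 by apply: geom_denom_neq0 => //; exact: ltW.
pose c := dual_prod lam u n.+1 * ((l * blaschke_factor l^* u - 1) / (1 - l * l^*)).
(* The step subtracts [c] from the coefficient of [B_n] and introduces [c conj l] as that of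
   [B_(n+1)]. *)
exists (fun k => if (k <= n)%N then a k - (k == n)%:R * c else c * l^*) => z z1.
have lz : 1 - l^* * z != 0 by exact: geom_denom_neq0.
have uz : 1 - u * z != 0 by exact: geom_denom_neq0.
have := IH z z1 => E.
have S1 : bsum lam (fun k => if (k <= n)%N then a k - (k == n)%:R * c else c * l^*) n.+1 z =
    bsum lam a n.+1 z - c * bprod lam 1 n.+1 z.
  rewrite !bsumS leqnn eqxx mul1r mulrBl addrA; congr (_ + _ - _).
  by apply: eq_big_nat => j /andP[_ jn]; rewrite (ltnW jn) (ltn_eqF jn) mul0r subr0.
rewrite bsumS S1 ltnn (bprodS lam z (n := n.+1))// -/l.
have -> : dual_prod lam u n.+2 = dual_prod lam u n.+1 * blaschke_factor l^* u.
  by rewrite /dual_prod big_nat_recr.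
have := geom_telescope_step (dual_prod lam u n.+1 * bprod lam 1 n.+1 z) lz uz lu ll.
move: E; rewrite -/c.
set X := (1 - u * z)^-1; set S := bsum _ _ _ _; set D := dual_prod _ _ _; set B := bprod _ _ _ _.
set beta := blaschke_factor l^* u; set b := blaschke_factor l z => E T.
have -> : X - (S - c * B + c * l^* * (B * b)) = (X - S) + c * B * (1 - l^* * b) by ring.
rewrite E; have -> : c * B * (1 - l^* * b) = D * B * ((l * beta - 1) / (1 - l * l^*)) * (1 - l^* * b).
  have -> : c = D * ((l * beta - 1) / (1 - l * l^*)) by [].
  by congr (_ * _); exact: mulrAC.
by rewrite -T; ring.
Qed.

Lemma normc_dual_prod lam u delta n : in_disc lam -> (forall k, (1 <= k)%N -> normc (lam k) <= delta) ->
  normc u < 1 -> delta < 1 ->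
  normc (dual_prod lam u n.+1) ^+ 2 <= (1 - (1 - delta) * (1 - normc u) / 4) ^+ n.
Proof.
move=> lam1 lamd u1 d1; elim: n => [|n IH].
  by rewrite /dual_prod big_geq// normc1 expr1n.
rewrite /dual_prod big_nat_recr//= normcM exprMn [_ ^+ n.+1]exprSr; apply: ler_pM => //;
  rewrite ?exprn_ge0 ?normc_ge0//.
have l1 : normc (lam n.+1)^* < 1 by rewrite Defs.normcJ; exact: lam1.
apply: (le_trans (normc_blaschke_factor_sqr l1 u1)); rewrite lerD2l lerN2 Defs.normcJ.
apply: ler_wpM2r; first by rewrite invr_ge0.
apply: ler_wpM2r; first by rewrite subr_ge0 ltW.
by rewrite lerD2l lerN2 lamd.
Qed.

(** The uniform closure on the closed disc of the span of the [B_k]; uniform errors pass to every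
    [p]-mean. *)
Definition bspan lam F := forall e, 0 < e -> exists a N, forall z, normc z <= 1 ->
  normc (F z - bsum lam a N z) <= e.

Lemma bspan_lim lam F : (forall e, 0 < e -> exists2 G, bspan lam G &
  forall z, normc z <= 1 -> normc (F z - G z) <= e) -> bspan lam F.
Proof.
move=> H e e0; have e20 : 0 < e / 2 by rewrite divr_gt0.
have [G VG HG] := H _ e20; have [a [N Ha]] := VG _ e20; exists a, N => z z1.
have h1 := HG z z1; have h2 := Ha z z1.
have := normcD (F z - G z) (G z - bsum lam a N z); rewrite addrA subrK.
by move: h1 h2; clear; lra.
Qed.

Lemma bsum_widen lam a N M z : (N <= M)%N ->
  bsum lam a N z = bsum lam (fun k => if (k < N)%N then a k else 0) M z.
Proof.
move=> NM; rewrite /bsum [RHS](big_cat_nat (leq0n N) NM)/=.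
rewrite [X in _ = _ + X]big_nat_cond [X in _ = _ + X]big1 ?addr0 => [|k /andP[/andP[Nk _] _]].
  by apply: eq_big_nat => k /andP[_ ->].
by rewrite ltnNge Nk mul0r.
Qed.

Lemma bsumD lam a d N z : bsum lam (fun k => a k + d k) N z = bsum lam a N z + bsum lam d N z.
Proof. by rewrite /bsum -big_split/=; apply: eq_bigr => k _; rewrite mulrDl. Qed.

Lemma bsumZ lam a c N z : bsum lam (fun k => c * a k) N z = c * bsum lam a N z.
Proof. by rewrite /bsum big_distrr/=; apply: eq_bigr => k _; rewrite mulrA. Qed.

Lemma bspanD lam F G : bspan lam F -> bspan lam G -> bspan lam (fun z => F z + G z).
Proof.
move=> VF VG e e0; have e20 : 0 < e / 2 by rewrite divr_gt0.
have [a [N Ha]] := VF _ e20; have [d [M Hd]] := VG _ e20.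
exists (fun k => (if (k < N)%N then a k else 0) + (if (k < M)%N then d k else 0)), (maxn N M).
move=> z z1; rewrite bsumD -(bsum_widen _ _ _ (leq_maxl N M)) -(bsum_widen _ _ _ (leq_maxr N M)).
have h1 := Ha z z1; have h2 := Hd z z1; rewrite opprD addrACA.
by apply: (le_trans (normcD _ _)); move: h1 h2; clear; lra.
Qed.

Lemma bspanZ lam c F : bspan lam F -> bspan lam (fun z => c * F z).
Proof.
move=> VF e e0; have c1 : 0 < normc c + 1 by rewrite ltr_wpDl ?normc_ge0.
have [a [N Ha]] := VF _ (divr_gt0 e0 c1); exists (fun k => c * a k), N => z z1.
rewrite bsumZ -mulrBr normcM.
apply: (le_trans (ler_wpM2l (normc_ge0 c) (Ha z z1))).
by rewrite mulrCA ler_piMr ?(ltW e0)// ler_pdivrMr// mul1r lerDl.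
Qed.

Lemma bspan_ext lam F G : bspan lam F -> F =1 G -> bspan lam G.
Proof. by move=> VF /funext <-. Qed.

Lemma bspan_geom lam delta u : in_disc lam -> (forall k, (1 <= k)%N -> normc (lam k) <= delta) ->
  delta < 1 -> normc u < 1 -> bspan lam (fun z => (1 - u * z)^-1).
Proof.
move=> lam1 lamd d1 u1 e e0; pose x := 1 - (1 - delta) * (1 - normc u) / 4.
have d0 : 0 <= delta := le_trans (normc_ge0 _) (lamd 1%N isT).
have u0 := normc_ge0 u.
have x1 : 0 <= x < 1.
  have : 0 < (1 - delta) * (1 - normc u) by rewrite mulr_gt0 ?subr_gt0.
  have : (1 - delta) * (1 - normc u) <= 1.
    by rewrite mulr_ile1 ?subr_ge0 ?(ltW d1) ?(ltW u1)// gerBl.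
  by rewrite /x; clear; lra.
have e1 : 0 < (e * (1 - normc u)) ^+ 2 by rewrite exprn_gt0// mulr_gt0// subr_gt0.
have [n xn] := expr_lt_eps x1 e1.
have [a Ha] := geom_bsum n lam1 u1; exists a, n.+1 => z z1; rewrite Ha// !normcM normcV.
have D := geom_denom u1 z1; have D0 : 0 < normc (1 - u * z) by apply: lt_le_trans D; rewrite subr_gt0.
rewrite ler_pdivrMr//; apply: (@le_trans _ _ (normc (dual_prod lam u n.+1))).
  rewrite ler_piMr ?normc_ge0//.
  rewrite /bprod big_nat_cond.
  apply: (big_ind (fun w => normc w <= 1)) => [|v w v1 w1|k /andP[/andP[k0 _] _]].
  - by rewrite normc1.
  - by rewrite normcM mulr_ile1 ?normc_ge0.
  - have [z1'|z1'] := ltP (normc z) 1; first by apply: blaschke_factor_le1 => //; exact: lam1.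
    have zE : normc z = 1 by apply/eqP; rewrite eq_le z1 z1'.
    by rewrite normc_blaschke_factor//; exact: lam1.
apply: (@le_trans _ _ (e * (1 - normc u))); last by apply: ler_wpM2l D; exact: ltW.
rewrite -(@ler_pXn2r _ 2) ?nnegrE ?normc_ge0 ?mulr_ge0 ?(ltW e0) ?subr_ge0 ?(ltW u1)//.
by apply: le_trans (ltW xn); exact: normc_dual_prod.
Qed.

(** Geometric kernels yield monomials by [z^(m+1) / (1 - s z) = (z^m / (1 - s z) - z^m) / s]; at
    each degree the monomial itself is the limit of [z^j / (1 - s z)] as [s] tends to [0]. *)
Lemma bspan_monomial lam delta m : in_disc lam -> (forall k, (1 <= k)%N -> normc (lam k) <= delta) ->
  delta < 1 -> bspan lam (fun z => z ^+ m).
Proof.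
move=> lam1 lamd d1.
have step j : (forall s : R, 0 < s < 1 -> bspan lam (fun z => z ^+ j / (1 - s%:C * z))) ->
    bspan lam (fun z => z ^+ j).
  move=> H; apply: bspan_lim => e e0.
  (* The error is at most [s / (1 - s)], which is at most [e] because [1 - s >= 1/2] and
     [s <= e / 2]. *)
  pose s := Num.min (2^-1) (e / 2); have s0 : 0 < s by rewrite lt_min invr_gt0 divr_gt0// ltr0n.
  have s1 : s <= 2^-1 by rewrite ge_min lexx.
  have se : s <= e / 2 by rewrite ge_min lexx orbT.
  have s01 : 0 < s < 1 by rewrite s0/=; move: s1; clear; lra.
  exists (fun z => z ^+ j / (1 - s%:C * z)); first exact: H.
  move=> z z1; have ns : normc (s%:C : R[i]) = s by rewrite normc_real ger0_norm// ltW.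
  have ns1 : normc (s%:C : R[i]) < 1 by rewrite ns; case/andP: s01.
  have D := geom_denom ns1 z1; have D0 := geom_denom_neq0 ns1 z1.
  have Dp : 0 < normc (1 - s%:C * z) by rewrite normc_gt0.
  rewrite ns in D.
  have -> : z ^+ j - z ^+ j / (1 - s%:C * z) = - (s%:C * z ^+ j.+1 / (1 - s%:C * z)).
    by rewrite exprS; field.
  rewrite normcN !(normcM, normcV) ns ler_pdivrMr// normcX.
  apply: (@le_trans _ _ s); first by rewrite ler_piMr ?(ltW s0)// exprn_ile1 ?normc_ge0.
  apply: (@le_trans _ _ (e * (1 - s))); last by apply: ler_wpM2l D; exact: ltW.
  have : e / 2 <= e * (1 - s) by apply: ler_wpM2l; [exact: ltW|move: s1; clear; lra].
  exact: le_trans.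
apply: (step); elim: m => [|m IH] s s01; have /andP[s0 s1] := s01.
  apply: bspan_ext (bspan_geom lam1 lamd d1 _) _ => [|z]; last by rewrite expr0 mul1r.
  by rewrite normc_real ger0_norm// ltW.
apply: bspan_lim => e e0.
exists (fun z => (s%:C)^-1 * (z ^+ m / (1 - s%:C * z) + - 1 * z ^+ m)).
  by apply: bspanZ; apply: bspanD; [exact: IH|apply: bspanZ; exact: step].
move=> z z1; have ns1 : normc (s%:C : R[i]) < 1 by rewrite normc_real ger0_norm// ltW.
have D0 := geom_denom_neq0 ns1 z1.
have sC : s%:C != 0 :> R[i] by rewrite -normc_gt0 normc_real ger0_norm// ltW.
rewrite (_ : _ - _ = 0) ?normc0 ?(ltW e0)//.
by rewrite exprS; field; rewrite D0 sC.
Qed.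

Lemma bspan_poly lam delta (P : {poly R[i]}) : in_disc lam ->
  (forall k, (1 <= k)%N -> normc (lam k) <= delta) -> delta < 1 -> bspan lam (horner P).
Proof.
move=> lam1 lamd d1.
have H n : bspan lam (fun z => \sum_(i < n) P`_i * z ^+ i).
  elim: n => [|n IH].
    move=> e e0; exists (fun=> 0), 0%N => z _; rewrite /bsum big_ord0 big_geq// subr0 normc0.
    exact: ltW.
  apply: (@bspan_ext _ (fun z => \sum_(i < n) P`_i * z ^+ i + P`_n * z ^+ n)).
    by apply: bspanD => //; apply: bspanZ; exact: bspan_monomial lamd d1.
  by move=> z; rewrite big_ord_recr.
by apply: bspan_ext (H (size P)) _ => z; rewrite horner_coef.
Qed.

Lemma bspan_disc_algebra lam delta F : in_disc lam ->
  (forall k, (1 <= k)%N -> normc (lam k) <= delta) -> delta < 1 ->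
  disc_algebra F -> bspan lam F.
Proof.
move=> lam1 lamd d1 AF; apply: bspan_lim => e /AF[P HP].
by exists (horner P) => //; exact: bspan_poly lamd d1.
Qed.

End density.

(** * Blocks of two terms with small norm *)

Section small_blocks.
Context {R : realType}.
Implicit Types (lam : nat -> R[i]) (z w x : R[i]) (p delta tau e : R) (n : nat).

Lemma normc_addcJ x (c : R) : normc x <= c ->
  normc (2^-1 * (x + c%:C) + (2^-1 * (x + c%:C))^*) = complex.Re x + c.
Proof.
move=> xc; have -> : 2^-1 * (x + c%:C) + (2^-1 * (x + c%:C))^* = (complex.Re x + c)%:C.
  rewrite (_ : 2^-1 = (2^-1)%:C :> R[i]); last by rewrite rmorphV ?unitfE ?pnatr_eq0//= rmorph_nat.
  by case: x {xc} => s t; apply/eqP; rewrite eq_complex/=; apply/andP; split; apply/eqP; field.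
rewrite normc_real ger0_norm//.
by have := le_trans (normc_Re x) xc; rewrite ler_norml => /andP[h _]; move: h; clear; lra.
Qed.

(** On the circle [|1 - conj w b|^2 = 1 + |w|^2 - 2 Re (conj w b)], and [conj w b] has value [|w|^2]
    at [0]. The mean of the real part is bounded below by [disc_algebra_center] with exponent [1];
    adding [2] makes the real part positive, so that it is a modulus. *)
Lemma blaschke_block_sqr w : normc w < 1 ->
  mean (fun t => normc (1 - w^* * blaschke_factor w (circle 1 t)) ^+ 2) <= 1 - normc w ^+ 2.
Proof.
move=> w1; pose b := blaschke_factor w; have w0 := normc_ge0 w.
pose F z := 2^-1 * (w^* * b z + 2%:C).
have AF : disc_algebra F.
  apply: disc_algebraZ; apply: disc_algebraD; last exact: disc_algebra_cst.
  by apply: disc_algebraZ; exact: disc_algebra_blaschke_factor.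
have b1 t : normc (b (circle 1 t)) = 1 by rewrite normc_blaschke_factor// normc_circle// ler01.
have wb t : normc (w^* * b (circle 1 t)) <= 2.
  by rewrite normcM b1 mulr1 Defs.normcJ; move: w1; clear; lra.
have b0 : w^* * b 0 = (normc w ^+ 2)%:C.
  rewrite /b /blaschke_factor subr0 mulr0 subr0 divr1 sqr_normcJ mulrC //.
have := disc_algebra_center (lexx 1) AF AF; rewrite hmeanE.
rewrite powRr1 ?normc_ge0// /F normc_addcJ; last first.
  rewrite b0 normc_real ger0_norm ?exprn_ge0//.
  by apply: (@le_trans _ _ 1); [rewrite exprn_ile1 ?(ltW w1)|rewrite ler1n].
rewrite b0/= => h.
pose u t := normc (F (circle 1 t) + (F (circle 1 t))^*) `^ 1.
have cu : continuous u by exact: continuous_norm_powR (lexx 1) (continuous_sum_conj AF AF).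
have cc : continuous (fun _ : R => 5 + normc w ^+ 2) by move=> t; exact: cvg_cst.
have c2 : continuous (fun t => 2 * u t) by move=> t; apply: cvgM; [exact: cvg_cst|exact: cu].
have -> : (fun t => normc (1 - w^* * b (circle 1 t)) ^+ 2) = (fun t => 5 + normc w ^+ 2 - 2 * u t).
  apply/funext => t; rewrite /u /F powRr1 ?normc_ge0// normc_addcJ//.
  have := b1 t; move/(congr1 (fun s => s ^+ 2)); rewrite expr1n.
  rewrite !sqr_normcE; move: (b (circle 1 t)); case: w {w1 w0 b F AF b1 wb b0 h u cu cc c2} => x y [s t'] /= E.
  have -> : (x ^+ 2 + y ^+ 2) = (x ^+ 2 + y ^+ 2) * (s ^+ 2 + t' ^+ 2) by rewrite E mulr1.
  ring.
rewrite (meanB cc c2) (meanZ _ cu) mean_cst.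
by move: h; rewrite -/u; clear; lra.
Qed.

(** It passes from the quadratic mean to the [p]-mean of a function bounded by [2], also when
    [p < 2]: values up to [tau^(1/p)] cost at most [tau], larger ones are dominated by their
    squares. *)
Lemma powR_le_interp p tau : 1 < p -> 0 < tau -> exists2 K : R, 0 <= K &
  forall v : R, 0 <= v <= 2 -> v `^ p <= tau + K * v ^+ 2.
Proof.
move=> p1 t0; pose s := tau `^ p^-1; have s0 : 0 < s by rewrite powR_gt0.
have p0 : 0 < p by exact: lt_trans p1.
exists (2 `^ p / s ^+ 2) => [|v /andP[v0 v2]]; first by rewrite divr_ge0 ?powR_ge0 ?exprn_ge0 ?ltW.
have [vs|sv] := leP v s.
  apply: (@le_trans _ _ tau); last by rewrite lerDl mulr_ge0 ?exprn_ge0// divr_ge0 ?powR_ge0 ?exprn_ge0 ?ltW.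
  have -> : tau = s `^ p by rewrite /s -powRrM mulVf ?gt_eqF// powRr1// ltW.
  by apply: ge0_ler_powR; rewrite ?nnegrE ?(ltW p0) ?(ltW s0).
apply: (@le_trans _ _ (2 `^ p)); first by apply: ge0_ler_powR; rewrite ?nnegrE ?(ltW p0).
apply: (@le_trans _ _ (2 `^ p / s ^+ 2 * v ^+ 2)); last by rewrite lerDr ltW.
rewrite -mulrA ler_peMr ?powR_ge0// mulrC ler_pdivlMr ?exprn_gt0// mul1r.
by rewrite ler_pXn2r ?nnegrE ?(ltW s0) ?(ltW sv).
Qed.

(* On the circle [B_n - conj(l) B_(n+1)] has the modulus of [1 - conj(l) b], which is at
   most 2 and, by the mean value property of [b], has squared [L^2]-norm [1 - |l|^2]. *)
Lemma blaschke_block_small p tau : 1 < p -> 0 < tau -> exists2 delta : R, delta < 1 &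
  forall lam n, in_disc lam -> delta <= normc (lam n.+1) ->
  pmean p (fun z => bprod lam 1 n.+1 z - (lam n.+1)^* * bprod lam 1 n.+2 z) 1 <= tau.
Proof.
move=> p1 t0; have t20 : 0 < tau / 2 by rewrite divr_gt0.
have [K K0 HK] := powR_le_interp p1 t20; have p1' := ltW p1.
(* [1 - |w|^2 <= 2 (1 - |w|)] is then at most [tau / (2 (K + 1))], so the quadratic term costs at
   most [tau / 2]. *)
pose delta := Num.max 0 (1 - tau / (4 * (K + 1))).
have K1 : 0 < 4 * (K + 1) by rewrite mulr_gt0// ltr_wpDl.
exists delta => [|lam n lam1 dl].
  by rewrite /delta gt_max ltr01/= ltrBlDr ltrDl divr_gt0.
set w := lam n.+1 in dl *; have w1 : normc w < 1 := lam1 n.+1 isT.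
have w0 := normc_ge0 w.
have one : 0 <= (1 : R) <= 1 by rewrite lexx ler01.
pose H z := 1 - w^* * blaschke_factor w z.
have AH : disc_algebra H.
  apply: disc_algebraB; first exact: disc_algebra_cst.
  by apply: disc_algebraZ; exact: disc_algebra_blaschke_factor.
have cH := disc_algebra_continuous AH one.
have -> : pmean p (fun z => bprod lam 1 n.+1 z - w^* * bprod lam 1 n.+2 z) 1 = pmean p H 1.
  rewrite !pmeanE; apply: eq_mean => t; rewrite (bprodS lam _ (n := n.+1))// -/w.
  set B := bprod _ _ _ _; have -> : B - w^* * (B * blaschke_factor w (circle 1 t)) = B * H (circle 1 t).
    by rewrite /H mulrBr mulr1 mulrCA.
  by rewrite normcM normc_bprod ?mul1r// normc_circle// ler01.
have cS : continuous (fun t => normc (H (circle 1 t)) ^+ 2) by exact: continuous_sqr_normc cH.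
have cK : continuous (fun t => K * normc (H (circle 1 t)) ^+ 2).
  by move=> t; apply: cvgM; [exact: cvg_cst|exact: cS].
have cc : continuous (fun _ : R => tau / 2) by move=> t; exact: cvg_cst.
have cT : continuous (fun t => tau / 2 + K * normc (H (circle 1 t)) ^+ 2).
  by move=> t; apply: cvgD; [exact: cc|exact: cK].
have bd t : 0 <= normc (H (circle 1 t)) <= 2.
  rewrite normc_ge0/=; have := normcB 1 (w^* * blaschke_factor w (circle 1 t)).
  rewrite normc1 normcM Defs.normcJ normc_blaschke_factor ?normc_circle ?ler01// mulr1.
  by rewrite -/(H _); move: w1; clear; lra.
rewrite pmeanE.
apply: (le_trans (le_mean (continuous_norm_powR p1' cH) cT (fun t => HK _ (bd t)))).
rewrite (meanD cc cK) (meanZ _ cS) mean_cst.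
have h := blaschke_block_sqr w1; rewrite -/(H _) in h.
have dw : 1 - tau / (4 * (K + 1)) <= normc w.
  by apply: le_trans dl; rewrite /delta le_max lexx orbT.
have dw2 : 1 - normc w ^+ 2 <= tau / (2 * (K + 1)).
  have -> : tau / (2 * (K + 1)) = 2 * (tau / (4 * (K + 1))).
    by field; move: K1; rewrite pmulr_rgt0// => /gt_eqF ->.
  by move: dw w1 w0; set q := tau / _; clear; nra.
have hK : K * mean (fun t => normc (H (circle 1 t)) ^+ 2) <= tau / 2.
  apply: (@le_trans _ _ (K * (tau / (2 * (K + 1))))).
    by apply: ler_wpM2l => //; exact: le_trans h dw2.
  have K10 : 0 < K + 1 by rewrite ltr_wpDl.
  have -> : K * (tau / (2 * (K + 1))) = (tau / 2) * (K / (K + 1)) by field; rewrite gt_eqF.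
  rewrite ler_piMr ?(ltW t20)// ler_pdivrMr//.
  by rewrite mul1r lerDl.
by move: hK; clear; lra.
Qed.

End small_blocks.

(** * Blaschke series in the Hardy space *)

Section hardy_approximation.
Context {R : realType}.
Implicit Types (F G : R[i] -> R[i]) (a d : nat -> R[i]) (z : R[i]) (p r e c : R).

Lemma pmean_le_sup p F r e : 1 <= p -> continuous (fun t => F (circle r t) : R[i]^o) ->
  (forall t, normc (F (circle r t)) <= e) -> pmean p F r <= e `^ p.
Proof.
move=> p1 cF Fe; have e0 : 0 <= e := le_trans (normc_ge0 _) (Fe 0).
rewrite pmeanE -[leRHS](mean_cst (e `^ p)).
apply: (le_mean (continuous_norm_powR p1 cF)) => [t|t]; first exact: cvg_cst.
by apply: ge0_ler_powR; rewrite ?nnegrE ?normc_ge0//; move: p1; clear; lra.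
Qed.

(** The threshold at which two summands, combined by [pmeanD_le], give a mean of at most [e^p]. *)
Definition half_mean p e := e `^ p / (2 * 2 `^ p).

Lemma half_mean_gt0 p e : 0 < e -> 0 < half_mean p e.
Proof. by move=> e0; rewrite divr_gt0 ?mulr_gt0 ?powR_gt0. Qed.

Lemma pmeanD_half p F G r e : 1 <= p ->
  continuous (fun t => F (circle r t) : R[i]^o) ->
  continuous (fun t => G (circle r t) : R[i]^o) ->
  pmean p F r <= half_mean p e -> pmean p G r <= half_mean p e ->
  pmean p (fun z => F z + G z) r <= e `^ p.
Proof.
move=> p1 cF cG hF hG; apply: (le_trans (pmeanD_le p1 cF cG)).
have q0 : 0 < 2 `^ p :> R by rewrite powR_gt0.
apply: (@le_trans _ _ (2 `^ p * (half_mean p e + half_mean p e))).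
  by apply: ler_wpM2l; [exact: ltW|exact: lerD].
by rewrite /half_mean le_eqVlt; apply/orP; left; apply/eqP; field; rewrite gt_eqF.
Qed.

Lemma powR_inv_gt0 p c : 0 < p -> 0 < c -> exists2 e : R, 0 < e & e `^ p = c.
Proof.
move=> p0 c0; exists (c `^ p^-1); first exact: powR_gt0.
by rewrite -powRrM mulVf ?gt_eqF// powRr1// ltW.
Qed.

Lemma small_inv (e : R) : 0 < e -> exists N, forall k, (N <= k)%N -> (k.+1%:R^-1 : R) <= e.
Proof.
move=> e0; have [N] := ltr_add_invr e0; rewrite add0r => HN; exists N => k Nk.
by apply: le_trans (ltW HN); rewrite lef_pV2 ?posrE ?ltr0n// ler_nat ltnS.
Qed.

Section fixed_exponent.
Variables (p : R) (p1 : 1 <= p).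
Implicit Types (f g h y : hardy p1).

Lemma hardy_valB f g z : val (f - g) z = val f z - val g z. Proof. by []. Qed.
Lemma hardy_valD f g z : val (f + g) z = val f z + val g z. Proof. by []. Qed.
Lemma hardy_valZ (c' : R[i]) f z : val (c' *: f) z = c' * val f z. Proof. by []. Qed.

Lemma hnorm_triangle f g : hnorm (f + g) <= hnorm f + hnorm g.
Proof. by have := ler_normD f g; rewrite !hnormE -rmorphD lecR. Qed.

Lemma hnorm_distC f g : hnorm (f - g) = hnorm (g - f).
Proof. by have := distrC f g; rewrite !hnormE => /complexI. Qed.

Lemma hnorm_scale (c' : R[i]) f : hnorm (c' *: f) = normc c' * hnorm f.
Proof. by have := normrZ c' f; rewrite !hnormE normCE -rmorphM => /complexI. Qed.

Lemma hnorm_zero : hnorm (0 : hardy p1) = 0.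
Proof. by have := normr0 (hardy p1); rewrite hnormE => /complexI. Qed.

Lemma hardy_cvgP (u : nat -> hardy p1) y : (u @ \oo --> y) <->
  (forall e, 0 < e -> exists N, forall n, (N <= n)%N -> hnorm (u n - y) <= e).
Proof.
split=> [/cvgrPdist_le H e e0|H].
  have e0' : 0 < e%:C :> R[i] by rewrite ltr0c.
  have [N _ HN] := H _ e0'; exists N => n Nn; have := HN n Nn.
  by rewrite hnormE lecR hnorm_distC.
apply/cvgrPdist_le => e'; case: e' => x t; rewrite ltcE/= => /andP[/eqP -> x0].
have [N HN] := H x x0; exists N => // n Nn /=.
by rewrite hnormE -[_ +i* _]/(x%:C) lecR hnorm_distC; exact: HN.
Qed.

(** Each [g k] is replaced by a polynomial at uniform distance at most [1 / (k+1)], which reduces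
    the claim to [hardy_limit]. *)
Lemma hardy_cauchy_limit (g : nat -> hardy p1) :
  (forall k, exists2 F, disc_algebra F & forall z, normc z < 1 -> val (g k) z = F z) ->
  (forall e, 0 < e -> exists N, forall i j, (N <= i)%N -> (N <= j)%N -> hnorm (g i - g j) <= e) ->
  exists h, g @ \oo --> h.
Proof.
move=> Ag cg; have p0 : 0 < p := lt_le_trans ltr01 p1.
have [F HF] := choice (fun k => let: ex_intro2 F A E := Ag k in
  ex_intro (fun F => disc_algebra F /\ forall z, normc z < 1 -> val (g k) z = F z) F (conj A E)).
have pol k : exists P : {poly R[i]}, forall z, normc z <= 1 -> normc (F k z - P.[z]) <= k.+1%:R^-1.
  by have [A _] := HF k; apply: A; rewrite invr_gt0 ltr0n.
have {pol} [P HP] := choice pol.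
have one : 0 <= (1 : R) <= 1 by rewrite lexx ler01.
have c1 t : normc (circle 1 t : R[i]) <= 1 by rewrite normc_circle// ler01.
have [|h Hh] := @hardy_limit R p p1 P.
  move=> e e0; have [e1 e10 E1] := powR_inv_gt0 p0 e0.
  have [e2 e20 E2] := powR_inv_gt0 p0 (half_mean_gt0 p e10).
  have [N1 H1] := cg _ e20.
  have [N2 H2] := @small_inv (e2 / 2) ltac:(by rewrite divr_gt0).
  exists (maxn N1 N2) => i j; rewrite !geq_max => /andP[i1 i2] /andP[j1 j2].
  have [[Ai Ei] [Aj Ej]] := (HF i, HF j).
  pose D z := F i z - F j z; have AD : disc_algebra D by exact: disc_algebraB.
  pose X z := (F j z - (P j).[z]) - (F i z - (P i).[z]).
  have AX : disc_algebra X by apply: disc_algebraB; apply: disc_algebraB => //; exact: disc_algebra_poly.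
  have -> : pmean p (horner (P i - P j)) 1 = pmean p (fun z => D z + X z) 1.
    by rewrite !pmeanE; apply: eq_mean => t; rewrite hornerD hornerN /D /X; congr (normc _ `^ _); ring.
  rewrite -E1; apply: (@pmeanD_half p D X 1 e1) => //.
  - exact: disc_algebra_continuous.
  - exact: disc_algebra_continuous.
  - rewrite -E2 -(@hnorm_disc_algebra _ p p1 (g i - g j) D AD) => [|z z1].
      by apply: ge0_ler_powR; rewrite ?nnegrE ?hnorm_ge0 ?(ltW p0) ?(ltW e20)// H1.
    by rewrite hardy_valB Ei// Ej.
  - rewrite -E2; apply: pmean_le_sup => //; first exact: disc_algebra_continuous.
    move=> t; apply: (le_trans (normcB _ _)).
    have := le_trans (HP j _ (c1 t)) (H2 j j2); have := le_trans (HP i _ (c1 t)) (H2 i i2).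
    by clear; lra.
exists h; apply/hardy_cvgP => e e0.
have [e2 e20 E2] := powR_inv_gt0 p0 (half_mean_gt0 p e0).
have [N1 H1] := Hh _ (half_mean_gt0 p e0); have [N2 H2] := small_inv e20.
exists (maxn N1 N2) => k; rewrite geq_max => /andP[k1 k2].
apply: hnorm_le => [|r r01]; first exact: ltW.
have [Ak Ek] := HF k; have /andP[r0 r1] := r01.
have r01' : 0 <= r <= 1 by rewrite !ltW.
have r01'' : 0 <= r < 1 by rewrite ltW.
have [ha _ _] := hardyP h.
pose X z := F k z - (P k).[z]; pose Y z := (P k).[z] - val h z.
have -> : pmean p (val (g k - h)) r = pmean p (fun z => X z + Y z) r.
  by apply: eq_pmean => // z z1; rewrite hardy_valB Ek// /X /Y addrA subrK.
have cX : continuous (fun t => X (circle r t) : R[i]^o).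
  by apply: disc_algebra_continuous => //; apply: disc_algebraB => //; exact: disc_algebra_poly.
apply: (@pmeanD_half p X Y r e p1 cX).
- have ch := analytic_circle_continuous ha r01''.
  have cP : continuous (fun t => (P k).[circle r t] : R[i]^o) by exact: continuous_poly_circle.
  exact: continuousB_complex cP ch.
- rewrite -E2; apply: pmean_le_sup => // t; apply: le_trans (H2 k k2); apply: HP.
  by rewrite normc_circle ?ltW.
- exact: H1.
Qed.

End fixed_exponent.

Section blaschke_series.
Variables (p : R) (p1 : 1 < p) (lam : nat -> R[i]).
Hypothesis lam1 : in_disc lam.
Local Notation B := (blaschke_hardy (ltW p1) lam1).

Lemma val_series a n z : normc z < 1 ->
  val (series (fun k => a k *: B k) n) z = bsum lam a n z.
Proof.
move=> z1; rewrite /series/= /bsum; elim: n => [|n IH]; first by rewrite !big_geq.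
have vB : val (B n) z = bprod lam 1 n.+1 z by rewrite /= /blaschke z1.
by rewrite !big_nat_recr// hardy_valD hardy_valZ vB -IH.
Qed.

Lemma hnorm_series a n : hnorm (series (fun k => a k *: B k) n) `^ p = pmean p (bsum lam a n) 1.
Proof.
apply: hnorm_disc_algebra; first exact: disc_algebra_bsum.
by move=> z z1; exact: val_series.
Qed.

Lemma hnorm_blaschke n : hnorm (B n) = 1.
Proof.
have p0 : 0 < p by exact: lt_trans p1.
have A := disc_algebra_bprod n.+1 lam1 (ltn0Sn 0).
have E : hnorm (B n) `^ p = 1.
  rewrite (hnorm_disc_algebra A) => [|z z1]; last by rewrite /= /blaschke z1.
  have -> : bprod lam 1 n.+1 = (fun z => 1 * bprod lam 1 n.+1 z).
    by apply/funext => z; rewrite mul1r.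
  by rewrite pmean_bprod// normc1 powR1.
have E' : hnorm (B n) `^ p = 1 `^ p by rewrite E powR1.
by apply/eqP; rewrite eq_le; apply/andP; split; apply: (powR_le_cancel p0);
  rewrite ?hnorm_ge0 ?E' ?ler01.
Qed.

Lemma seriesB a d n : series (fun k => (a k - d k) *: B k) n =
  series (fun k => a k *: B k) n - series (fun k => d k *: B k) n.
Proof. by rewrite /series/= -sumrB; apply: eq_bigr => k _; rewrite scalerBl. Qed.

Lemma hnorm_coef_le m : exists2 K : R, 0 <= K & forall a N, (m < N)%N ->
  normc (a m) <= K * hnorm (series (fun k => a k *: B k) N).
Proof.
have p0 : 0 < p by exact: lt_trans p1.
have [K K0 HK] := bsum_coef_le m p1 lam1; exists (K `^ p^-1) => [|a N mN].
  exact: powR_ge0.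
have hn := hnorm_ge0 (series (fun k => a k *: B k) N).
apply: (powR_le_cancel p0 (normc_ge0 _)); first by rewrite mulr_ge0 ?powR_ge0.
rewrite powRM ?powR_ge0// -powRrM mulVf ?gt_eqF// powRr1// hnorm_series.
exact: HK.
Qed.

Lemma hnorm_partial_le delta : delta < 1 -> (forall k, (1 <= k)%N -> normc (lam k) <= delta) ->
  exists2 C : R, 0 <= C & forall a n N, (n <= N)%N ->
  hnorm (series (fun k => a k *: B k) n) <= C * hnorm (series (fun k => a k *: B k) N).
Proof.
move=> d1 lamd; have p0 : 0 < p by exact: lt_trans p1.
have [C C0 HC] := bsum_le p1 d1; exists (C `^ p^-1) => [|a n N nN]; first exact: powR_ge0.
have hn := hnorm_ge0 (series (fun k => a k *: B k) N).
apply: (powR_le_cancel p0 (hnorm_ge0 _)); first by rewrite mulr_ge0 ?powR_ge0.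
rewrite powRM ?powR_ge0// -powRrM mulVf ?gt_eqF// powRr1// !hnorm_series.
by apply: HC => // n0; exact: lamd.
Qed.

(** A dilation of [y] is close to [y] in the mean and lies in the disc algebra, where finite
    Blaschke sums approximate it uniformly. *)
Lemma hardy_approx delta (y : hardy (ltW p1)) e : delta < 1 ->
  (forall k, (1 <= k)%N -> normc (lam k) <= delta) -> 0 < e ->
  exists a N, hnorm (series (fun k => a k *: B k) N - y) <= e.
Proof.
move=> d1 lamd e0; have p0 : 0 < p by exact: lt_trans p1.
have [ya _ _] := hardyP y; have h0 := half_mean_gt0 p e0.
have [rho rho01 Hr] := dilation_pmean p1 (fun u u01 => analytic_disc_algebra ya u01)
  (fun r r01 => pmean_le_hnorm y r01) h0.
have [e2 e20 E2] := powR_inv_gt0 p0 h0.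
have Ar := analytic_disc_algebra ya rho01.
have [a [N Ha]] := bspan_disc_algebra lam1 lamd d1 Ar e20; exists a, N.
apply: hnorm_le => [|r r01]; first exact: ltW.
have /andP[r0 r1] := r01; have p1' := ltW p1.
have r01' : 0 <= r <= 1 by rewrite !ltW.
have r01'' : 0 <= r < 1 by rewrite ltW.
pose X z := - (val y (rho%:C * z) - bsum lam a N z); pose Y z := val y (rho%:C * z) - val y z.
have -> : pmean p (val (series (fun k => a k *: B k) N - y)) r = pmean p (fun z => X z + Y z) r.
  by apply: eq_pmean => // z z1; rewrite hardy_valB val_series// /X /Y; ring.
have AX : disc_algebra X.
  by apply: disc_algebraN; apply: disc_algebraB => //; exact: disc_algebra_bsum.
have cX := disc_algebra_continuous AX r01'.
apply: (@pmeanD_half p X Y r e p1' cX).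
- have cA := disc_algebra_continuous Ar r01'; have cy := analytic_circle_continuous ya r01''.
  exact: continuousB_complex cA cy.
- rewrite -E2; apply: pmean_le_sup => // t; rewrite /X normcN; apply: Ha.
  by rewrite normc_circle ?ltW.
- exact: Hr.
Qed.

End blaschke_series.

End hardy_approximation.

(** * Basis property for points away from the circle *)

Section basis.
Context {R : realType} (p : R) (p1 : 1 < p) (lam : nat -> R[i]) (lam1 : in_disc lam).
Implicit Types (a d : nat -> R[i]) (y : hardy (ltW p1)).
Local Notation B := (blaschke_hardy (ltW p1) lam1).
Local Notation S a := (series (fun k => a k *: B k)).

Lemma hnorm_dist_le (f g h : hardy (ltW p1)) : hnorm (f - g) <= hnorm (f - h) + hnorm (g - h).
Proof.
by rewrite [hnorm (g - h)]hnorm_distC; have := hnorm_triangle (f - h) (h - g); rewrite addrA subrK.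
Qed.

Lemma hnorm_coef_dist m : exists2 K : R, 0 <= K & forall a d N, (m < N)%N ->
  normc (a m - d m) <= K * hnorm (S a N - S d N).
Proof.
have [K K0 HK] := hnorm_coef_le p1 lam1 m; exists K => // a d N mN.
by rewrite -seriesB; exact: (HK (fun k => a k - d k)).
Qed.

(** Each coefficient is bounded by the norm of long partial sums, and the partial sums of the
    difference tend to [0]. *)
Lemma series_unique a d y : S a @ \oo --> y -> S d @ \oo --> y -> a = d.
Proof.
move=> /hardy_cvgP Ha /hardy_cvgP Hd; apply/funext => m; apply/eqP.
have [K K0 HK] := hnorm_coef_dist m.
rewrite -subr_eq0; apply/eqP/eq0_normc/eqP; rewrite eq_le normc_ge0 andbT.
apply: (@le_linear_eps _ _ _ (K * 2)) => [|e /andP[e0 _]]; first exact: mulr_ge0.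
have [N1 H1] := Ha e e0; have [N2 H2] := Hd e e0.
pose N := maxn m.+1 (maxn N1 N2).
have h1 := H1 N ltac:(by rewrite /N !leq_max leqnn orbT).
have h2 := H2 N ltac:(by rewrite /N !leq_max leqnn !orbT).
rewrite add0r -mulrA; apply: (le_trans (HK a d N (leq_maxl _ _))).
apply: (ler_wpM2l K0); apply: (le_trans (hnorm_dist_le _ _ y)).
by rewrite mulr_natl mulr2n; exact: lerD.
Qed.

Lemma series_pad a N n : (N <= n)%N -> S (fun k => if (k < N)%N then a k else 0) n = S a N.
Proof.
move=> Nn; rewrite /series/= (big_cat_nat (leq0n N) Nn)/= [X in _ + X]big_nat_cond.
rewrite [X in _ + X]big1 ?addr0 => [|k /andP[/andP[Nk _] _]].
  by apply: eq_big_nat => k /andP[_ ->].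
by rewrite ltnNge Nk /= scale0r.
Qed.

Lemma hnorm_series_le a n (e : R) : (forall k, (k < n)%N -> normc (a k) <= e) ->
  hnorm (S a n) <= n%:R * e.
Proof.
rewrite /series/=; elim: n => [|n IH] H; first by rewrite big_geq// hnorm_zero mul0r.
rewrite big_nat_recr//=; apply: (le_trans (hnorm_triangle _ _)).
rewrite hnorm_scale hnorm_blaschke mulr1 -natr1 mulrDl mul1r; apply: lerD; last exact: H.
by apply: IH => k kn; apply: H; exact: ltnW.
Qed.

Lemma uniform_bound (P : nat -> nat -> Prop) n :
  (forall k, exists N, forall i, (N <= i)%N -> P k i) ->
  exists N, forall i, (N <= i)%N -> forall k, (k < n)%N -> P k i.
Proof.
move=> H; elim: n => [|n [N HN]]; first by exists 0%N.
have [M HM] := H n; exists (maxn N M) => i; rewrite geq_max => /andP[Ni Mi] k.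
by rewrite ltnS leq_eqVlt => /orP[/eqP ->|]; [exact: HM|exact: HN].
Qed.

(* The coefficients of finite sums approximating [y] converge, and the uniform
   bound on the partial sum operators lets the limit series inherit the approximation. *)
Lemma schauder_basis_separated (delta : R) : delta < 1 ->
  (forall k, (1 <= k)%N -> normc (lam k) <= delta) -> schauder_basis B.
Proof.
move=> d1 lamd y.
have [C C0 HC] := hnorm_partial_le p1 lam1 d1 lamd.
have inv0 j : 0 < (j.+1%:R^-1 : R) by rewrite invr_gt0 ltr0n.
have approx j : exists aN : (nat -> R[i]) * nat, hnorm (S aN.1 aN.2 - y) <= j.+1%:R^-1.
  by have [a [N h]] := hardy_approx lam1 y d1 lamd (inv0 j); exists (a, N).
have {approx} [aN HaN] := choice approx.
(* Padding with zeros allows finite sums of different lengths to be compared at a common length. *)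
pose A j k := if (k < (aN j).2)%N then (aN j).1 k else 0.
have hA j n : ((aN j).2 <= n)%N -> hnorm (S (A j) n - y) <= j.+1%:R^-1.
  by move=> jn; rewrite /A series_pad.
have hAA i j n : ((aN i).2 <= n)%N -> ((aN j).2 <= n)%N ->
    hnorm (S (A i) n - S (A j) n) <= i.+1%:R^-1 + j.+1%:R^-1.
  by move=> ni nj; apply: (le_trans (hnorm_dist_le _ _ y)); apply: lerD; exact: hA.
have lim m : exists c, forall e : R, 0 < e -> exists N, forall i, (N <= i)%N -> normc (A i m - c) <= e.
  apply: (complex_cauchy (u := fun i => A i m)) => e e0.
  have [K K0 HK] := hnorm_coef_dist m.
  have K1 : 0 < 2 * (K + 1) by rewrite mulr_gt0// ltr_wpDl.
  have [N HN] := small_inv (divr_gt0 e0 K1); exists N => i j Ni Nj.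
  pose n := maxn m.+1 (maxn (aN i).2 (aN j).2).
  apply: (le_trans (HK (A i) (A j) n (leq_maxl _ _))).
  have h := hAA i j n ltac:(by rewrite /n !leq_max leqnn orbT) ltac:(by rewrite /n !leq_max leqnn !orbT).
  apply: (@le_trans _ _ (K * (2 * (e / (2 * (K + 1)))))).
    apply: (ler_wpM2l K0); apply: (le_trans h); rewrite mulr_natl mulr2n.
    by apply: lerD; exact: HN.
  have K10 : 0 < K + 1 by rewrite ltr_wpDl.
  have -> : K * (2 * (e / (2 * (K + 1)))) = e * (K / (K + 1)) by field; rewrite gt_eqF.
  by rewrite ler_piMr ?(ltW e0)// ler_pdivrMr// mul1r lerDl.
have {lim} [alpha Halpha] := choice lim.
(* For fixed [n] let [i] grow: [S (A i) n] tends to [S alpha n] coefficientwise, while [S (A i) n]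
   and [S (A j) n] are compared through the sums of length [M], both of which are close to [y]. *)
have main j n : hnorm (S alpha n - S (A j) n) <= C * j.+1%:R^-1.
  apply: (@le_linear_eps _ _ _ (n%:R + C)) => [|e /andP[e0 _]]; first exact: addr_ge0.
  have [N1 H1] := uniform_bound n (fun k => Halpha k e e0).
  have [N2 H2] := small_inv e0; pose i := maxn N1 N2.
  pose M := maxn n (maxn (aN i).2 (aN j).2).
  have h1 : hnorm (S alpha n - S (A i) n) <= n%:R * e.
    rewrite hnorm_distC -seriesB; apply: hnorm_series_le => k kn.
    exact: (H1 i (leq_maxl _ _)).
  have h2 : hnorm (S (A i) n - S (A j) n) <= C * (i.+1%:R^-1 + j.+1%:R^-1).
    rewrite -seriesB; apply: (le_trans (HC _ n M (leq_maxl _ _))); apply: (ler_wpM2l C0).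
    by rewrite seriesB; apply: hAA; rewrite /M !leq_max leqnn /= ?orbT.
  apply: (@le_trans _ _ (n%:R * e + C * (i.+1%:R^-1 + j.+1%:R^-1))).
    apply: le_trans (lerD h1 h2).
    by have := hnorm_triangle (S alpha n - S (A i) n) (S (A i) n - S (A j) n); rewrite addrA subrK.
  have := ler_wpM2l C0 (H2 i (leq_maxr _ _)); rewrite mulrDr mulrDl.
  by set X := C * i.+1%:R^-1; set Y := C * j.+1%:R^-1; set Z := n%:R * e; clear; lra.
suff conv : S alpha @ \oo --> y by exists alpha; split => // d; exact: series_unique conv.
apply/hardy_cvgP => e e0; have C1 : 0 < C + 1 by rewrite ltr_wpDl.
have [j Hj] := small_inv (divr_gt0 e0 C1); exists (aN j).2 => n jn.
apply: (@le_trans _ _ (C * j.+1%:R^-1 + j.+1%:R^-1)).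
  apply: le_trans (lerD (main j n) (hA j n jn)).
  by have := hnorm_triangle (S alpha n - S (A j) n) (S (A j) n - y); rewrite addrA subrK.
rewrite -[X in _ + X]mul1r -mulrDl mulrC -ler_pdivlMr//.
exact: Hj.
Qed.

End basis.

(** * Failure when the points approach the circle *)

Section obstruction.
Context {R : realType} (p : R) (p1 : 1 < p) (lam : nat -> R[i]) (lam1 : in_disc lam).
Implicit Types (a d : nat -> R[i]) (y : hardy (ltW p1)) (e : R).
Local Notation B := (blaschke_hardy (ltW p1) lam1).
Local Notation S a := (series (fun k => a k *: B k)).

Lemma big_nat_single (V : nmodType) (F : nat -> V) i n : (i < n)%N ->
  (forall k, (k < n)%N -> k != i -> F k = 0) -> \sum_(0 <= k < n) F k = F i.
Proof.
move=> iln F0; rewrite big_mkord (bigD1 (Ordinal iln))//= big1 ?addr0// => k ki.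
by apply: F0.
Qed.

Lemma series_delta i n (c : R[i]) : (i < n)%N ->
  S (fun k => (k == i)%:R * c) n = c *: B i.
Proof.
move=> iln; rewrite /series/= (big_nat_single iln) ?eqxx ?mul1r// => k _ /negbTE ->.
by rewrite mul0r scale0r.
Qed.

Definition block n := B n - (lam n.+1)^* *: B n.+1.

Lemma block_small e : 0 < e -> exists2 delta : R, delta < 1 &
  forall n, delta <= normc (lam n.+1) -> hnorm (block n) <= e.
Proof.
move=> e0; have p0 : 0 < p := lt_trans ltr01 p1.
have ep : 0 < e `^ p by rewrite powR_gt0.
have [delta d1 H] := blaschke_block_small p1 ep; exists delta => // n dn.
apply: (powR_le_cancel p0 (hnorm_ge0 _) (ltW e0)); apply: le_trans (H lam n lam1 dn).
rewrite le_eqVlt; apply/orP; left; apply/eqP; apply: hnorm_disc_algebra => [|z z1].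
  apply: disc_algebraB; first exact: disc_algebra_bprod.
  by apply: disc_algebraZ; exact: disc_algebra_bprod.
by rewrite /block hardy_valB hardy_valZ /= /blaschke z1.
Qed.

(* Blocks [block (nu k)] with summable norms and disjoint supports add up to a
   function whose coefficients at the indices [nu k] are 1. *)
Lemma not_schauder_basis :
  (forall (delta : R) M, delta < 1 -> exists2 n, (M <= n)%N & delta <= normc (lam n.+1)) ->
  ~ schauder_basis B.
Proof.
move=> dense SB; pose x : R := 2^-1.
have x01 : 0 <= x < 1 by rewrite /x; apply/andP; split; lra.
have x0 : 0 < x by rewrite /x invr_gt0.
have pickP (kM : nat * nat) : exists n, (kM.2 <= n)%N /\ hnorm (block n) <= x ^+ kM.1.
  have [delta d1 H] := block_small (exprn_gt0 kM.1 x0).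
  by have [n Mn dn] := dense delta kM.2 d1; exists n; split => //; exact: H.
have {pickP} [pick Hpick] := choice pickP.
(* The block at index [m] involves [B_m] and [B_(m+1)]; starting the next search at [m.+2] keeps the
   supports disjoint. *)
pose nu := nat_rect (fun=> nat) (pick (0, 0)%N) (fun k m => pick (k.+1, m.+2)).
have nuS k : ((nu k).+2 <= nu k.+1)%N by have [] := Hpick (k.+1, (nu k).+2).
have nu_lt j k : (j < k)%N -> ((nu j).+2 <= nu k)%N.
  elim: k => // k IH; rewrite ltnS leq_eqVlt => /orP[/eqP -> //|/IH h].
  by apply: (leq_trans h); apply: leq_trans (nuS k); rewrite ltnW.
have nu_ge k : (k <= nu k)%N.
  by elim: k => // k IH; apply: leq_trans (nuS k); rewrite ltnS ltnW// ltnS.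
have nu_small k : hnorm (block (nu k)) <= x ^+ k.
  by case: k => [|k]; [have [] := Hpick (0, 0)%N|have [] := Hpick (k.+1, (nu k).+2)].
pose T K := \sum_(0 <= k < K) block (nu k).
(* The coefficients of [T K]: [1] at each [nu k] and [- conj (lam (nu k).+1)] at the next index. *)
pose E K m : R[i] := \sum_(0 <= k < K) ((m == nu k)%:R * 1 + (m == (nu k).+1)%:R * - (lam (nu k).+1)^*).
have TS K : T K.+1 = T K + block (nu K) by rewrite /T big_nat_recr.
have ES K m : E K.+1 m = E K m + ((m == nu K)%:R * 1 + (m == (nu K).+1)%:R * - (lam (nu K).+1)^*).
  by rewrite /E big_nat_recr.
have ET K n : (nu K <= n)%N -> S (E K) n = T K.
  elim: K => [|K IH] h.
    rewrite /T big_geq// /series/= big1// => k _.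
    by rewrite /E big_geq// scale0r.
  have h2 : ((nu K).+2 <= n)%N by exact: leq_trans (nuS K) h.
  rewrite TS -(IH (ltnW (ltnW h2))).
  have -> : block (nu K) = S (fun k => (k == nu K)%:R * 1) n
      + S (fun k => (k == (nu K).+1)%:R * - (lam (nu K).+1)^*) n.
    by rewrite !series_delta ?scale1r ?scaleNr// ltnW.
  rewrite /series/= -!big_split/=; apply: eq_bigr => k _.
  by rewrite ES -!scalerDl.
have E1 K j : (j < K)%N -> E K (nu j) = 1.
  move=> jK; rewrite /E (big_nat_single jK) => [|k _ kj].
    by rewrite eqxx mulr1 ltn_eqF// mul0r addr0.
  have [kj'|jk|/eqP] := ltngtP k j; last by rewrite (negbTE kj).
    have h := nu_lt _ _ kj'.
    by rewrite (gtn_eqF (ltnW h)) (gtn_eqF h) !mul0r addr0.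
  have h := nu_lt _ _ jk.
  by rewrite (ltn_eqF (ltnW h)) (ltn_eqF (leq_trans (ltnW h) (leqnSn _))) !mul0r addr0.
(* With [x = 1/2] one has [x^i = 2 (x^i - x^(i+1))], so the bounds on the blocks telescope. *)
have Tgap i (d : nat) : hnorm (T (i + d)%N - T i) <= 2 * (x ^+ i - x ^+ (i + d)).
  elim: d => [|d IH]; first by rewrite addn0 !subrr mulr0 hnorm_zero.
  rewrite addnS TS addrAC; apply: (le_trans (hnorm_triangle _ _)).
  have h := nu_small (i + d)%N; apply: (le_trans (lerD IH h)).
  by rewrite exprS /x; set X := 2^-1 ^+ (i + d); set Y := 2^-1 ^+ i; clear; lra.
have Tle i k : (i <= k)%N -> hnorm (T k - T i) <= 2 * x ^+ i.
  move=> ik; have := Tgap i (k - i)%N; rewrite subnKC// => h; apply: (le_trans h).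
  by rewrite ler_pM2l// gerBl exprn_ge0// ltW.
have [|e e0|y Ty] := @hardy_cauchy_limit R p (ltW p1) T.
- move=> K; exists (bsum lam (E K) (nu K)); first exact: disc_algebra_bsum.
  by move=> z z1; rewrite -(ET K (nu K))// val_series.
- have e4 : 0 < e / 4 by rewrite divr_gt0.
  have [N HN] := expr_lt_eps x01 e4; exists N => i j Ni Nj.
  apply: (le_trans (hnorm_dist_le _ _ (T N))).
  by have := Tle N i Ni; have := Tle N j Nj; move: HN; clear; lra.
move/hardy_cvgP : Ty => Ty.
have [alpha [/hardy_cvgP Sy _]] := SB y.
(* For long sums, [S alpha n] and [T k = S (E k) n] are both close to [y], hence so are their
   coefficients at [nu j]; that of [T k] is exactly [1]. *)
have alpha1 j : alpha (nu j) = 1.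
  have [K K0 HK] := hnorm_coef_dist p1 lam1 (nu j).
  apply/eqP; rewrite -subr_eq0; apply/eqP/eq0_normc/eqP; rewrite eq_le normc_ge0 andbT.
  apply: (@le_linear_eps _ _ _ (K * 2)) => [|e /andP[e0 _]]; first exact: mulr_ge0.
  have [N1 H1] := Sy e e0; have [N2 H2] := Ty e e0.
  pose k := maxn j.+1 N2; pose n := maxn (nu j).+1 (maxn N1 (nu k)).
  have h1 := H1 n ltac:(by rewrite /n !leq_max leqnn orbT).
  have h2 := H2 k (leq_maxr _ _).
  have h := HK alpha (E k) n (leq_maxl _ _).
  rewrite (E1 k j (leq_maxl _ _)) (ET k n) in h; last by rewrite /n !leq_max leqnn !orbT.
  rewrite add0r -mulrA; apply: (le_trans h); apply: (ler_wpM2l K0).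
  by apply: (le_trans (hnorm_dist_le _ _ y)); rewrite mulr_natl mulr2n; exact: lerD h1 h2.
(* Consecutive partial sums beyond [N] differ by at most [1/2], but at index [nu N] they differ by
   [B (nu N)], which has norm [1]. *)
have [|N HN] := Sy 4^-1; first by rewrite invr_gt0.
have Nn : (N <= nu N)%N := nu_ge N.
have h := hnorm_dist_le (S alpha (nu N).+1) (S alpha (nu N)) y.
have step : S alpha (nu N).+1 - S alpha (nu N) = alpha (nu N) *: B (nu N).
  by rewrite /series/= big_nat_recr//= addrAC subrr add0r.
rewrite step hnorm_scale hnorm_blaschke alpha1 normc1 mulr1 in h.
by have := HN _ Nn; have := HN _ (leqW Nn); move: h; clear; lra.
Qed.

End obstruction.

Theorem theorem6p1 (R : realType) (p : R) (p1 : 1 < p) (lam : nat -> R[i])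
    (lam1 : forall n, (1 <= n)%N -> normc (lam n) < 1) :
  schauder_basis (blaschke_hardy (ltW p1) lam1) <->
  sup [set normc (lam n) | n in [set n | (1 <= n)%N]] < 1.
Proof.
set E := [set _ | _ in _]; have E0 : E !=set0 by exists (normc (lam 1%N)); exists 1%N.
have Eub : has_ubound E by exists 1 => _ [k k1 <-]; rewrite ltW// lam1.
split=> [SB|supE]; last first.
  have lamd k : (1 <= k)%N -> normc (lam k) <= sup E.
    by move=> k1; apply: ub_le_sup => //; exists k.
  exact: (@schauder_basis_separated R p p1 lam lam1 _ supE lamd).
rewrite ltNge; apply/negP => sup1; apply: (@not_schauder_basis R p p1 lam lam1) SB => delta M d1.
apply: contrapT => H.
(* The finitely many points with index at most [M] stay below some [mu < 1], so a supremum of at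
   least [1] must come from larger indices. *)
have [mu mu1 Hmu] : exists2 mu : R, mu < 1 & forall k, (1 <= k <= M)%N -> normc (lam k) <= mu.
  elim: M {H} => [|M [mu mu1 IH]].
    by exists 0 => // k /andP[k1]; rewrite leqn0 => /eqP k0; rewrite k0 in k1.
  exists (Num.max mu (normc (lam M.+1))); first by rewrite gt_max mu1 lam1.
  move=> k /andP[k1]; rewrite leq_eqVlt => /orP[/eqP ->|kM]; rewrite le_max ?lexx ?orbT//.
  by rewrite IH// k1.
suff : sup E <= Num.max delta mu by apply/negP; rewrite -ltNge (lt_le_trans _ sup1)// gt_max d1.
apply: ge_sup => // _ [k k1 <-]; rewrite le_max; have [kM|Mk] := leqP k M.
  by rewrite Hmu ?orbT// kM andbT.
apply/orP; left; rewrite leNgt; apply/negP => lt.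
apply: H; case: k k1 Mk lt => // k _ Mk lt; exists k => //; exact: ltW.
Qed.
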